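(* Let $G$ be a non-elementary finitely presented group which is hyperbolic relative to a family $\mathcal{P}=\{P_1,\dots,P_n\}$ of finitely generated groups. Let $\mathrm{Out}(G;\mathcal{P})$ denote the subgroup of $\mathrm{Out}(G)$ preserving the conjugacy classes of the $P_i$, but allowing permutation of the $P_i$. Then $G$ has infinitely many twisted conjugacy classes with respect to any $\Phi\in\mathrm{Out}(G;\mathcal{P})$; that is, $G$ has property $R_\infty(\Phi)$ for every $\Phi\in\mathrm{Out}(G;\mathcal{P})$.
   Context: Relative hyperbolicity is in the usual (Gromov--Bowditch--Osin) sense. Non-elementary means that $G$ is not virtually cyclic and is not equal to any $P_i$. An outer automorphism $\Phi$ lies in $\mathrm{Out}(G;\mathcal{P})$ if it permutes the set of conjugacy classes of the subgroups $P_1,\dots,P_n$. Twisted conjugacy: for a group $G$ and $\varphi\in\mathrm{Aut}(G)$ (acting on the right), write $x\sim_\varphi y$ if there is $w\in G$ with $(w\varphi)\,x\,w^{-1}=y$; this is an equivalence relation on $G$. $G$ has property $R_\infty(\varphi)$ if $\sim_\varphi$ has infinitely many equivalence classes. For $\Phi\in\mathrm{Out}(G)$, $G$ has $R_\infty(\Phi)$ if it has $R_\infty(\varphi)$ for some (equivalently, every) automorphism $\varphi\in\Phi$. *)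

(* Defs.v *)
(* Groups are (possibly infinite) groupTypes; subsets of a group are Prop-valued
   classical sets. *)
From HB Require Import structures.
From mathcomp Require Import all_boot.
From mathcomp Require Import boolp classical_sets functions cardinality.

Set Implicit Arguments.
Unset Strict Implicit.
Unset Printing Implicit Defensive.

Local Open Scope classical_set_scope.
Local Open Scope group_scope.

Section Subgroups.
Variable G : groupType.
Implicit Types (H S : set G) (f : G -> G).

Definition is_subgroup H : Prop :=
  [/\ H 1, forall x y, H x -> H y -> H (x * y) & forall x, H x -> H x^-1].

Definition generated S : set G := smallest is_subgroup S.

Definition finitely_generated H : Prop :=
  exists S, finite_set S /\ H = generated S.

Definition cyclic_subgroup H : Prop := exists c, H = generated [set c].

Definition finite_index H : Prop :=
  finite_set (range (fun g : G => [set g * h | h in H])).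

Definition virtually_cyclic : Prop :=
  exists H, [/\ is_subgroup H, cyclic_subgroup H & finite_index H].

Definition conj_class H : set (set G) :=
  range (fun g : G => [set h ^ g | h in H]).

Definition Aut : set (G -> G) :=
  [set f | {morph f : x y / x * y} /\ bijective f].

(* Out(G) = Aut(G) / Inn(G): an outer automorphism is the coset, modulo inner
   automorphisms, of an automorphism. *)
Definition Out : set (set (G -> G)) :=
  [set [set (fun x => f x ^ g) | g in [set: G]] | f in Aut].

End Subgroups.

Arguments Aut G : clear implicits.
Arguments Out G : clear implicits.
Arguments virtually_cyclic G : clear implicits.

(* Elements of the free product F = P_1 * ... * P_n * F(X), where F(X) is the
   free group with basis X, are represented by words up to [word_eq]. *)
Section RelativePresentations.
Variables (G : groupType) (n : nat) (P : 'I_n -> set G) (X : set G).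

(* [Gen x b] stands for x if b, and for its formal inverse otherwise. *)
Inductive letter : Type :=
| Gen (x : X) (b : bool)
| Per (i : 'I_n) (h : P i).

Definition word := seq letter.

Inductive word_eq : word -> word -> Prop :=
| word_eq_refl u : word_eq u u
| word_eq_sym u v : word_eq u v -> word_eq v u
| word_eq_trans u v w : word_eq u v -> word_eq v w -> word_eq u w
| word_eq_cat u u' v v' :
    word_eq u u' -> word_eq v v' -> word_eq (u ++ v) (u' ++ v')
| word_eq_gen x b : word_eq [:: Gen x b; Gen x (~~ b)] [::]
| word_eq_per1 i (h : P i) : \val h = 1 -> word_eq [:: Per h] [::]
| word_eq_perM i (h k l : P i) :
    \val h * \val k = \val l -> word_eq [:: Per h; Per k] [:: Per l].

Definition word_inv (u v : word) : Prop := word_eq (u ++ v) [::].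

Definition letter_val (l : letter) : G :=
  match l with
  | Gen x b => if b then \val x else (\val x)^-1
  | Per _ h => \val h
  end.

Definition word_val (w : word) : G := \prod_(l <- w) letter_val l.

(* [conj_prod R k w]: in F, w is a product of k conjugates f^-1 r^{+-1} f of
   elements r of R and of their inverses. *)
Inductive conj_prod (R : set word) : nat -> word -> Prop :=
| conj_prod0 w : word_eq w [::] -> conj_prod R 0 w
| conj_prodS k u w f f' r r' :
    R r -> r' = r \/ word_inv r r' -> word_inv f f' ->
    conj_prod R k u -> word_eq w (f' ++ r' ++ f ++ u) ->
    conj_prod R k.+1 w.

(* G = < X, P_1, ..., P_n | R >: X and the P_i generate G, and the kernel of
   F -> G is the normal closure of R. *)
Definition relative_presentation (R : set word) : Prop :=
  generated (X `|` \bigcup_i P i) = [set: G] /\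
  forall w, word_val w = 1 <-> exists k, conj_prod R k w.

Definition relative_area_le (R : set word) (w : word) (m : nat) : Prop :=
  exists2 k, (k <= m)%N & conj_prod R k w.

(* Words may contain letters [Per h] with h trivial; erasing them does not
   change the area and decreases the length, so this is the same condition as
   on words in the alphabet with non-trivial peripheral letters only. *)
Definition linear_relative_dehn (R : set word) : Prop :=
  exists C : nat,
    forall w, word_val w = 1 -> relative_area_le R w (C * size w)%N.

End RelativePresentations.

Section RelativeHyperbolicity.
Variable G : groupType.

(* A presentation relative to the empty family is an ordinary presentation. *)
Definition finitely_presented : Prop :=
  let P0 := fun _ : 'I_0 => set0 : set G in
  exists (X : set G) (R : set (word P0 X)),
    [/\ finite_set X, finite_set R & relative_presentation R].

Variables (n : nat) (P : 'I_n -> set G).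

(* Osin's definition. *)
Definition relatively_hyperbolic : Prop :=
  exists (X : set G) (R : set (word P X)),
    [/\ finite_set X, finite_set R, relative_presentation R
      & linear_relative_dehn R].

Definition non_elementary : Prop :=
  ~ virtually_cyclic G /\ forall i, P i <> [set: G].

Definition peripheral_classes : set (set (set G)) :=
  range (fun i => conj_class (P i)).

(* The action of an outer automorphism on conjugacy classes of subgroups. *)
Definition outer_image (Phi : set (G -> G)) (C : set (set G)) : set (set G) :=
  [set K | exists f H, [/\ Phi f, C H & K = f @` H]].

Definition relative_Out : set (set (G -> G)) :=
  [set Phi | Out G Phi /\
             outer_image Phi @` peripheral_classes = peripheral_classes].

End RelativeHyperbolicity.

Arguments finitely_presented G : clear implicits.

Section TwistedConjugacy.
Variable G : groupType.

Definition twisted_conj (f : G -> G) (x y : G) : Prop :=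
  exists w, f w * x * w^-1 = y.

Definition R_infty (f : G -> G) : Prop :=
  infinite_set (range (fun x => [set y | twisted_conj f x y])).

(* R_infty f does not depend on the representative f of Phi. *)
Definition R_infty_outer (Phi : set (G -> G)) : Prop :=
  exists2 f, Phi f & R_infty f.

End TwistedConjugacy.

(* Main.v *)
(* Let d be the word metric of G with respect to X and all the P_i.  A linear relative
   Dehn function bounds the area of cycles in the coned-off Cayley graph, hence gives the
   Morse lemma, hyperbolicity and acylindricity for d, and so, with the same constants,
   for all pullbacks d_t of d by automorphisms t preserving the peripheral structure.
   The translation length of a suitable loxodromic h dominates the minimal joint
   displacement of a finite generating set in all the metrics d_t at once.  As G is not
   virtually cyclic, the representative f of Phi can be chosen so that h and f^-1(h) are
   not commensurable.

   Finitely many twisted conjugacy classes would give a constant C such that for every x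
   some v satisfies d(psi v, v) <= C, where psi(y) = x^-1 f(y).  Take x = h^M.  In the
   metrics d_k pulled back by the f^-k, psi is an isometry from d_k to d_(k+1), and it
   moves the centres q_k of the generating set far along the axis of h; the point
   psi^k(v) lies behind or ahead of q_k, and comparing consecutive metrics at the k where
   it is nearest to q_k is contradictory for large M. *)
Require Import Defs.
From HB Require Import structures.
From mathcomp Require Import all_boot.
From mathcomp Require Import order ssralg ssrnum ssrint zify.
From mathcomp Require Import boolp classical_sets functions cardinality.

Set Implicit Arguments.
Unset Strict Implicit.
Unset Printing Implicit Defensive.

(** * Growth estimates *)

(** The obstacle is that an automorphism preserving the peripheral structure is only bilipschitz for
    [d], with constants that get out of control under iteration. Its pullbacks are exact copies of
    [d], so one four-point constant and one pair of acylindricity functions serve them all, and only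
    neighbouring metrics are compared, at the fixed cost of one application of [f]. No bound on
    [mdisp (d k) h] uniform in [k] is available, so estimates in [d k] are made in multiples of this
    number. As [d] need not be proper, finiteness comes from counting: acylindricity, or the finite
    set of relators. Domination by [h] is arranged for all bilipschitz automorphisms at once because
    the representative [f] is chosen only after [h]. Areas are handled by integral chains paired
    with cochains instead of planar diagrams: a Lipschitz function calibrates a quasi-geodesic, a
    clipped height shows where two geodesics must come together, a truncated length detects long
    peripheral letters. *)

Lemma exp2_dominates E : exists s0, forall s, s0 <= s -> E * s.+1 < 2 ^ s.
Proof.
exists (4 * E + 2) => s sE.
have [a sa] : exists a, (s = 2 * a \/ s = (2 * a).+1)%N by exists (s %/ 2); lia.
have -> : s = (a + (s - a))%N by lia.
rewrite expnD.
have h1 : a < 2 ^ a by exact: ltn_expl.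
have h2 : s - a < 2 ^ (s - a) by exact: ltn_expl.
have := leq_mul h1 h2; apply: leq_trans.
have : 2 * E + 1 <= a by lia.
nia.
Qed.

(** Exponential growth in a number of steps proportional to [D] cannot stay below a linear bound in
    [D]. In [morse], [D] is the distance to be bounded. *)
Lemma log_bounded c E : exists B, forall D,
  (forall s, s * c < D -> 2 ^ s <= E * D) -> D <= B.
Proof.
have [s0 H] := exp2_dominates (E * c.+1).
exists (s0 * c.+1 + c.+1)%N => D HD; rewrite leqNgt; apply/negP => DB.
pose s := (D.-1 %/ c.+1).
have D1 : (D.-1 = s * c.+1 + D.-1 %% c.+1)%N := divn_eq _ _.
have r : D.-1 %% c.+1 < c.+1 by rewrite ltn_mod.
have s0s : s0 <= s by rewrite /s leq_divRL //; lia.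
have /HD : s * c < D by nia.
have := H s s0s; have : D <= s.+1 * c.+1 by nia.
move: (2 ^ s) => e; nia.
Qed.

(** Each step of length [L] loses at least the fraction 1/[E] of the current value. Over [E] steps
    every loss is at least [A (t + E * L)] / [E]; the losses add up to at least [A (t + E * L)],
    which is therefore at most half of [A t]. *)
Lemma halving (A : nat -> nat) L E : (forall t, A t + E * A (t + L) <= E * A t) ->
  forall s t, 2 ^ s * A (t + s * (E * L)) <= A t.
Proof.
move=> AE; have step t : A (t + L) <= A t.
  have := AE t; case: E AE => [|E] AE; first by have := AE (t + L); lia.
  by move=> H; rewrite -(leq_pmul2l (ltn0Sn E)); move: (A _) (A _) H => *; lia.
have mono t k : A (t + k * L) <= A t.
  elim: k => [|k IH]; first by rewrite mul0n addn0.
  by apply: leq_trans IH; rewrite mulSnr addnA.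
have drop t k : k * A (t + k * L) + E * A (t + k * L) <= E * A t.
  elim: k => [|k IH]; first by rewrite mul0n addn0.
  have := AE (t + k * L); have := step (t + k * L); rewrite -addnA -mulSnr.
  move=> xy; have := leq_mul (leqnn k) xy; move: xy; rewrite [in k.+1 * A _]mulSn.
  move: (A (t + k.+1 * L)) (A (t + k * L)) (A t) IH => x y z.
  move: (k * x) (k * y) (E * x) (E * y) (E * z) => *; lia.
have half t : 2 * A (t + E * L) <= A t.
  have := drop t E; have := AE t; case: E {AE drop} => [|E]; first by rewrite !mul0n !addn0; lia.
  by move=> _; rewrite -mulnDr leq_mul2l /= mul2n addnn.
elim=> [|s IH] t; first by rewrite mul0n addn0 mul1n.
apply: leq_trans (half t); rewrite expnS -mulnA leq_mul2l /=.
by have := IH (t + E * L); rewrite mulSn addnA.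
Qed.

(** Bookkeeping for [morse]: [e] is the power of two given by [halving], [a0] the area at level 0,
    [sb] the size of the return path and [m'] the number of steps of the subpath. What matters is
    that the bound on [e] is linear in [D]. *)
Lemma morse_arith C K D e a0 As sb m' :
  e * As <= a0 -> 0 < As -> a0 <= C * (2 * K * m' + sb) + m' ->
  sb <= 4 * D + 2 * (2 * D + K * (2 * (4 * K * D))) -> m' <= 2 * (4 * K * D) ->
  e <= (C * (2 * K + 1) + 1) * (8 * K + 4 + 2 * (2 + 8 * K * K)) * D.
Proof.
move=> h1 h2 h3 h4 h5.
have e1 : e <= a0 by nia.
apply: leq_trans e1 _; apply: leq_trans h3 _.
have h6 : 2 * K * m' + sb <= (32 * K * K + 8) * D.
  have : 2 * K * m' <= 2 * K * (2 * (4 * K * D)) by rewrite leq_mul2l h5 orbT.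
  move: h4; nia.
have h7 : C * (2 * K * m' + sb) <= C * ((32 * K * K + 8) * D) by rewrite leq_mul2l h6 orbT.
apply: leq_trans (leq_add h7 h5) _.
have -> : (C * (2 * K + 1) + 1) * (8 * K + 4 + 2 * (2 + 8 * K * K)) * D =
  C * ((2 * K + 1) * (8 * K + 4 + 2 * (2 + 8 * K * K)) * D)
  + (8 * K + 4 + 2 * (2 + 8 * K * K)) * D by nia.
apply: leq_add; last by nia.
rewrite leq_mul2l; apply/orP; right; rewrite leq_mul2r; apply/orP; right; nia.
Qed.

Local Open Scope group_scope.

(** * Word metrics *)

Section LeftInvariantMetrics.
Variable G : groupType.
Implicit Types (d : G -> G -> nat) (g x y z : G).

Record geodesic_metric d : Prop := GeodesicMetric {
  dist_refl : forall x, d x x = 0;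
  dist_sym : forall x y, d x y = d y x;
  dist_tri : forall y x z, d x z <= d x y + d y z;
  dist_inv : forall g x y, d (g * x) (g * y) = d x y;
  dist_geo : forall x y t, t <= d x y ->
    exists2 m, d x m = t & d m y = d x y - t }.

End LeftInvariantMetrics.

Section WordMetric.
Variables (G : groupType) (n : nat) (P : 'I_n -> set G) (X : set G).
Local Notation word := (word P X).
Local Notation letter := (letter P X).
Implicit Types (w u v : word) (l : letter) (g x y : G).

Lemma word_val_cat u v : word_val (u ++ v) = word_val u * word_val v.
Proof. by rewrite /word_val big_cat. Qed.

Lemma word_val_nil : word_val ([::] : word) = 1.
Proof. by rewrite /word_val big_nil. Qed.

Lemma word_val_cons l w : word_val (l :: w) = letter_val l * word_val w.
Proof. by rewrite /word_val big_cons. Qed.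

Lemma word_val1 l : word_val [:: l] = letter_val l.
Proof. by rewrite /word_val big_seq1. Qed.

Lemma word_eq_val u v : word_eq u v -> word_val u = word_val v.
Proof.
elim=> {u v} //.
- by move=> u v w _ -> _ ->.
- by move=> u u' v v' _ Hu _ Hv; rewrite !word_val_cat Hu Hv.
- move=> x b; rewrite !word_val_cons word_val_nil /= mulg1.
  by case: b; rewrite /= ?mulgV ?mulVg.
- by move=> i h h1; rewrite word_val1 word_val_nil.
- by move=> i h k l hk; rewrite !word_val_cons word_val_nil mulg1 /= hk mulg1.
Qed.

Hypothesis P_sub : forall i, is_subgroup (P i).
Hypothesis gen : generated (X `|` \bigcup_i P i)%classic = [set: G]%classic.

Lemma per_inv (i : 'I_n) (h : P i) : exists k : P i, \val k = (\val h)^-1.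
Proof.
have [_ _ V] := P_sub i.
exists (SigSub (mem_set (V _ (set_mem (valP h))))); by [].
Qed.

Lemma letter_inv l : exists l' : letter, letter_val l' = (letter_val l)^-1.
Proof.
case: l => [x b|i h].
  by exists (Gen P x (~~ b)); case: b => //=; rewrite invgK.
by have [k kh] := per_inv h; exists (Per X k).
Qed.

Lemma word_inv_ex w : exists2 w' : word, word_val w' = (word_val w)^-1 & size w' = size w.
Proof.
elim: w => [|l w [w' w'v w's]].
  by exists [::] => //; rewrite word_val_nil invg1.
have [l' l'v] := letter_inv l.
exists (rcons w' l'); last by rewrite size_rcons w's.
by rewrite -cats1 word_val_cat word_val1 word_val_cons invgM w'v l'v.
Qed.

Lemma ex_word g : exists w : word, word_val w = g.
Proof.
have: [set: G]%classic g by [].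
rewrite -gen; move: g.
apply: (@smallest_sub _ _ _ [set g | exists w : word, word_val w = g]%classic).
  split.
  - by exists [::]; rewrite word_val_nil.
  - by move=> x y [u <-] [v <-]; exists (u ++ v); rewrite word_val_cat.
  - by move=> x [u <-]; have [u' u'v _] := word_inv_ex u; exists u'.
move=> x [Xx|[i _ Px]].
  by exists [:: Gen P (SigSub (mem_set Xx)) true]; rewrite word_val1.
by exists [:: Per X (SigSub (mem_set Px))]; rewrite word_val1.
Qed.

Lemma ex_word_size g : exists k, `[< exists2 w : word, size w = k & word_val w = g >].
Proof. by have [w wg] := ex_word g; exists (size w); apply/asboolP; exists w. Qed.

Definition wlen g : nat := ex_minn (ex_word_size g).

Lemma wlenP g : exists2 w : word, size w = wlen g & word_val w = g.
Proof. by rewrite /wlen; case: ex_minnP => m /asboolP. Qed.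

Lemma wlen_le w : wlen (word_val w) <= size w.
Proof. by rewrite /wlen; case: ex_minnP => m _; apply; apply/asboolP; exists w. Qed.

Lemma wlen1 : wlen 1 = 0.
Proof. by apply/eqP; rewrite -leqn0 -word_val_nil wlen_le. Qed.

Lemma wlenM g x : wlen (g * x) <= wlen g + wlen x.
Proof.
have [u <- <-] := wlenP g; have [v <- <-] := wlenP x.
by rewrite -word_val_cat -size_cat wlen_le.
Qed.

Lemma wlenV_le g : wlen g^-1 <= wlen g.
Proof.
have [u us uv] := wlenP g; have [v vv vs] := word_inv_ex u.
by rewrite -us -vs -uv -vv wlen_le.
Qed.

Lemma wlenV g : wlen g^-1 = wlen g.
Proof.
by apply/eqP; rewrite eqn_leq wlenV_le; have := wlenV_le g^-1; rewrite invgK.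
Qed.

Lemma wlen_take w j : wlen (word_val w) = size w -> j <= size w ->
  wlen (word_val (take j w)) = j /\ wlen (word_val (drop j w)) = size w - j.
Proof.
move=> Hw jw.
have := wlenM (word_val (take j w)) (word_val (drop j w)).
rewrite -word_val_cat cat_take_drop Hw.
have := wlen_le (take j w); have := wlen_le (drop j w).
rewrite size_drop size_takel //; lia.
Qed.

Definition wdist x y : nat := wlen (x^-1 * y).

Lemma wdist_metric : geodesic_metric wdist.
Proof.
rewrite /wdist; split.
- by move=> x; rewrite mulVg wlen1.
- by move=> x y; rewrite -wlenV invgM invgK.
- move=> y x z; rewrite (_ : x^-1 * z = (x^-1 * y) * (y^-1 * z)) ?wlenM //.
  by rewrite -mulgA mulVKg.
- by move=> g x y; rewrite invgM -mulgA mulKg.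
- move=> x y t; have [w ws wv] := wlenP (x^-1 * y).
  rewrite -ws => tw; have [|ht hd] := @wlen_take w t _ tw; first by rewrite wv ws.
  exists (x * word_val (take t w)); rewrite ?mulKg //.
  rewrite invgM -mulgA -wv -{2}(cat_take_drop t w) word_val_cat mulKg //.
Qed.

End WordMetric.

Section RelativePresentation.
Import GRing.Theory Num.Theory Order.TTheory.

(** * Chains in the coned-off Cayley graph *)

Section ConedOffChains.
Variables (G : groupType) (n : nat) (P : 'I_n -> set G) (X : set G).
Local Notation word := (word P X).
Local Notation letter := (letter P X).
Implicit Types (w : word) (g x y : G).

(** An edge at [g] is a Cayley edge labelled by a generator, or a half-edge from [g] to the cone
    point over the coset of [P i]. A peripheral letter becomes two half-edges, so each infinite
    alphabet [P i] needs only one edge per element of [G]. *)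
Definition edge : Type := (G * (X + 'I_n))%type.
Definition arc : Type := (bool * edge)%type.
Definition vertex : Type := (G + 'I_n * G)%type.
HB.instance Definition _ := Equality.on edge.
HB.instance Definition _ := Equality.on arc.
HB.instance Definition _ := Equality.on vertex.
Implicit Types (e : edge) (a : arc) (l t : seq arc) (f : edge -> int)
  (u : vertex -> int).

(** [xget] depends only on the set, so all elements of a coset get the same cone point and cone
    points can be compared by equality. *)
Definition coset_rep (i : 'I_n) g : G := xget 1 [set g * h | h in P i]%classic.

Definition edge_src e : vertex := inl e.1.
Definition edge_tgt e : vertex :=
  match e.2 with
  | inl x => inl (e.1 * \val x)
  | inr i => inr (i, coset_rep i e.1)
  end.
Definition arc_src a := if a.1 then edge_src a.2 else edge_tgt a.2.
Definition arc_tgt a := if a.1 then edge_tgt a.2 else edge_src a.2.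

(** Integral chains are lists of signed edges, identified when all cochains agree on them.
    Cancellation thus becomes an identity between integers. *)
Definition pairing f l : int :=
  (\sum_(a <- l) (if a.1 then f a.2 else - f a.2))%R.
Definition cobd u e : int := (u (edge_tgt e) - u (edge_src e))%R.
Definition chain_opp l : seq arc := [seq (~~ a.1, a.2) | a <- l].
Definition is_cycle l := forall u, pairing (cobd u) l = 0%R.
Definition chain_eq l1 l2 := forall f, pairing f l1 = pairing f l2.

Lemma pairing_nil f : pairing f [::] = 0%R.
Proof. by rewrite /pairing big_nil. Qed.

Lemma pairing_cons f a l :
  pairing f (a :: l) = ((if a.1 then f a.2 else - f a.2) + pairing f l)%R.
Proof. by rewrite /pairing big_cons. Qed.

Lemma pairing_cat f l1 l2 :
  pairing f (l1 ++ l2) = (pairing f l1 + pairing f l2)%R.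
Proof. by rewrite /pairing big_cat. Qed.

Lemma pairing_opp f l : pairing f (chain_opp l) = (- pairing f l)%R.
Proof.
elim: l => [|[b e] l IH]; first by rewrite !pairing_nil.
by rewrite /= !pairing_cons IH /=; case: b => /=; lia.
Qed.

Lemma pairing_perm f l1 l2 : perm_eq l1 l2 -> pairing f l1 = pairing f l2.
Proof. by move=> l12; rewrite /pairing (perm_big _ l12). Qed.

Lemma pairing_filter f (Q : pred edge) l :
  pairing f [seq a <- l | Q a.2] = pairing (fun e => if Q e then f e else 0%R) l.
Proof.
elim: l => [|a l IH] //=; first by rewrite !pairing_nil.
case: ifP => Qa; rewrite !pairing_cons Qa IH //.
by case: a.1; rewrite ?oppr0 add0r.
Qed.

Lemma eq_pairing f1 f2 l : (forall a, a \in l -> f1 a.2 = f2 a.2) ->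
  pairing f1 l = pairing f2 l.
Proof.
elim: l => [|a l IH] H; first by rewrite !pairing_nil.
rewrite !pairing_cons H ?mem_head // IH // => b bl; apply: H.
by rewrite inE bl orbT.
Qed.

Lemma pairing_bound f l (c : nat) :
  (forall a, a \in l -> `|f a.2| <= c%:Z)%R -> (`|pairing f l| <= (c * size l)%:Z)%R.
Proof.
elim: l => [|a l IH] H; first by rewrite pairing_nil.
rewrite pairing_cons /=.
have Ha := H a (mem_head _ _).
have := IH (fun b bl => H b (mem_behead (s := a :: l) bl)).
by case: a.1; nia.
Qed.

Definition letter_arcs g (l : letter) : seq arc :=
  match l with
  | Gen x true => [:: (true, (g, inl x))]
  | Gen x false => [:: (false, (g * (\val x)^-1, inl x))]
  | @Per _ _ _ _ i h => [:: (true, (g, inr i)); (false, (g * \val h, inr i))]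
  end.

Fixpoint word_arcs g w : seq arc :=
  if w is l :: w' then letter_arcs g l ++ word_arcs (g * letter_val l) w' else [::].

Lemma word_arcs_cat g (u v : word) :
  word_arcs g (u ++ v) = word_arcs g u ++ word_arcs (g * word_val u) v.
Proof.
elim: u g => [|l u IH] g /=; first by rewrite word_val_nil mulg1.
by rewrite IH word_val_cons mulgA catA.
Qed.

Lemma size_word_arcs g w : size (word_arcs g w) <= 2 * size w.
Proof.
elim: w g => // l w IH g /=; rewrite size_cat.
have := IH (g * letter_val l).
by case: l => [x []|i h] /=; lia.
Qed.

Hypothesis P_sub : forall i, is_subgroup (P i).

Lemma coset_repM i g h : P i h -> coset_rep i (g * h) = coset_rep i g.
Proof.
move=> Ph; have [_ PM PV] := P_sub i.
rewrite /coset_rep; congr (xget _ _); rewrite eqEsubset; split=> z [k Pk <-].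
  by exists (h * k); [exact: PM|rewrite mulgA].
by exists (h^-1 * k); [apply: PM => //; exact: PV|rewrite -mulgA mulVKg].
Qed.

Lemma coset_rep_mem i g : exists2 h, P i h & coset_rep i g = g * h.
Proof.
have [P1 _ _] := P_sub i.
have /= [] := @xgetPex _ 1 [set g * h | h in P i]%classic; last first.
  by move=> h Ph E; exists h.
by exists g, 1 => //; rewrite mulg1.
Qed.

Lemma coset_rep_eq i g g' : coset_rep i g = coset_rep i g' -> P i (g^-1 * g').
Proof.
have [_ PM PV] := P_sub i.
have [h Ph ->] := coset_rep_mem i g; have [h' Ph' ->] := coset_rep_mem i g'.
move=> E; have -> : g^-1 * g' = h * h'^-1.
  by rewrite -(mulgK h' g') -E !mulgA mulVg mul1g.
by apply: PM => //; exact: PV.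
Qed.

Lemma pairing_cobd_word u g w :
  pairing (cobd u) (word_arcs g w) = (u (inl (g * word_val w)%g) - u (inl g))%R.
Proof.
elim: w g => [|l w IH] g /=.
  by rewrite pairing_nil word_val_nil mulg1 subrr.
rewrite pairing_cat IH word_val_cons mulgA.
have -> : pairing (cobd u) (letter_arcs g l) = (u (inl (g * letter_val l)%g) - u (inl g))%R.
  case: l => [x []|i h] /=; rewrite !pairing_cons pairing_nil /= /cobd /edge_tgt /edge_src /=.
  - by rewrite addr0.
  - by rewrite mulgVK; lia.
  - by rewrite (coset_repM _ (set_mem (valP h))); lia.
by rewrite [LHS]addrC addrA subrK.
Qed.

Lemma word_arcs_cycle g w : word_val w = 1 -> is_cycle (word_arcs g w).
Proof. by move=> w1 u; rewrite pairing_cobd_word w1 mulg1 subrr. Qed.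

(** The relations inside each [P i] already hold for chains, because opposite half-edges cancel.
    Only relators of [R] cost area. *)
Lemma pairing_word_eq f (v w : word) : word_eq v w ->
  forall g, pairing f (word_arcs g v) = pairing f (word_arcs g w).
Proof.
elim=> {v w} //.
- by move=> u v w _ IH1 _ IH2 g; rewrite IH1 IH2.
- move=> u u' v v' uu' IHu _ IHv g; rewrite !word_arcs_cat !pairing_cat.
  by rewrite IHu IHv (word_eq_val uu').
- move=> x b g; case: b; rewrite /= !pairing_cons !pairing_nil /=.
    by rewrite mulgK addr0 subrr.
  by rewrite addr0 addNr.
- by move=> i h h1 g; rewrite /= !pairing_cons !pairing_nil /= h1 mulg1 addr0 subrr.
- move=> i h k l hkl g; rewrite /= !pairing_cons !pairing_nil /=.
  by rewrite -mulgA hkl addr0 addKr.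
Qed.

Definition cell : Type := (bool * (G * word))%type.
Definition cell_arcs (s : cell) : seq arc :=
  if s.1 then word_arcs s.2.1 s.2.2 else chain_opp (word_arcs s.2.1 s.2.2).
Definition cells_bd (c : seq cell) : seq arc := flatten [seq cell_arcs s | s <- c].
Definition cells_in (R : set word) (c : seq cell) : bool :=
  all (fun s : cell => `[< R s.2.2 >]) c.

Variable R : set word.
Hypothesis pres : relative_presentation R.

Lemma relator_val r : R r -> word_val r = 1.
Proof.
have [_ H] := pres => Rr; apply/H; exists 1%N.
apply: (@conj_prodS _ _ _ _ _ 0 [::] r [::] [::] r r) => //.
- by left.
- exact: word_eq_refl.
- by apply: conj_prod0; exact: word_eq_refl.
- by rewrite /= cats0; exact: word_eq_refl.
Qed.

(** A relator closes up, so the conjugating words are traversed over the same arcs in opposite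
    directions and cancel: a conjugate contributes exactly one cell. *)
Lemma conj_prod_filling k w : conj_prod R k w -> forall g, exists2 c,
  size c = k /\ cells_in R c & chain_eq (cells_bd c) (word_arcs g w).
Proof.
elim=> {k w}.
  move=> w w1 g; exists [::] => // f.
  by rewrite (pairing_word_eq f w1).
move=> k u w f f' r r' Rr rr' ff' _ IH weq g.
have r1 := relator_val Rr.
have fv : word_val f' = (word_val f)^-1.
  have := word_eq_val ff'; rewrite word_val_cat word_val_nil => E.
  by rewrite -[LHS](mulKg (word_val f)) E mulg1.
have r'1 : word_val r' = 1.
  case: rr' => [-> //|/word_eq_val]; rewrite word_val_cat word_val_nil r1 mul1g //.
have [b Hb] : exists b, forall h,
    pairing h (word_arcs (g * word_val f') r') =
    pairing h (cell_arcs (b, (g * word_val f', r))).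
  case: rr' => [->|rr']; first by exists true.
  exists false => h; rewrite /cell_arcs /= pairing_opp.
  have := pairing_word_eq h rr' (g * word_val f').
  rewrite word_arcs_cat pairing_cat r1 mulg1 pairing_nil; lia.
have [c [cs cR] ceq] := IH g.
exists ((b, (g * word_val f', r)) :: c).
  by rewrite /= cs; split => //; apply/andP; split=> //; apply/asboolP.
move=> h; rewrite (pairing_word_eq h weq) /cells_bd /= !word_arcs_cat !pairing_cat.
rewrite -/(cells_bd c) ceq -Hb r'1 mulg1.
have := pairing_word_eq h ff' (g * word_val f').
rewrite word_arcs_cat pairing_cat pairing_nil fv mulgVK => E.
lia.
Qed.

Fixpoint walk (x : vertex) t (y : vertex) : bool :=
  if t is a :: t' then (arc_src a == x) && walk (arc_tgt a) t' y else x == y.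

Lemma walk_rcons (x : vertex) t a (y : vertex) : walk x (rcons t a) y =
  walk x t (arc_src a) && (arc_tgt a == y).
Proof.
elim: t x => [|b t IH] x /=; first by rewrite eq_sym.
by rewrite IH andbA.
Qed.

Lemma pairing_cobd_cons u a l :
  pairing (cobd u) (a :: l) = (u (arc_tgt a) - u (arc_src a) + pairing (cobd u) l)%R.
Proof.
by rewrite pairing_cons /cobd /arc_tgt /arc_src; case: a.1; lia.
Qed.

Lemma pairing_cobd_walk u (x : vertex) t (y : vertex) : walk x t y ->
  pairing (cobd u) t = (u y - u x)%R.
Proof.
elim: t x => [|a t IH] x /=; first by move=> /eqP->; rewrite pairing_nil subrr.
by case/andP=> /eqP <- /IH H; rewrite pairing_cobd_cons H; lia.
Qed.

(* A trail that has not returned to its origin leaves its end point unbalanced,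
   so it can be extended by one of the remaining arcs. *)
Lemma closed_trail (x : vertex) t (y : vertex) l : walk x t y -> is_cycle (t ++ l) ->
  exists t' l', [/\ perm_eq (t ++ l) (t' ++ l'), walk x t' x & size t <= size t'].
Proof.
move: {2}(size l) (leqnn (size l)) => k; elim: k t y l => [|k IH] t y l.
  rewrite leqn0 size_eq0 => /eqP-> wt cyc; exists t, [::]; split => //.
  have := cyc (fun v => (v == y)%:R%R); rewrite cats0 (pairing_cobd_walk _ wt).
  by rewrite eqxx; case: eqVneq => [xy _|_ /=]; [rewrite {2}xy|lia].
move=> lk wt cyc; have [xy|xy] := eqVneq x y.
  by exists t, l; split => //; rewrite {2}xy.
have [/hasP[a al /eqP ay]|no] := boolP (has (fun a => arc_src a == y) l).
  have pl : perm_eq (t ++ l) (rcons t a ++ rem a l).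
    by rewrite cat_rcons perm_cat2l perm_to_rem.
  have [|||t' [l' [p w s]]] := IH (rcons t a) (arc_tgt a) (rem a l).
  - by rewrite size_rem //; case: (size l) lk.
  - by rewrite walk_rcons ay wt eqxx.
  - by move=> u; rewrite -(pairing_perm _ pl).
  exists t', l'; split => //; first exact: perm_trans pl p.
  by rewrite size_rcons in s; lia.
exfalso; set u := fun v : vertex => ((v == y)%:R : int)%R.
have := cyc u; rewrite pairing_cat (pairing_cobd_walk _ wt) {1 2}/u eqxx (negPf xy).
have : (0 <= pairing (cobd u) l)%R.
  elim: l no {lk cyc} => [|a l IHl] /=; first by rewrite pairing_nil.
  rewrite negb_or pairing_cobd_cons => /andP[ay /IHl Hl].
  by rewrite /u (negPf ay) subr0 addr_ge0 // ler0n.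
by move=> /=; lia.
Qed.

(** A cone point is entered and left through half-edges of the same coset, whose group ends differ
    by an element of [P i]; such a pair is read as one peripheral letter. *)
Lemma walk_word g t g' : walk (inl g) t (inl g') ->
  exists w, [/\ size w <= size t, g * word_val w = g' & word_arcs g w = t].
Proof.
move: {2}(size t) (leqnn (size t)) => k; elim: k g t => [|k IH] g t.
  rewrite leqn0 size_eq0 => /eqP-> /= /eqP [->]; exists [::].
  by rewrite word_val_nil mulg1.
case: t => [_ /= /eqP [->]|[b [g0 [x|i]]] t].
- by exists [::]; rewrite word_val_nil mulg1.
- case: b => /=; rewrite /arc_src /arc_tgt /edge_src /edge_tgt /= => tk.
    case/andP=> /eqP [g0g] /(IH _ _ tk) [w [ws wv wa]]; rewrite g0g in wv wa *.
    exists (Gen P x true :: w); split => //=; first by rewrite word_val_cons mulgA.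
    by rewrite wa.
  case/andP=> /eqP [g0g] /(IH _ _ tk) [w [ws wv wa]].
  have E : g * (\val x)^-1 = g0 by rewrite -g0g mulgK.
  exists (Gen P x false :: w); split => //=; first by rewrite word_val_cons mulgA /= E.
  by rewrite E wa.
- case: b => /=; rewrite /arc_src /arc_tgt /edge_src /edge_tgt //= => tk.
  case/andP=> /eqP [g0g]; subst g0.
  case: t tk => [|[b [g1 [x|j]]] t] //= tk.
    by case: b.
  case: b => //=; rewrite /arc_src /arc_tgt /edge_src /edge_tgt //=.
  case/andP=> /eqP [ji]; subst j => /esym/coset_rep_eq Ph.
  have tk' : size t <= k by lia.
  move=> /(IH _ _ tk') [w [ws wv wa]].
  exists (Per X (SigSub (mem_set Ph)) :: w); split => //=; first by lia.
    by rewrite word_val_cons /= -mulgA mulVKg -?mulgA // mulgA mulVKg.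
  by rewrite mulVKg wa.
Qed.

Variable C : nat.
Hypothesis dehn : forall w, word_val w = 1 -> relative_area_le R w (C * size w).

Lemma closed_walk_filling (x : vertex) t : walk x t x -> exists2 c,
  size c <= C * size t /\ cells_in R c & chain_eq (cells_bd c) t.
Proof.
have base g t' : walk (inl g) t' (inl g) -> exists2 c,
    size c <= C * size t' /\ cells_in R c & chain_eq (cells_bd c) t'.
  move=> /walk_word [w [ws wv wa]].
  have w1 : word_val w = 1 by rewrite -[LHS](mulKg g) wv mulVg.
  have [k kle kR] := dehn w1; have [c [cs cR] ceq] := conj_prod_filling kR g.
  exists c; last by rewrite -wa.
  by split => //; rewrite cs (leq_trans kle) // leq_mul2l ws orbT.
case: x => [g|[i g]]; first exact: base.
case: t => [_|[b [g0 [x|j]]] t]; first by exists [::].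
  by case: b.
case: b => //=.
case/andP=> /eqP E wt.
(* A walk based at a cone point is rotated so that it starts at the group element reached by its
   first arc. *)
have [|c [cs cR] ceq] := base g0 (rcons t (false, (g0, inr j))).
  by rewrite walk_rcons E; apply/andP; split; [exact: wt|exact: eqxx].
exists c; first by rewrite size_rcons in cs.
move=> f; rewrite ceq; apply: pairing_perm.
by rewrite perm_rcons.
Qed.

Lemma cells_bd_cat (c c' : seq cell) : cells_bd (c ++ c') = cells_bd c ++ cells_bd c'.
Proof. by rewrite /cells_bd map_cat flatten_cat. Qed.

(** Homological form of the linear Dehn function: a cycle splits into closed trails, and linear
    bounds add up. Cutting a filling at a height produces cycles rather than loops, which is why
    this form is wanted. *)
Lemma cycle_filling l : is_cycle l -> exists2 c,
  size c <= C * size l /\ cells_in R c & chain_eq (cells_bd c) l.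
Proof.
move: {2}(size l) (leqnn (size l)) => k; elim: k l => [|k IH] l.
  by rewrite leqn0 size_eq0 => /eqP-> _; exists [::].
case: l => [|a l] lk cyc; first by exists [::].
have [||t [l' [p w s]]] := @closed_trail (arc_src a) [:: a] (arc_tgt a) l.
- by rewrite /= !eqxx.
- by [].
have [c [cs cR] ceq] := closed_walk_filling w.
have sz : (size l).+1 = size t + size l' by rewrite -size_cat -(perm_size p).
have [||c' [c's c'R] c'eq] := IH l'.
- by move: lk s; rewrite /= sz /=; move: (size t) (size l') => p1 p2; lia.
- move=> u; have := cyc u; rewrite -cat1s (pairing_perm _ p) pairing_cat.
  by rewrite (pairing_cobd_walk _ w) subrr add0r.
exists (c ++ c').
  rewrite size_cat /= sz mulnDr; split; first exact: leq_add.
  by rewrite /cells_in all_cat; apply/andP.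
by move=> f; rewrite cells_bd_cat -cat1s (pairing_perm _ p) !pairing_cat ceq c'eq.
Qed.

End ConedOffChains.

(** * Lipschitz cochains and slices of fillings by height *)

Section CellBounds.
Variables (G : groupType) (n : nat) (P : 'I_n -> set G) (X : set G).
Local Notation word := (word P X).
Implicit Types (w : word) (g x y : G).
Hypothesis P_sub : forall i, is_subgroup (P i).
Hypothesis gen : generated (X `|` \bigcup_i P i)%classic = [set: G]%classic.
Local Notation d := (wdist P_sub gen).
Local Notation vertex := (vertex G n).
Local Notation arc := (arc n X).

Lemma wdist_tri y x z : d x z <= d x y + d y z.
Proof. exact: (dist_tri (wdist_metric P_sub gen)). Qed.

Lemma wdist_sym x y : d x y = d y x.
Proof. exact: (dist_sym (wdist_metric P_sub gen)). Qed.

Lemma wdistxx x : d x x = 0.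
Proof. exact: (dist_refl (wdist_metric P_sub gen)). Qed.

Lemma wdistM g w : d g (g * word_val w) <= size w.
Proof. by rewrite /wdist mulKg; exact: wlen_le. Qed.

Lemma word_arcs_base g w (a : arc) : a \in word_arcs g w ->
  exists2 j, j <= size w & a.2.1 = g * word_val (take j w).
Proof.
elim: w g => [|l w IH] g //=; rewrite mem_cat => /orP[|].
  case: l => [x []|i h] /=; rewrite !inE.
  - by move/eqP->; exists 0 => //=; rewrite word_val_nil mulg1.
  - move/eqP->; exists 1%N => //=; rewrite take0 word_val_cons word_val_nil mulg1 //.
  case/orP=> /eqP->; first by exists 0 => //=; rewrite word_val_nil mulg1.
  by exists 1%N => //=; rewrite take0 word_val_cons word_val_nil mulg1.
case/IH => j jw ->; exists j.+1 => //=.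
by rewrite word_val_cons mulgA.
Qed.

Lemma word_arcs_near g w (a : arc) : a \in word_arcs g w -> d g a.2.1 <= size w.
Proof.
case/word_arcs_base => j jw ->; apply: leq_trans (wdistM _ _) _.
by rewrite size_take; case: ltnP.
Qed.

Definition dist_word x y : word := projT1 (cid2 (wlenP P_sub gen (x^-1 * y))).

Lemma size_dist_word x y : size (dist_word x y) = d x y.
Proof. by rewrite /dist_word; case: cid2. Qed.

Lemma dist_word_val x y : x * word_val (dist_word x y) = y.
Proof. by rewrite /dist_word; case: cid2 => /= w _ ->; rewrite mulVKg. Qed.

Definition segment x y : seq arc := word_arcs x (dist_word x y).

Lemma segment_near x y (a : arc) : a \in segment x y -> d x a.2.1 <= d x y.
Proof. by move/word_arcs_near; rewrite size_dist_word. Qed.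

Lemma size_segment x y : size (segment x y) <= 2 * d x y.
Proof. by rewrite -size_dist_word size_word_arcs. Qed.

Lemma pairing_segment (u : vertex -> int) x y :
  pairing (cobd P u) (segment x y) = (u (inl y) - u (inl x))%R.
Proof. by rewrite /segment (pairing_cobd_word P_sub) dist_word_val. Qed.

Definition path_arcs (p : nat -> G) (s : seq nat) : seq arc :=
  flatten [seq segment (p i) (p i.+1) | i <- s].

Lemma pairing_path_arcs f p s :
  pairing f (path_arcs p s) = (\sum_(i <- s) pairing f (segment (p i) (p i.+1)))%R.
Proof.
elim: s => [|i s IH]; first by rewrite big_nil pairing_nil.
by rewrite big_cons /path_arcs /= pairing_cat -IH.
Qed.

Lemma pairing_path_iota (u : vertex -> int) p i m :
  pairing (cobd P u) (path_arcs p (iota i m)) = (u (inl (p (i + m)%N)) - u (inl (p i)))%R.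
Proof.
elim: m i => [|m IH] i; first by rewrite addn0 subrr pairing_nil.
rewrite /= /path_arcs /= pairing_cat pairing_segment -/(path_arcs _ _) IH addSnnS.
by rewrite [LHS]addrC addrA subrK.
Qed.

(** A cone point takes the value of [u] at the chosen coset representative, which is at most one
    peripheral letter away from each element of the coset. *)
Lemma cobd_lipschitz (u : G -> nat) K (a : arc) :
  (forall x y, u x <= u y + K * d x y) ->
  let U := fun v : vertex => match v with inl x => (u x)%:Z%R | inr y => (u y.2)%:Z%R end in
  (`|cobd P U a.2| <= K%:Z)%R.
Proof.
move=> uL; case: a => b [x [y|i]]; rewrite /cobd /=.
  have dx : d x (x * \val y) <= 1 by have := wdistM x [:: Gen P y true]; rewrite word_val1.
  have := uL x (x * \val y); have := uL (x * \val y) x; rewrite wdist_sym.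
  move: (d _ _) dx (u x) (u _) => D; nia.
have [h Ph ->] := coset_rep_mem P_sub i x.
have dx : d x (x * h) <= 1.
  by have := wdistM x [:: Per X (SigSub (mem_set Ph))]; rewrite word_val1.
have := uL x (x * h); have := uL (x * h) x; rewrite wdist_sym.
move: (d _ _) dx (u x) (u _) => D; nia.
Qed.

Variables (R : set word) (C M : nat).
Hypothesis pres : relative_presentation R.
Hypothesis dehn : forall w, word_val w = 1 -> relative_area_le R w (C * size w).
Hypothesis R_size : forall r, R r -> size r <= M.

Lemma cell_arcs_near (s : cell P X) (a : arc) : cells_in R [:: s] ->
  a \in cell_arcs s -> d s.2.1 a.2.1 <= M.
Proof.
rewrite /cells_in /= andbT => /asboolP /R_size sM.
rewrite /cell_arcs; case: s.1.
  by move/word_arcs_near => H; exact: leq_trans H sM.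
case/mapP => b /word_arcs_near H -> /=; exact: leq_trans H sM.
Qed.

Lemma size_cell_arcs (s : cell P X) : cells_in R [:: s] -> size (cell_arcs s) <= 2 * M.
Proof.
rewrite /cells_in /= andbT => /asboolP /R_size sM.
rewrite /cell_arcs; case: s.1; rewrite ?size_map.
  by have := size_word_arcs s.2.1 s.2.2; move: (size _) (size _) sM => *; lia.
by have := size_word_arcs s.2.1 s.2.2; move: (size _) (size _) sM => *; lia.
Qed.

Lemma cells_in_cons (s : cell P X) c :
  cells_in R (s :: c) = cells_in R [:: s] && cells_in R c.
Proof. by rewrite /cells_in /= andbT. Qed.

Lemma cells_bd_cycle (c : seq (cell P X)) : cells_in R c -> is_cycle P (cells_bd c).
Proof.
elim: c => [_ u|s c IH]; first by rewrite pairing_nil.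
rewrite cells_in_cons => /andP[sR cR] u.
rewrite /cells_bd /= pairing_cat [X in (_ + X)%R]IH // addr0.
move: sR; rewrite /cells_in /= andbT => /asboolP sR.
have cyc := @word_arcs_cycle _ _ _ _ P_sub s.2.1 s.2.2 (relator_val pres sR) u.
by rewrite /cell_arcs; case: s.1; rewrite ?pairing_opp cyc ?oppr0.
Qed.

(** McShane extension of the index function on the path: [u x] is the minimum of [i + K * d (p i) x]
    over [i]. The quasi-geodesic inequality is exactly what makes it restrict to the index on the
    path. *)
Lemma calibration (K m : nat) (p : nat -> G) :
  (forall i j, i <= j -> j <= m -> j - i <= K * d (p i) (p j)) ->
  exists2 u : G -> nat, (forall x y, u x <= u y + K * d x y) &
    forall i, i <= m -> u (p i) = i.
Proof.
move=> qg.
have ex x : exists v, `[< exists2 i, i <= m & v = i + K * d (p i) x >].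
  by exists (0 + K * d (p 0) x); apply/asboolP; exists 0.
exists (fun x => ex_minn (ex x)).
  move=> x y; case: ex_minnP => v _ vmin; case: ex_minnP => v' /asboolP [i im ->] _.
  have : v <= i + K * d (p i) x by apply: vmin; apply/asboolP; exists i.
  have := wdist_tri y (p i) x; rewrite (wdist_sym x y).
  move: (d _ _) (d _ _) (d _ _) => *; nia.
move=> j jm; case: ex_minnP => v /asboolP [i im ->] vmin.
apply/eqP; rewrite eqn_leq; apply/andP; split.
  apply: vmin; apply/asboolP; exists j => //.
  by rewrite wdistxx muln0 addn0.
have [ij|ji] := leqP i j; last by rewrite ltnW // (leq_trans ji) // leq_addr.
by rewrite -leq_subLR; exact: qg.
Qed.

Lemma pairing_cells_filter f (q : pred (cell P X)) c : cells_in R c ->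
  (forall s, cells_in R [:: s] -> ~~ q s ->
    forall a : arc, a \in cell_arcs s -> f a.2 = 0%R) ->
  pairing f (cells_bd [seq s <- c | q s]) = pairing f (cells_bd c).
Proof.
elim: c => // s c IH; rewrite cells_in_cons => /andP[sR cR] H /=.
have E := IH cR H; case: ifP => qs; rewrite /cells_bd /= !pairing_cat -/(cells_bd c).
  by rewrite -E.
rewrite [X in (X + _)%R](_ : _ = 0%R) ?add0r //.
rewrite (@eq_pairing _ _ _ _ (fun=> 0%R)) //; last by move=> a /(H s sR (negbT qs)).
by rewrite /pairing big1 // => a _; case: a.1; rewrite ?oppr0.
Qed.

Lemma pairing_path_filter f (p : nat -> G) (q : pred nat) s :
  (forall i, i \in s -> ~~ q i -> forall a : arc, a \in segment (p i) (p i.+1) -> f a.2 = 0%R) ->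
  pairing f (path_arcs p [seq i <- s | q i]) = pairing f (path_arcs p s).
Proof.
elim: s => // i s IH H /=.
have E : pairing f (path_arcs p [seq i <- s | q i]) = pairing f (path_arcs p s).
  by apply: IH => j js; apply: H; rewrite inE js orbT.
case: ifP => qi; rewrite /path_arcs /= !pairing_cat -/(path_arcs p s).
  by rewrite -E.
rewrite [X in (X + _)%R](_ : _ = 0%R) ?add0r //.
rewrite (@eq_pairing _ _ _ _ (fun=> 0%R)) //; last first.
  by move=> a; apply: (H i) => //; rewrite ?mem_head ?qi.
by rewrite /pairing big1 // => a _; case: a.1; rewrite ?oppr0.
Qed.

Lemma filter_size0 (T : eqType) (q : pred T) (s : seq T) :
  (forall a, a \in s -> ~~ q a) -> size [seq a <- s | q a] = 0.
Proof. by move=> H; apply/eqP; rewrite size_filter -leqn0 leqNgt -has_count; apply/hasPn. Qed.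

(** The arcs of a cell stay within [M < L] of its base, so a cell based above [t + 2 * L] has none
    below [t + L]. The counted arcs are thus paid for by cells based between the levels [t] and
    [t + 2 * L], at most [2 * M] arcs each. *)
Lemma size_cells_slice (f : G -> nat) L t c : cells_in R c -> M < L ->
  (forall x y, f x <= f y + d x y) ->
  size [seq a <- cells_bd [seq s <- c | t < f s.2.1] | f a.2.1 <= t + L]
    + 2 * M * count (fun s : cell P X => t + 2 * L < f s.2.1) c
  <= 2 * M * count (fun s : cell P X => t < f s.2.1) c.
Proof.
move=> cR ML fL; elim: c cR => [|s c IH]; first by rewrite /= muln0.
rewrite cells_in_cons => /andP[sR /IH] /=.
case: ifP => fs; last first.
  have -> : (t + 2 * L < f s.2.1) = false by move: fs; lia.
  by rewrite !add0n.
rewrite /cells_bd /= filter_cat size_cat -/(cells_bd _).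
case: ltnP => fs2.
  rewrite (@filter_size0 _ _ (cell_arcs s)); first by move: (size _) (count _ _) (count _ _) => *; nia.
  move=> a /(cell_arcs_near sR) near; have := fL s.2.1 a.2.1.
  move: (f _) (f _) fs2 (d _ _) near => *; lia.
have : size [seq a <- cell_arcs s | f a.2.1 <= t + L] <= 2 * M.
  by rewrite size_filter (leq_trans (count_size _ _)) // size_cell_arcs.
move: (size _) (size _) (count _ _) (count _ _) => *; nia.
Qed.

Lemma size_path_slice (f : G -> nat) (p : nat -> G) K L t s : K < L ->
  (forall i, i \in s -> d (p i) (p i.+1) <= K) ->
  (forall x y, f x <= f y + d x y) ->
  size [seq a <- path_arcs p [seq i <- s | t < f (p i)] | f a.2.1 <= t + L]
    + 2 * K * count (fun i => t + 2 * L < f (p i)) s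
  <= 2 * K * count (fun i => t < f (p i)) s.
Proof.
move=> KL sK fL; elim: s sK => [|i s IH] sK; first by rewrite /= muln0.
have /IH /= : forall i, i \in s -> d (p i) (p i.+1) <= K.
  by move=> j js; apply: sK; rewrite inE js orbT.
have dK := sK i (mem_head _ _).
case: ifP => fs; last first.
  have -> : (t + 2 * L < f (p i)) = false by move: fs; lia.
  by rewrite !add0n.
rewrite /path_arcs /= filter_cat size_cat -/(path_arcs _ _).
case: ltnP => fs2.
  rewrite (@filter_size0 _ _ (segment (p i) (p i.+1))); first by move: (size _) (count _ _) (count _ _) => *; nia.
  move=> a /segment_near near; have := fL (p i) a.2.1.
  move: (f _) (f _) fs2 (d (p i) a.2.1) (d (p i) (p i.+1)) near dK => *; lia.
have : size [seq a <- segment (p i) (p i.+1) | f a.2.1 <= t + L] <= 2 * K.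
  rewrite size_filter (leq_trans (count_size _ _)) //.
  by rewrite (leq_trans (size_segment _ _)) // leq_mul2l dK.
move: (size _) (size _) (count _ _) (count _ _) => *; nia.
Qed.

End CellBounds.

(** * Stability of quasi-geodesics *)

Section Morse.
Variables (G : groupType) (n : nat) (P : 'I_n -> set G) (X : set G).
Local Notation word := (word P X).
Implicit Types (w : word) (g x y : G).
Hypothesis P_sub : forall i, is_subgroup (P i).
Hypothesis gen : generated (X `|` \bigcup_i P i)%classic = [set: G]%classic.
Local Notation d := (wdist P_sub gen).
Local Notation vertex := (vertex G n).
Local Notation arc := (arc n X).
Local Notation path_arcs := (path_arcs P_sub gen).
Local Notation segment := (segment P_sub gen).
Variables (R : set word) (C M : nat).
Hypothesis pres : relative_presentation R.
Hypothesis dehn : forall w, word_val w = 1 -> relative_area_le R w (C * size w).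
Hypothesis R_size : forall r, R r -> size r <= M.

Lemma ex_min_filling (l : seq arc) : is_cycle P l -> exists c,
  [/\ cells_in R c, chain_eq (cells_bd c) l, size c <= C * size l &
  forall c', cells_in R c' -> chain_eq (cells_bd c') l -> size c <= size c'].
Proof.
move=> cyc; have [c0 [c0s c0R] c0eq] := cycle_filling P_sub pres dehn cyc.
have ex : exists k, `[< exists c, [/\ cells_in R c, chain_eq (cells_bd c) l & size c = k] >].
  by exists (size c0); apply/asboolP; exists c0.
have := ex_minnP ex; case=> k /asboolP [c [cR ceq ck]] kmin.
exists c; split => //.
  rewrite ck (leq_trans _ c0s) // kmin //; apply/asboolP; by exists c0.
by move=> c' c'R c'eq; rewrite ck kmin //; apply/asboolP; exists c'.
Qed.

(** [A t] counts the cells of a minimal filling and the path steps above level [t]. Both are bounded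
    linearly by the slice of the filling just above [t]: the steps by calibration, the cells by
    minimality. The slice in turn is bounded by the loss from [A t] to [A (t + 2 * L)]. *)
Lemma area_decay (K m : nat) (p : nat -> G) (b : seq arc) (f : G -> nat) :
  (forall i, i < m -> d (p i) (p i.+1) <= K) ->
  (forall i j, i <= j -> j <= m -> j - i <= K * d (p i) (p j)) ->
  (forall x y, f x <= f y + d x y) -> (forall a, a \in b -> f a.2.1 <= 1) ->
  is_cycle P (path_arcs p (iota 0 m) ++ b) ->
  let L := (M + K + 1)%N in let E := (2 * (M + K) * (C * (2 * K * K + 1) + K))%N in
  exists A : nat -> nat, [/\ A 0 <= C * (2 * K * m + size b) + m,
   (forall i t, i < m -> t < f (p i) -> 0 < A t) &
   forall t, A t + E * A (t + 2 * L) <= E * A t].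
Proof.
move=> pK qg fL fb cyc L E.
have [u uL up] := calibration qg.
have [c [cR ceq cs cmin]] := ex_min_filling cyc.
set al := path_arcs p (iota 0 m) in cyc ceq cs cmin.
have sizeal s : (forall i, i \in s -> i < m) -> size (path_arcs p s) <= 2 * K * size s.
  elim: s => [|i s IH] H; first by rewrite muln0.
  rewrite /path_arcs /= size_cat -/(path_arcs p s).
  have := IH (fun j js => H j (mem_behead (s := i :: s) js)).
  have := size_segment P_sub gen (p i) (p i.+1); have := pK i (H i (mem_head _ _)).
  move: (d _ _) (size _) (size _) (size _) => *; nia.
have iotam i : i \in iota 0 m -> i < m by rewrite mem_iota.
pose ca t := count (fun s : cell P X => t < f s.2.1) c.
pose cn t := count (fun i => t < f (p i)) (iota 0 m).
exists (fun t => ca t + cn t); split.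
- rewrite leq_add //; last by rewrite (leq_trans (count_size _ _)) ?size_iota.
  rewrite (leq_trans (count_size _ _)) // (leq_trans cs) // leq_mul2l size_cat leq_add2r.
  by have := sizeal _ iotam; rewrite size_iota => ->; rewrite orbT.
- move=> i t im fi; rewrite addn_gt0; apply/orP; right.
  by rewrite -has_count; apply/hasP; exists i => //; rewrite mem_iota.
move=> t.
pose ct := [seq s <- c | t < f s.2.1].
pose at_ := path_arcs p [seq i <- iota 0 m | t < f (p i)].
pose Q (e : edge n X) := f e.1 <= t + L.
pose sg1 := [seq a <- cells_bd ct | Q a.2]; pose sg2 := [seq a <- chain_opp at_ | Q a.2].
pose sg := sg1 ++ sg2.
have ctR : cells_in R ct by rewrite /cells_in all_filter; apply: sub_all cR => s /= ->; rewrite implybT.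
(* Above level [t + L] the truncated filling and the truncated path agree with the full ones, and
   [b] has no arcs there; the error chain [sg] lies below that level. *)
have eqt : chain_eq (cells_bd ct) (at_ ++ sg).
  move=> g; rewrite pairing_cat /sg /sg1 /sg2 -filter_cat.
  rewrite (pairing_filter g Q) pairing_cat pairing_opp.
  pose h := fun e : edge n X => if Q e then 0%R else g e.
  have split_ l : pairing g l = (pairing (fun e => if Q e then g e else 0) l + pairing h l)%R.
    elim: l => [|a l IH]; first by rewrite !pairing_nil.
    rewrite !pairing_cons IH /h; case: a.1; case: ifP => _; move: (pairing _ _) (pairing _ _) (g _) => *; lia.
  have h1 : pairing h (cells_bd ct) = pairing h (cells_bd c).
    apply: (pairing_cells_filter (R := R)) => // s sR; rewrite -leqNgt => fs a aa.
    rewrite /h /Q ifT //.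
    have := cell_arcs_near P_sub gen R_size sR aa; have := fL a.2.1 s.2.1.
    rewrite (wdist_sym P_sub gen a.2.1) /L.
    move: (f _) (f _) (d _ _) fs => *; lia.
  have h2 : pairing h at_ = pairing h al.
    apply: pairing_path_filter => i /iotam im; rewrite -leqNgt => fi a aa.
    rewrite /h /Q ifT //.
    have := segment_near aa; have := fL a.2.1 (p i).
    rewrite (wdist_sym P_sub gen a.2.1) /L; have := pK i im.
    move: (f _) (f _) fi (d _ _) (d _ _)  => *; lia.
  have h3 : pairing h b = 0%R.
    rewrite (@eq_pairing _ _ _ _ (fun=> 0%R)).
      by rewrite /pairing big1 // => a _; case: a.1; rewrite ?oppr0.
    by move=> a /fb fa; rewrite /h /Q ifT // (leq_trans fa) // /L addnA leq_addl.
  have := ceq h; rewrite pairing_cat -h1 -h2 h3.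
  have := split_ (cells_bd ct); have := split_ at_.
  move: (pairing _ _) (pairing _ _) (pairing _ _) (pairing _ _) (pairing _ _) (pairing _ _) => *; lia.
have sgs : size sg + 2 * M * ca (t + 2 * L) + 2 * K * cn (t + 2 * L) <= 2 * M * ca t + 2 * K * cn t.
  have : size sg1 + 2 * M * ca (t + 2 * L) <= 2 * M * ca t.
    by apply: (@size_cells_slice _ _ _ _ P_sub gen R M R_size); rewrite ?/L //; lia.
  have : size sg2 + 2 * K * cn (t + 2 * L) <= 2 * K * cn t.
    rewrite /sg2 /chain_opp filter_map size_map.
    apply: size_path_slice => //; first by rewrite /L; lia.
    by move=> i /iotam; exact: pK.
  rewrite size_cat; move: (size _) (size _) (ca _) (ca _) (cn _) (cn _) => *; lia.
pose U := fun v : vertex => match v with inl x => (u x)%:Z%R | inr y => (u y.2)%:Z%R end.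
have ctc : is_cycle P (cells_bd ct) by apply: (cells_bd_cycle P_sub pres).
(* The calibrating coboundary is 1 on every path step and at most [K] on every arc of [sg], and it
   vanishes on the cycle formed by both. *)
have nS : cn t <= K * size sg.
  have /= := ctc U; rewrite eqt pairing_cat.
  have -> : pairing (cobd P U) at_ = (cn t)%:Z%R.
    rewrite pairing_path_arcs /cn -size_filter.
    have : forall i, i \in [seq i <- iota 0 m | t < f (p i)] -> i < m.
      by move=> i; rewrite mem_filter => /andP[_ /iotam].
    elim: [seq i <- _ | _] => [|i s IH] H; first by rewrite big_nil.
    rewrite big_cons IH; last by move=> j js; apply: H; rewrite inE js orbT.
    have im := H i (mem_head _ _).
    by rewrite pairing_segment /U !up ?(ltnW im) //=; lia.
  have : (`|pairing (cobd P U) sg| <= (K * size sg)%:Z)%R.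
    apply: pairing_bound => a _; exact: (cobd_lipschitz (P_sub := P_sub) (gen := gen)).
  move: (pairing _ _) (size _) (cn _) => *; lia.
(* Otherwise the cells above [t] could be replaced by a smaller filling of their own boundary. *)
have aS : ca t <= C * (2 * K * cn t + size sg).
  have [|c' [c's c'R] c'eq] := @cycle_filling _ _ _ _ P_sub _ pres _ dehn (at_ ++ sg).
    by move=> v; rewrite -eqt; exact: ctc.
  pose rest := [seq s <- c | ~~ (t < f s.2.1)].
  have restR : cells_in R rest by rewrite /cells_in all_filter; apply: sub_all cR => s /= ->; rewrite implybT.
  have : size c <= size (c' ++ rest).
    apply: cmin => [|g]; first by rewrite /cells_in all_cat; apply/andP.
    rewrite -ceq cells_bd_cat pairing_cat c'eq -eqt /ct /rest.
    elim: (c) => [|s c0 IH] /=; first by rewrite pairing_nil addr0.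
    rewrite -/(cells_bd c0) [in RHS]/cells_bd /= pairing_cat -/(cells_bd c0) -IH.
    case: ifP => _ /=; rewrite [in LHS]/cells_bd /= pairing_cat.
      by rewrite addrA.
    by rewrite addrCA.
  have : size c = ca t + size rest by rewrite /rest size_filter -(count_predC (fun s : cell P X => t < f s.2.1) c).
  rewrite size_cat; have : size at_ <= 2 * K * cn t.
    have := @sizeal [seq i <- iota 0 m | t < f (p i)]; rewrite size_filter; apply.
    by move=> i; rewrite mem_filter => /andP[_ /iotam].
  have := c's; rewrite size_cat.
  move: (size _) (size _) (size _) (size _) (size _) (ca _) (cn _) => *; nia.
have ca_le : ca (t + 2 * L) <= ca t by apply: sub_count => s /=; lia.
have cn_le : cn (t + 2 * L) <= cn t by apply: sub_count => i /=; lia.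
rewrite /E; move: (size _) (ca _) (ca _) (cn _) (cn _) sgs nS aS ca_le cn_le => S a a' k k' sgs nS aS aa kk.
have H1 : a + k <= (C * (2 * K * K + 1) + K) * S.
  have : k * (C * (2 * K)) <= K * S * (C * (2 * K)) by rewrite leq_mul2r nS orbT.
  nia.
have H2 : S + 2 * (M + K) * (a' + k') <= 2 * (M + K) * (a + k).
  nia.
have := leq_mul (leqnn (C * (2 * K * K + 1) + K)) H2.
nia.
Qed.

Lemma geodesic_points x y : exists b : nat -> G,
  [/\ b 0 = x, b (d x y) = y & forall i j, i <= j -> j <= d x y -> d (b i) (b j) = j - i].
Proof.
have := dist_word_val P_sub gen x y; have := size_dist_word P_sub gen x y.
move: (dist_word _ _ _ _) => w ws wv.
have wl : wlen P_sub gen (word_val w) = size w by rewrite ws -[in RHS]wv /wdist mulKg.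
exists (fun i => x * word_val (take i w)); split.
- by rewrite take0 word_val_nil mulg1.
- by rewrite -ws take_size.
move=> i j ij; rewrite -ws => js.
have -> : take i w = take i (take j w) by rewrite take_takel.
rewrite /wdist invgM -mulgA mulKg -{2}(cat_take_drop i (take j w)) word_val_cat mulKg.
have [h1 _] := wlen_take (P_sub := P_sub) (gen := gen) wl js.
have sj : size (take j w) = j by rewrite size_takel.
have [||_ ->] := wlen_take (P_sub := P_sub) (gen := gen) (w := take j w) (j := i); by rewrite ?sj.
Qed.

Lemma path_arcs_mem (p : nat -> G) s (a : arc) : a \in path_arcs p s ->
  exists2 j, j \in s & a \in segment (p j) (p j.+1).
Proof.
elim: s => // j s IH; rewrite /path_arcs /= mem_cat => /orP[H|/IH [k ks H]].
  by exists j => //; exact: mem_head.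
by exists k => //; rewrite inE ks orbT.
Qed.

Lemma size_path_arcs (p : nat -> G) K s : (forall j, j \in s -> d (p j) (p j.+1) <= K) ->
  size (path_arcs p s) <= 2 * K * size s.
Proof.
elim: s => [|i s IH] H; first by rewrite muln0.
rewrite /path_arcs /= size_cat -/(path_arcs p s).
have := IH (fun j js => H j (mem_behead (s := i :: s) js)).
have := size_segment P_sub gen (p i) (p i.+1); have := H i (mem_head _ _).
move: (d _ _) (size _) (size _) (size _) => *; nia.
Qed.

Lemma path_lipschitz (p : nat -> G) K m : (forall i, i < m -> d (p i) (p i.+1) <= K) ->
  forall i k, i + k <= m -> d (p i) (p (i + k)%N) <= K * k.
Proof.
move=> pK i; elim=> [|k IH] im; first by rewrite addn0 wdistxx.
have ik : i + k <= m by lia.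
have := IH ik; have := pK (i + k)%N; rewrite -addnS => /(_ im).
have := wdist_tri P_sub gen (p (i + k)%N) (p i) (p (i + k.+1)%N).
move: (d _ _) (d _ _) (d _ _) => *; nia.
Qed.

(** A long detour is expensive. If [p i0] is at the maximal distance [D] from [b], a piece of [p]
    around [p i0] and a return path that stays at distance about [D] bound an area linear in [D]. By
    [area_decay] the area halves after a fixed number of levels towards [p i0], yet it stays
    positive below level [D]; so [D] is bounded. *)
Lemma morse K : exists B, forall m (p : nat -> G),
  (forall i, i < m -> d (p i) (p i.+1) <= K) ->
  (forall i j, i <= j -> j <= m -> j - i <= K * d (p i) (p j)) ->
  forall l (b : nat -> G), (forall i j, i <= j -> j <= l -> d (b i) (b j) = j - i) ->
  b 0 = p 0 -> b l = p m ->
  forall i, i <= m -> exists2 j, j <= l & d (p i) (b j) <= B.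
Proof.
pose L := (M + K + 1)%N; pose E := (2 * (M + K) * (C * (2 * K * K + 1) + K))%N.
pose E1 := (C * (2 * K + 1) + 1)%N.
have [B HB] := log_bounded (E * (2 * L)) (E1 * (8 * K + 4 + 2 * (2 + 8 * K * K))).
exists B => m p pK qg l b bg b0 bm.
have tri := wdist_tri P_sub gen; have sym := wdist_sym P_sub gen.
have ex x : exists k, `[< exists2 j, j <= l & d x (b j) = k >].
  by exists (d x (b 0)); apply/asboolP; exists 0.
pose f x := ex_minn (ex x).
have fmin x j : j <= l -> f x <= d x (b j).
  by move=> jl; rewrite /f; case: ex_minnP => k _; apply; apply/asboolP; exists j.
have fatt x : exists2 j, j <= l & d x (b j) = f x.
  by rewrite /f; case: ex_minnP => k /asboolP.
suff H i : i <= m -> f (p i) <= B.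
  by move=> i im; have [j jl jd] := fatt (p i); exists j; rewrite ?jd ?H.
move=> im; pose D := \max_(k < m.+1) f (p k).
suff DB : D <= B by apply: leq_trans DB; exact: (leq_bigmax (Ordinal (im : i < m.+1))).
have fD k : k <= m -> f (p k) <= D.
  by move=> km; exact: (leq_bigmax (Ordinal (km : k < m.+1))).
have [|i0] := @bigop.eq_bigmax _ (fun k : 'I_m.+1 => f (p k)); first by rewrite card_ord.
rewrite -/D => Di0.
have i0m : i0 <= m by rewrite -ltnS.
move: (nat_of_ord i0) Di0 i0m => {}i0 Di0 i0m.
have [D0|Dpos] := posnP D; first by rewrite D0.
apply: HB => s sD.
(* With [T] steps on either side, each end of the window is an end of the path or at distance at
   least [4 * D] from [p i0]; the connections to [b], of length at most [D], then avoid [p i0]. *)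
pose T := (4 * K * D)%N; pose i1 := i0 - T; pose i2 := minn m (i0 + T).
have i1m : i1 <= m by rewrite /i1; lia.
have i2m : i2 <= m by rewrite geq_minl.
have [j1 j1l dj1] := fatt (p i1); have [j2 j2l dj2] := fatt (p i2).
have f0 : f (p 0) = 0 by have := fmin (p 0) 0 (leq0n _); rewrite b0 wdistxx leqn0 => /eqP.
have fm : f (p m) = 0 by have := fmin (p m) l (leqnn _); rewrite bm wdistxx leqn0 => /eqP.
have K0 : 0 < K.
  rewrite lt0n; apply/eqP => K0; have := qg 0 m (leq0n _) (leqnn _).
  rewrite K0 mul0n subn0 leqn0 => /eqP m0.
  by move: Dpos i0m; rewrite Di0 m0 leqn0 => + /eqP i00; rewrite i00 f0.
have i0lt : i0 < m.
  rewrite ltn_neqAle i0m andbT; apply/eqP => E0.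
  by move: Dpos; rewrite Di0 E0 fm.
have Tpos : 0 < T by rewrite /T !muln_gt0 K0 Dpos.
have i10 : i1 <= i0 by rewrite leq_subr.
have i02 : i0 < i2 by rewrite /i2; lia.
have far1 x : d (p i1) x <= f (p i1) -> D <= d (p i0) x.
  move=> dx; have t1 := tri x (p i0) (p i1); rewrite (sym x) in t1.
  have [Ti|iT] := leqP i0 T.
    have i1_0 : i1 = 0 by rewrite /i1; lia.
    rewrite i1_0 in dx t1; have := fmin (p i0) 0 (leq0n _).
    rewrite b0 -Di0; rewrite f0 in dx.
    move: dx t1; move: (d _ x) (d _ _) (d _ _) => *; lia.
  have := qg i1 i0 i10 i0m; rewrite (sym (p i1)).
  have -> : (i0 - i1)%N = T by rewrite /i1; lia.
  have := fD i1 i1m; rewrite /T; move: dx t1.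
  move: (d (p i0) x) (d (p i1) x) (d (p i0) (p i1)) (f _) => *; nia.
have far2 x : d (p i2) x <= f (p i2) -> D <= d (p i0) x.
  move=> dx; have t1 := tri x (p i0) (p i2); rewrite (sym x) in t1.
  have [mT|Tm] := leqP m (i0 + T).
    have i2_m : i2 = m by rewrite /i2; lia.
    rewrite i2_m in dx t1; have := fmin (p i0) l (leqnn _).
    rewrite bm -Di0; rewrite fm in dx.
    move: dx t1; move: (d _ x) (d _ _) (d _ _) => *; lia.
  have := qg i0 i2 (ltnW i02) i2m.
  have -> : (i2 - i0)%N = T by rewrite /i2; lia.
  have := fD i2 i2m; rewrite /T; move: dx t1.
  move: (d (p i0) x) (d (p i2) x) (d (p i0) (p i2)) (f _) => *; nia.
pose F x := (D - d (p i0) x)%N.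
have FL x y : F x <= F y + d x y.
  have := tri x (p i0) y; rewrite /F; move: (d _ _) (d _ _) (d _ _) => *; lia.
pose arcs j k := path_arcs b (iota j k).
pose mid := if j1 <= j2 then arcs j1 (j2 - j1)%N else chain_opp (arcs j2 (j1 - j2)%N).
pose bl := segment (p i2) (b j2) ++ chain_opp (segment (p i1) (b j1) ++ mid).
have arcsF j k a : j + k <= l -> a \in arcs j k -> F a.2.1 <= 1.
  move=> jk /path_arcs_mem [h]; rewrite mem_iota => ij /segment_near.
  rewrite bg ?subSnn //; last by lia.
  have := fmin (p i0) h; rewrite -Di0 => /(_ ltac:(lia)).
  have := tri a.2.1 (p i0) (b h); rewrite (sym a.2.1) /F.
  move: (d _ _) (d _ _) (d _ _) => *; lia.
have blF a : a \in bl -> F a.2.1 <= 1.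
  rewrite mem_cat => /orP[/segment_near|/mapP[{}a + ->]].
    by rewrite dj2 => /far2; rewrite /F => H; rewrite (eqP (H : _ == 0)).
  rewrite /= mem_cat => /orP[/segment_near|].
    by rewrite dj1 => /far1; rewrite /F => H; rewrite (eqP (H : _ == 0)).
  rewrite /mid; case: ifP => j12; first by apply: arcsF; lia.
  by case/mapP => {}a H ->; apply: arcsF H; lia.
have sizearcs j k : j + k <= l -> size (arcs j k) <= 2 * k.
  move=> jk; have := @size_path_arcs b 1 (iota j k); rewrite size_iota muln1; apply.
  by move=> h; rewrite mem_iota => H; rewrite bg //; lia.
have midu u : pairing (cobd P u) mid = (u (inl (b j2)) - u (inl (b j1)))%R.
  rewrite /mid /arcs; case: ifP => j12; first by rewrite pairing_path_iota subnKC.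
  rewrite pairing_opp pairing_path_iota subnKC; last by lia.
  by rewrite opprB.
pose p' k := p (i1 + k)%N.
have p'm : p' (i2 - i1)%N = p i2 by rewrite /p' subnKC // (leq_trans i10) // ltnW.
have cyc : is_cycle P (path_arcs p' (iota 0 (i2 - i1)) ++ bl).
  move=> u; rewrite pairing_cat pairing_path_iota pairing_cat pairing_opp pairing_cat midu.
  rewrite !pairing_segment add0n p'm /p' addn0.
  move: (u _) (u _) (u _) (u _) => *; lia.
have sizebl : size bl <= 4 * D + 2 * (2 * D + K * (2 * T)).
  have := size_segment P_sub gen (p i2) (b j2); have := size_segment P_sub gen (p i1) (b j1).
  rewrite dj1 dj2; have := fD i1 i1m; have := fD i2 i2m.
  have d12 : d (p i1) (p i2) <= K * (2 * T).
    have := path_lipschitz pK (i := i1) (k := (i2 - i1)%N); rewrite subnKC; last by lia.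
    move=> /(_ i2m) H; apply: leq_trans H _; rewrite leq_mul2l.
    by apply/orP; right; rewrite /i1 /i2; lia.
  have midsz : size mid <= 2 * (f (p i1) + K * (2 * T) + f (p i2)).
    have db : d (b j1) (b j2) <= f (p i1) + K * (2 * T) + f (p i2).
      have := tri (p i1) (b j1) (b j2); have := tri (p i2) (p i1) (b j2).
      rewrite (sym (b j1) (p i1)) dj1 dj2; move: d12; move: (f _) (f _) (d (p i1) (p i2)) (d _ _) (d _ _) => *; lia.
    rewrite /mid; case: ifP => j12.
      rewrite bg // in db; apply: leq_trans (sizearcs _ _ _) _; first by lia.
      by rewrite leq_mul2l db.
    rewrite sym bg // in db; last by lia.
    rewrite size_map; apply: leq_trans (sizearcs _ _ _) _; first by lia.
    by rewrite leq_mul2l db.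
  rewrite /bl size_cat size_map size_cat.
  move: (f _) (f _) (size _) (size _) (size _) (K * (2 * T))%N midsz => *; lia.
have [||A [A0 Apos Adec]] := area_decay (K := K) _ _ FL blF cyc.
- by move=> h im'; rewrite /p' addnS; apply: pK; lia.
- move=> h j ij jm'; have := qg (i1 + h)%N (i1 + j)%N; rewrite subnDl; apply; lia.
have := halving Adec s 0; rewrite add0n => H.
apply: morse_arith H _ A0 sizebl _; last by rewrite /i1 /i2; lia.
apply: (Apos (i0 - i1)%N); first by lia.
by rewrite /F /p' subnKC // wdistxx subn0.
Qed.

End Morse.

(** * Slim triangles and the four-point condition *)

Section FourPoint.
Variables (G : groupType) (n : nat) (P : 'I_n -> set G) (X : set G).
Local Notation word := (word P X).
Implicit Types (x y z : G).
Hypothesis P_sub : forall i, is_subgroup (P i).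
Hypothesis gen : generated (X `|` \bigcup_i P i)%classic = [set: G]%classic.
Local Notation d := (wdist P_sub gen).
Variables (R : set word) (C M : nat).
Hypothesis pres : relative_presentation R.
Hypothesis dehn : forall w, word_val w = 1 -> relative_area_le R w (C * size w).
Hypothesis R_size : forall r, R r -> size r <= M.

Let tri := wdist_tri P_sub gen.
Let sym := wdist_sym P_sub gen.

Definition geodesic_path (l : nat) (b : nat -> G) :=
  forall i j, i <= j -> j <= l -> d (b i) (b j) = j - i.

Lemma geodesic_through x y m : d x m + d m y = d x y -> exists b : nat -> G,
  [/\ geodesic_path (d x y) b, b 0 = x, b (d x y) = y & b (d x m) = m].
Proof.
move=> xmy; have [b1 [b10 b1l b1g]] := geodesic_points P_sub gen x m.
have [b2 [b20 b2l b2g]] := geodesic_points P_sub gen m y.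
exists (fun i => if i <= d x m then b1 i else b2 (i - d x m)%N); split.
- move=> i j ij jl; case: leqP => ix; case: leqP => jx.
  + exact: b1g.
  + have h1 := b1g i _ ix (leqnn _); rewrite b1l in h1.
    have h2 := b2g 0 (j - d x m)%N (leq0n _) ltac:(lia); rewrite b20 in h2.
    have h3 := b1g 0 _ (leq0n _) ix; rewrite b10 in h3.
    have h4 := b2g (j - d x m)%N (d m y) ltac:(lia) (leqnn _); rewrite b2l in h4.
    have := tri m (b1 i) (b2 (j - d x m)%N); have := tri (b1 i) x y.
    have := tri (b2 (j - d x m)%N) (b1 i) y.
    move: h1 h2 h3 h4 xmy ix jx jl ij.
    lia.
  + lia.
  + rewrite b2g; lia.
- by [].
- case: leqP => // h; last by rewrite (_ : (_ - _)%N = d m y) //; lia.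
  have h0 : d m y = 0 by lia.
  have -> : d x y = d x m by lia.
  by move: b2l; rewrite b1l h0 b20.
- by rewrite leqnn.
Qed.

(* A geodesic from z to its nearest point b 0 on a geodesic b, followed by b,
   is a 3-quasi-geodesic. *)
Lemma near_side_slim : exists B, forall l b z m (c : nat -> G),
  geodesic_path l b -> geodesic_path m c -> c 0 = z -> c m = b l ->
  (forall j, j <= l -> d z (b 0) <= d z (b j)) ->
  forall j, j <= l -> exists2 k, k <= m & d (b j) (c k) <= B.
Proof.
have [B HB] := morse P_sub gen pres dehn R_size 3.
exists B => l b z m c bg cg c0 cm zmin j jl.
have [a [a0 az ag]] := geodesic_points P_sub gen z (b 0).
pose s := d z (b 0); pose p i := if i <= s then a i else b (i - s)%N.
have ps i : i <= l -> p (s + i)%N = b i.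
  move=> il; rewrite /p; case: leqP => h; last by congr b; lia.
  have -> : i = 0 by lia.
  by rewrite addn0 /s az.
have pa i : i <= s -> p i = a i by rewrite /p => ->.
have psi i : s <= i -> i <= s + l -> p i = b (i - s)%N.
  by move=> si il; rewrite -{1}(subnKC si) ps //; lia.
have pmix i k : i <= s -> k <= l -> (s - i) + k <= 3 * d (a i) (b k).
  move=> si kl; have := ag i s si (leqnn _); rewrite az => h1.
  have := ag 0 i (leq0n _) si; rewrite a0 => h2.
  have := bg 0 k (leq0n _) kl => h3.
  have := zmin k kl; have := tri (a i) z (b k); have := tri (a i) (b 0) (b k).
  rewrite (sym (b 0) (a i)) h1 h2 h3 -/s; lia.
have [|||||k km kB] := HB (s + l)%N p _ _ m c cg _ _ (s + j)%N.
- move=> i il; have [h1|h1] := ltnP i s.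
    by rewrite !pa ?(ltnW h1) // ag // subSnn.
  by rewrite !psi ?bg //; lia.
- move=> i k ik kl; have [h2|h2] := leqP k s.
    by rewrite !pa ?ag //; lia.
  have [h1|h1] := leqP i s; last by rewrite !psi ?bg //; lia.
  rewrite (pa _ h1) psi ?(ltnW h2) //.
  by have := pmix i (k - s)%N h1 ltac:(lia); apply: leq_trans; lia.
- by rewrite c0 /p leq0n a0.
- by rewrite cm ps.
- lia.
by exists k => //; rewrite -(ps j jl).
Qed.

(** A point of the side nearest to [z] cuts the triangle in two, and [near_side_slim] applies to the
    half that contains [m]. *)
Lemma slim : exists B, forall x y z m, d x m + d m y = d x y ->
  exists2 m', d m m' <= B & d x m' + d m' z = d x z \/ d z m' + d m' y = d z y.
Proof.
have [B HB] := near_side_slim; exists B => x y z m xmy.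
have [b [bg b0 bl bm]] := geodesic_through xmy.
have [i0 i0l i0min] : exists2 i0, i0 <= d x y & forall j, j <= d x y -> d z (b i0) <= d z (b j).
  have ex : exists k, `[< exists2 j, j <= d x y & d z (b j) = k >].
    by exists (d z (b 0)); apply/asboolP; exists 0.
  have := ex_minnP ex; case=> k /asboolP [i il ik] kmin.
  by exists i => // j jl; rewrite ik kmin //; apply/asboolP; exists j.
have ml : d x m <= d x y by rewrite -xmy leq_addr.
have [mi|im] := leqP (d x m) i0.
  have [c [c0 cl cg]] := geodesic_points P_sub gen z x.
  have [||||k km] := HB i0 (fun i => b (i0 - i)%N) z (d z x) c _ cg c0 _ _ (i0 - d x m)%N.
  - by move=> i j ij jl; rewrite sym bg; lia.
  - by rewrite subnn b0.
  - by move=> j jl; rewrite subn0 i0min //; lia.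
  - lia.
  rewrite /= subKn // bm => mk; exists (c k) => //; left.
  have := cg 0 k (leq0n _) km; have := cg k _ km (leqnn _).
  by rewrite c0 cl (sym x) (sym (c k) z) (sym x z) => -> ->; lia.
have [c [c0 cl cg]] := geodesic_points P_sub gen z y.
have [||||k km] := HB (d x y - i0)%N (fun i => b (i0 + i)%N) z (d z y) c _ cg c0 _ _ (d x m - i0)%N.
- by move=> i j ij jl; rewrite bg; lia.
- by rewrite subnKC // bl.
- by move=> j jl; rewrite addn0 i0min //; lia.
- lia.
rewrite /= subnKC; last exact: ltnW.
rewrite bm => mk; exists (c k) => //; right.
have := cg 0 k (leq0n _) km; have := cg k _ km (leqnn _).
by rewrite c0 cl => -> ->; lia.
Qed.

(** The Gromov product of [x] and [y] at [w] bounds the distance from [w] to a geodesic between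
    them. The witness sits where the geodesic stops following the side to [w] from [x] and starts
    following the one from [w] to [y], hence is close to both. *)
Lemma interval_near : exists B, forall x y w, exists2 m, d x m + d m y = d x y &
  2 * d w m + d x y <= d x w + d y w + B.
Proof.
have [B HB] := slim; exists (4 * B + 2)%N => x y w.
have [b [b0 bl bg]] := geodesic_points P_sub gen x y.
have bI i : i <= d x y -> d x (b i) + d (b i) y = d x y.
  move=> il; have := bg 0 i (leq0n _) il; have := bg i _ il (leqnn _).
  by rewrite b0 bl => -> ->; lia.
pose near i := exists2 m', d (b i) m' <= B & d x m' + d m' w = d x w.
have [i il [ni nSi]] : exists2 i, i <= d x y & near i /\ (i = d x y \/ ~ near i.+1).
  have : near 0 by exists x; rewrite ?b0 wdistxx.
  move: {-2}(d x y) (leqnn (d x y)) => l lxy n0.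
  suff: forall k, k <= l -> (exists2 i, i <= l & near i /\ (i = l \/ ~ near i.+1)) \/ near k.
    by move=> /(_ l (leqnn _)) [//|nl]; exists l => //; split => //; left.
  elim=> [|k IH] kl; first by right.
  have [|nk] := IH (ltnW kl); first by left.
  have [nk1|nk1] := pselect (near k.+1); first by right.
  by left; exists k; [exact: ltnW|split => //; right].
have [m1 d1 I1] := ni.
have [m2 d2 I2] : exists2 m2, d (b i) m2 <= B.+1 & d w m2 + d m2 y = d w y.
  case: nSi => [iE|nSi]; first by exists y; rewrite ?iE ?bl wdistxx // addn0.
  have [ixy|ixy] := eqVneq i (d x y); first by exists y; rewrite ?ixy ?bl wdistxx // addn0.
  have iSl : i.+1 <= d x y by rewrite ltn_neqAle ixy il.
  have [m' dm' [H|H]] := HB x y w (b i.+1) (bI _ iSl); first by case: nSi; exists m'.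
  exists m' => //; have := tri (b i.+1) (b i) m'; rewrite bg // subSnn.
  by move: dm'; lia.
exists (b i); first exact: bI.
have := bI _ il; have := tri m1 x (b i); have := tri m1 w (b i).
have := tri m2 y (b i); have := tri m2 w (b i).
rewrite (sym w m1) (sym (b i) y) (sym m1 (b i)) (sym m2 (b i)) (sym y m2) (sym y w).
lia.
Qed.

(** Let [m] be a point between [x] and [z] as close to [w] as the Gromov product allows. By slimness
    it is close to the side from [x] to [y] or to that from [y] to [z]; these are the two
    alternatives. *)
Lemma four_point_ex : exists D, forall x y z w,
  d x z + d y w <= d x y + d z w + D \/ d x z + d y w <= d x w + d y z + D.
Proof.
have [B1 H1] := slim; have [B2 H2] := interval_near.
exists (B2 + 2 * B1)%N => x y z w.
have [m xmz dm] := H2 x z w; have [m' dm' I] := H1 x z y m xmz.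
have t1 := tri m w m'; have t2 := tri m' y w; have t3 := tri m' x w; have t4 := tri m' z w.
have := (sym y m', sym m' w, sym z m', sym w m, sym z w, sym z y).
by case=> [] [] [] [] []; case: I => I; [left|right]; lia.
Qed.

End FourPoint.

Lemma has_split (T : Type) (q : pred T) s : has q s ->
  exists x s1 s2, s = s1 ++ x :: s2 /\ q x.
Proof.
elim: s => //= a s IH; have [qa _|_ /= /IH [x [s1 [s2 [-> qx]]]]] := boolP (q a).
  by exists a, [::], s.
by exists x, (a :: s1), s2.
Qed.

(** * Gromov products under bilipschitz maps; components of fillings *)

Section GromovProducts.
Variables (G : groupType) (n : nat) (P : 'I_n -> set G) (X : set G).
Local Notation word := (word P X).
Implicit Types (x y z g : G).
Hypothesis P_sub : forall i, is_subgroup (P i).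
Hypothesis gen : generated (X `|` \bigcup_i P i)%classic = [set: G]%classic.
Local Notation d := (wdist P_sub gen).
Local Notation arc := (arc n X).
Local Notation edge := (edge n X).
Local Notation cell := (cell P X).
Variables (R : set word) (C M : nat).
Hypothesis pres : relative_presentation R.
Hypothesis dehn : forall w, word_val w = 1 -> relative_area_le R w (C * size w).
Hypothesis R_size : forall r, R r -> size r <= M.

Let tri := wdist_tri P_sub gen.
Let sym := wdist_sym P_sub gen.

(** Gromov products are distances to geodesics up to constants, and [f] maps a geodesic to a
    quasi-geodesic, which is near a geodesic by [morse]. [B] depends on [K] but not on [f]. *)
Lemma gromov_product_quasi K : exists B, forall f : G -> G,
  (forall x y, d (f x) (f y) <= K * d x y) ->
  (forall x y, d x y <= K * d (f x) (f y)) ->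
  forall a b c, d (f a) (f c) + d (f b) (f c) <=
    d (f a) (f b) + B * (d a c + d b c - d a b) + B.
Proof.
have [B1 H1] := interval_near P_sub gen pres dehn R_size.
have [B2 H2] := morse P_sub gen pres dehn R_size K.
exists (K + K * B1 + 2 * B2)%N => f fK Kf a b c.
have [m amb dm] := H1 a b c.
have [p [pg p0 pl pm]] := geodesic_through amb.
have [q [q0 ql qg]] := geodesic_points P_sub gen (f a) (f b).
have mab : d a m <= d a b by rewrite -amb leq_addr.
have [||||k kl] := H2 (d a b) (f \o p) _ _ _ q qg _ _ (d a m) mab.
- move=> i il /=; apply: leq_trans (fK _ _) _.
  by rewrite pg // subSnn muln1.
- by move=> i j ij jl /=; apply: leq_trans (Kf _ _); rewrite pg.
- by rewrite q0 /= p0.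
- by rewrite ql /= pl.
rewrite /= pm => dk.
have t1 := tri (q k) (f a) (f c); have t2 := tri (q k) (f b) (f c).
have t3 := tri (f m) (q k) (f c); have t4 := fK m c.
have := qg 0 k (leq0n _) kl; have := qg k _ kl (leqnn _).
rewrite q0 ql => g1 g2.
have := (sym (f b) (q k), sym (q k) (f m), sym c m); case=> [] [] s1 s2 s3.
have : 2 * d m c <= (d a c + d b c - d a b) + B1 by lia.
move: (d a c + d b c - d a b)%N => gp Hgp.
have : K * (2 * d m c) <= K * (gp + B1) by rewrite leq_mul2l Hgp orbT.
rewrite mulnCA => Hk; nia.
Qed.

(** Finite substitutes for metric balls, which are infinite as soon as some [P i] is. *)
Fixpoint ball (T : seq G) k : seq G :=
  if k is k'.+1 then [seq t * b | t <- 1 :: T, b <- ball T k'] else [:: 1].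

Definition cell_verts (s : cell) : seq G :=
  [seq s.2.1 * word_val (take j s.2.2) | j <- iota 0 (size s.2.2).+1].
Arguments cell_verts : simpl never.

Variable T : seq G.
Hypothesis TP : forall (s : cell), R s.2.2 -> forall x y,
  x \in cell_verts s -> y \in cell_verts s -> x^-1 * y \in T.

Lemma ball_one k : 1 \in ball T k.
Proof.
elim: k => [|k IH]; first by rewrite inE.
by rewrite -[1]mul1g; apply: allpairs_f => //; rewrite inE eqxx.
Qed.

(** [W] grows by the vertices of one adjacent cell at a time. Cells count as adjacent only through
    group elements, never through cone points, whose infinitely many neighbours would destroy the
    finiteness of the balls. *)
Lemma cell_component (c : seq cell) (W0 : seq G) : cells_in R c -> exists (W : seq G) (c1 c2 : seq cell),
  [/\ {subset W0 <= W},
      (forall w, w \in W -> exists2 w0, w0 \in W0 & w0^-1 * w \in ball T (size c)),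
      (forall f, pairing f (cells_bd c) = (pairing f (cells_bd c1) + pairing f (cells_bd c2))%R),
      cells_in R c1 /\ all (fun s => all (mem W) (cell_verts s)) c1 &
      all (fun s => ~~ has (mem W) (cell_verts s)) c2].
Proof.
move: {2}(size c) (erefl (size c)) => k; elim: k c W0 => [|k IH] c W0 ck cR.
  case: c ck cR => // _ _; exists W0, [::], [::]; split => //.
    by move=> w wW; exists w => //; rewrite mulVg ball_one.
  by move=> f; rewrite pairing_nil addr0.
have [/has_split [s [s1 [s2 [cE sW]]]]|no] := boolP (has (fun s => has (mem W0) (cell_verts s)) c); last first.
  exists W0, [::], c; split => //; first by move=> w wW; exists w => //; rewrite mulVg ball_one.
    by move=> f; rewrite pairing_nil add0r.
  by rewrite all_predC.
have c'k : size (s1 ++ s2) = k by move: ck; rewrite cE !size_cat /=; lia.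
have [sR c'R] : R s.2.2 /\ cells_in R (s1 ++ s2).
  move: cR; rewrite cE /cells_in !all_cat /= => /and3P[-> /asboolP sR ->]; by [].
have [W [c1 [c2 [WW Wb cc [c1R c1W] c2W]]]] := IH (s1 ++ s2) (W0 ++ cell_verts s) c'k c'R.
exists W, (s :: c1), c2; split => //.
- by move=> w w0; apply: WW; rewrite mem_cat w0.
- move=> w /Wb [w1 w1W w1w]; rewrite ck c'k in w1w *.
  have [w0 w0W w01] : exists2 w0, w0 \in W0 & w0^-1 * w1 \in 1 :: T.
    move: w1W; rewrite mem_cat => /orP[w1W|w1s]; first by exists w1 => //; rewrite mulVg inE eqxx.
    have /hasP [w0 w0s w0W] := sW; exists w0 => //.
    by rewrite inE (TP sR) ?orbT.
  exists w0 => //; rewrite (_ : w0^-1 * w = (w0^-1 * w1) * (w1^-1 * w)).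
    exact: allpairs_f.
  by rewrite -mulgA mulVKg.
- move=> f; have := cc f; rewrite cE /cells_bd !map_cat !flatten_cat /= !pairing_cat.
  move: (pairing _ _) (pairing _ _) (pairing _ _) (pairing _ _) (pairing _ _) => *; lia.
- split; first by rewrite /cells_in /= (asboolT sR).
  apply/andP; split; last exact: c1W.
  apply/allP => w ws; apply: WW.
  by rewrite mem_cat ws orbT.
Qed.

Lemma word_arcs_verts g (w : word) (a : arc) : a \in word_arcs g w ->
  let vs := [seq g * word_val (take j w) | j <- iota 0 (size w).+1] in
  a.2.1 \in vs /\ (forall x : X, a.2.2 = inl x -> a.2.1 * \val x \in vs).
Proof.
move=> aw vs.
have inv j : j <= size w -> g * word_val (take j w) \in vs.
  by move=> jw; apply/mapP; exists j; rewrite ?mem_iota.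
split; first by have [j jw ->] := word_arcs_base aw; exact: inv.
move=> x ax; suff [j jw ->] : exists2 j, j <= size w & a.2.1 * \val x = g * word_val (take j w).
  exact: inv.
elim: w g aw {vs inv} => [|l w IH] g //=; rewrite mem_cat => /orP[|].
  case: l => [y []|i h] /=; rewrite !inE.
  - move/eqP=> E; move: ax; rewrite E /= => -[->]; exists 1%N => //=.
    by rewrite take0 word_val_cons word_val_nil mulg1.
  - move/eqP=> E; move: ax; rewrite E /= => -[->]; exists 0 => //=.
    by rewrite word_val_nil mulg1 mulgVK.
  by case/orP=> /eqP E; move: ax; rewrite E.
case/IH => j jw ->; exists j.+1 => //=.
by rewrite word_val_cons mulgA.
Qed.

Lemma cell_arcs_verts (s : cell) (a : arc) : a \in cell_arcs s ->
  a.2.1 \in cell_verts s /\ (forall x : X, a.2.2 = inl x -> a.2.1 * \val x \in cell_verts s).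
Proof.
rewrite /cell_arcs; case: s.1; first exact: word_arcs_verts.
by case/mapP => b /word_arcs_verts H -> /=.
Qed.

Definition touches (W : seq G) (e : edge) : bool :=
  (e.1 \in W) || (if e.2 is inl x then e.1 * \val x \in W else false).

(** Absorbed cells have all their vertices in [W] and the others none, so restricting a cochain to
    the edges touching [W] isolates the boundary of the component. *)
Lemma component_pairing (W : seq G) (c c1 c2 : seq cell) f : cells_in R c1 ->
  (forall f, pairing f (cells_bd c) = (pairing f (cells_bd c1) + pairing f (cells_bd c2))%R) ->
  all (fun s => all (mem W) (cell_verts s)) c1 ->
  all (fun s => ~~ has (mem W) (cell_verts s)) c2 ->
  pairing f (cells_bd c1) = pairing (fun e => if touches W e then f e else 0%R) (cells_bd c).
Proof.
move=> c1R cc c1W c2W; rewrite cc.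
have -> : pairing (fun e => if touches W e then f e else 0%R) (cells_bd c2) = 0%R.
  rewrite (@eq_pairing _ _ _ _ (fun=> 0%R)).
    by rewrite /pairing big1 // => a _; case: a.1; rewrite ?oppr0.
  elim: c2 c2W {cc} => // s c2 IH /andP[sW /IH H] a.
  rewrite /cells_bd /= mem_cat => /orP[aS|]; last exact: H.
  have [v1 v2] := cell_arcs_verts aS.
  have nW v : v \in cell_verts s -> (v \in W) = false.
    by move=> vs; have /negbTE := hasPn sW v vs.
  rewrite /touches nW //=; case E: a.2.2 => [x|i] //.
  by rewrite nW // v2.
rewrite addr0; apply: eq_pairing.
elim: c1 c1W {cc c1R} => // s c1 IH /andP[sW /IH H] a.
rewrite /cells_bd /= mem_cat => /orP[aS|]; last exact: H.
have [v1 _] := cell_arcs_verts aS.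
by have /= v1W := allP sW _ v1; rewrite /touches v1W.
Qed.

End GromovProducts.

Ltac dist_lia :=
  repeat match goal with
  | H : is_true ?b |- _ => match b with context [wdist] => revert H end
  | H : @eq nat _ _ |- _ => revert H
  | H : _ \/ _ |- _ => revert H
  end;
  repeat match goal with |- context [wdist ?a ?b ?x ?y] => generalize (wdist a b x y) end;
  intros; lia.

(** * Acylindricity *)

Section FellowTravel.
Variables (G : groupType) (n : nat) (P : 'I_n -> set G) (X : set G).
Local Notation word := (word P X).
Implicit Types (x y z g : G).
Hypothesis P_sub : forall i, is_subgroup (P i).
Hypothesis gen : generated (X `|` \bigcup_i P i)%classic = [set: G]%classic.
Local Notation d := (wdist P_sub gen).
Local Notation segment := (segment P_sub gen).
Local Notation path_arcs := (path_arcs P_sub gen).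
Local Notation geodesic_path := (geodesic_path P_sub gen).
Local Notation arc := (arc n X).
Local Notation edge := (edge n X).
Local Notation cell := (cell P X).
Variables (R : set word) (C M : nat).
Hypothesis pres : relative_presentation R.
Hypothesis dehn : forall w, word_val w = 1 -> relative_area_le R w (C * size w).
Hypothesis R_size : forall r, R r -> size r <= M.

Let tri := wdist_tri P_sub gen.
Let sym := wdist_sym P_sub gen.

Variable T : seq G.
Hypothesis TP : forall (s : cell), R s.2.2 -> forall x y,
  x \in cell_verts s -> y \in cell_verts s -> x^-1 * y \in T.

Lemma ball_mono k k' : k <= k' -> {subset ball T k <= ball T k'}.
Proof.
move=> kk'; rewrite -(subnK kk'); move: (k' - k)%N => j; elim: j => // j IH x /IH xb.
by rewrite -[x]mul1g; apply: allpairs_f => //; rewrite inE eqxx.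
Qed.

Lemma unit_segment x y : d x y = 1%N -> exists2 l : letter P X,
  segment x y = letter_arcs x l & x * letter_val l = y.
Proof.
rewrite -size_dist_word /segment; have := dist_word_val P_sub gen x y.
case: (dist_word _ _ _ _) => [|l []] //= lv _; exists l; first by rewrite cats0.
by rewrite -lv word_val1.
Qed.

Lemma per_dist i g h : P i h -> d g (g * h) <= 1.
Proof.
by move=> Ph; have := wdistM P_sub gen g [:: Per X (SigSub (mem_set Ph))]; rewrite word_val1.
Qed.

Lemma gen_dist g (x : X) : d g (g * \val x) <= 1.
Proof. by have := wdistM P_sub gen g [:: Gen P x true]; rewrite word_val1. Qed.

Lemma coset_dist_ex o i y : exists k, `[< exists2 h, P i h & d o (y * h) = k >].
Proof.
have [P1 _ _] := P_sub i.
by exists (d o (y * 1)); apply/asboolP; exists 1.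
Qed.

Definition coset_dist o i y := ex_minn (coset_dist_ex o i y).

Lemma coset_distP o i g : let m := coset_dist o i (coset_rep P i g) in
  m <= d o g /\ d o g <= m.+1.
Proof.
have [_ PM PV] := P_sub i.
have [h Ph ->] := coset_rep_mem P_sub i g.
rewrite /coset_dist /=; case: ex_minnP => m /asboolP [k Pk km] mmin; split.
  apply: mmin; apply/asboolP; exists h^-1; first exact: PV.
  by rewrite mulgK.
have e := per_dist g (PM _ _ Ph Pk); have t := tri (g * (h * k)) o g.
by rewrite (sym (g * (h * k)) g) !mulgA km in t e; dist_lia.
Qed.

(** Clamping confines the coboundary of [height] to a neighbourhood of the sphere of radius [L]
    about [o], away from the two short sides of the quadrilateral in [fellow_travel]. *)
Definition clip L s := minn (maxn s (2 * L - 2)) (2 * L + 2).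

(* Distances from o are doubled so that a cone point can be given a height
   strictly between those of the two ends of a geodesic edge through it. *)
Definition height o L (v : vertex G n) : int := match v with
  | inl g => (clip L (2 * d o g))%:Z%R
  | inr y => (clip L (2 * coset_dist o y.1 y.2).+1)%:Z%R
  end.

Lemma height_low o L (e : edge) B : d o e.1 <= B -> B + 3 <= L ->
  cobd P (height o L) e = 0%R.
Proof.
case: e => g [x|i] /= gB BL; rewrite /cobd /height /= /clip.
  set y := (g * _); have := gen_dist g x : d g y <= 1; have := tri g o y.
  by dist_lia.
have [h1 h2] := coset_distP o i g.
by move: gB h1 h2; move: (d _ _) (coset_dist _ _ _) => *; lia.
Qed.

Lemma height_high o L (e : edge) : L + 3 <= d o e.1 -> cobd P (height o L) e = 0%R.
Proof.
case: e => g [x|i] /= gB; rewrite /cobd /height /= /clip.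
  set y := (g * _); have := gen_dist g x : d g y <= 1; have := tri y o g; rewrite (sym y g).
  by dist_lia.
have [h1 h2] := coset_distP o i g.
by move: gB h1 h2; move: (d _ _) (coset_dist _ _ _) => *; lia.
Qed.

(** Restriction to edges touching [W] may keep only one half of a peripheral step. Neither half
    lowers the height, so the contribution is non-negative in every case. *)
Lemma height_step o L W x y t : d o x = t -> d o y = t.+1 -> d x y = 1%N ->
  (t = L -> x \in W) ->
  (((t == L) : nat)%:Z <=
    pairing (fun e => if touches W e then cobd P (height o L) e else 0)
            (segment x y))%R.
Proof.
move=> ox oy /unit_segment [l -> ly] xW.
have xW' : (t == L) ==> (x \in W) by apply/implyP => /eqP.
case: l ly => [z [|]|i h] /= ly; rewrite !pairing_cons pairing_nil /= /touches /=.
- rewrite ly /cobd /height /= ly ox oy /clip.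
  by case: (t =P L) xW' => [tL /= ->|tL _] /=; do ?case: ifP => _; lia.
- have xE : y * \val z = x by rewrite -ly mulgVK.
  rewrite ly xE /cobd /height /= xE ox oy /clip.
  by case: (t =P L) xW' => [tL /= ->|tL _] /=; rewrite ?orbT; do ?case: ifP => _; lia.
rewrite ly !orbF /cobd /height /= ox oy.
have Ph : P i (\val h) := set_mem (valP h).
rewrite -ly (coset_repM P_sub _ Ph) ly.
have [h1 h2] := coset_distP o i x; have [h3 h4] := coset_distP o i y.
rewrite -ly (coset_repM P_sub _ Ph) ly oy in h3 h4; rewrite ox in h1 h2.
have -> : coset_dist o i (coset_rep P i x) = t by lia.
by rewrite /clip; case: (t =P L) xW' => [tL /= ->|tL _] /=; do ?case: ifP => _; lia.
Qed.

Definition subpath (b : nat -> G) j1 j2 : seq arc :=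
  if j1 <= j2 then path_arcs b (iota j1 (j2 - j1))
  else chain_opp (path_arcs b (iota j2 (j1 - j2))).

Lemma pairing_subpath u b j1 j2 :
  pairing (cobd P u) (subpath b j1 j2) = (u (inl (b j2)) - u (inl (b j1)))%R.
Proof.
rewrite /subpath; case: leqP => j12; first by rewrite pairing_path_iota subnKC.
by rewrite pairing_opp pairing_path_iota subnKC ?opprB // ltnW.
Qed.

Lemma subpath_mem b l j1 j2 (a : arc) : j1 <= l -> j2 <= l -> a \in subpath b j1 j2 ->
  exists2 j, j < l & exists2 s, (s, a.2) \in segment (b j) (b j.+1) & true.
Proof.
move=> j1l j2l; rewrite /subpath; case: leqP => j12.
  case/path_arcs_mem => j; rewrite mem_iota => jj aj; exists j; first by lia.
  by exists a.1 => //; case: a aj.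
case/mapP => [[s e]] /path_arcs_mem [j]; rewrite mem_iota => jj aj ->.
by exists j; [lia|exists s].
Qed.

Lemma size_subpath b l j1 j2 : geodesic_path l b -> j1 <= l -> j2 <= l ->
  size (subpath b j1 j2) <= 2 * d (b j1) (b j2).
Proof.
move=> bg j1l j2l; rewrite /subpath; have [j12|j12] := leqP j1 j2.
  rewrite bg // (leq_trans (size_path_arcs (K := 1) _)) ?size_iota ?muln1 //.
  by move=> h; rewrite mem_iota => hh; rewrite bg; lia.
rewrite sym bg //; last exact: ltnW.
rewrite /chain_opp size_map (leq_trans (size_path_arcs (K := 1) _)) ?size_iota ?muln1 //.
by move=> h; rewrite mem_iota => hh; rewrite bg; lia.
Qed.

(** The quadrilateral has a filling with at most [k0] cells. If its component at [a i] missed [a'],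
    the boundary of that component would have positive pairing with the coboundary of the height:
    the step at [a i] contributes at least 1, the other steps of [a] are non-negative, the other
    sides give 0. But that boundary is a cycle. *)
Lemma fellow_travel B : exists k0, forall l a l' a' i j1 j2, let L := (B + 5)%N in
  geodesic_path l a -> geodesic_path l' a' -> L <= i -> i + L <= l ->
  j1 <= l' -> j2 <= l' -> d (a (i - L)%N) (a' j1) <= B -> d (a (i + L)%N) (a' j2) <= B ->
  exists2 j, j <= l' & (a i)^-1 * a' j \in ball T k0.
Proof.
(* [C] times a bound for the arcs of the quadrilateral: a side of length [2 * L] with [L = B + 5],
   two of length at most [B], one of length at most [2 * B + 2 * L], and two arcs per unit of
   length. *)
exists (C * (4 * (B + 5) + 4 * B + 2 * (2 * B + 2 * (B + 5))))%N => l a l' a' i j1 j2 L.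
set k0 := (C * _)%N => ag a'g Li iL j1l j2l d1 d2.
apply: contrapT => no; have {}no j : j <= l' -> (a i)^-1 * a' j \notin ball T k0.
  by move=> jl; apply/negP => H; apply: no; exists j.
set o := a (i - L)%N in d1; set q := a (i + L)%N in d2.
have oq : d o q = (2 * L)%N by rewrite /o /q ag //; lia.
pose al := path_arcs a (iota (i - L) (2 * L)).
pose rest := segment q (a' j2) ++ subpath a' j2 j1 ++ chain_opp (segment o (a' j1)).
have cyc : is_cycle P (al ++ rest).
  move=> u; rewrite !pairing_cat pairing_path_iota pairing_opp !pairing_segment pairing_subpath.
  have -> : (i - L + 2 * L = i + L)%N by lia.
  rewrite -/o -/q; move: (u _) (u _) (u _) (u _) => *; lia.
have szz : size (al ++ rest) <= 4 * (B + 5) + 4 * B + 2 * (2 * B + 2 * (B + 5)).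
  rewrite !size_cat size_map; have := size_segment P_sub gen o (a' j1).
  have := size_segment P_sub gen q (a' j2); have := size_subpath a'g j2l j1l.
  have : size al <= 2 * 1 * size (iota (i - L) (2 * L)).
    apply: size_path_arcs => h; rewrite mem_iota => hh; rewrite ag; lia.
  have := tri o (a' j2) (a' j1); have := tri q (a' j2) o.
  rewrite (sym (a' j2) q) (sym q o) oq size_iota /L; lia.
have [c [cs cR] ceq] := cycle_filling P_sub pres dehn cyc.
have ck0 : size c <= k0 by rewrite (leq_trans cs) // leq_mul2l szz orbT.
have [W [c1 [c2 [W0W Wb cc [c1R c1W] c2W]]]] := cell_component TP [:: a i] cR.
have aW : a i \in W by apply: W0W; rewrite inE.
have a'W j : j <= l' -> a' j \notin W.
  move=> jl; apply/negP => /Wb [w0]; rewrite inE => /eqP-> /(ball_mono ck0) H.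
  by have := no j jl; rewrite H.
pose U := height o L; pose f (e : edge) := if touches W e then cobd P U e else 0%R.
have : pairing f (al ++ rest) = 0%R.
  rewrite -ceq -(component_pairing (cobd P U) c1R cc c1W c2W).
  exact: (cells_bd_cycle P_sub pres c1R).
have z0 s : (forall b : arc, b \in s -> f b.2 = 0%R) -> pairing f s = 0%R.
  move=> s0; rewrite (@eq_pairing _ _ _ _ (fun=> 0%R)) //.
  by rewrite /pairing big1 // => b _; case: b.1; rewrite ?oppr0.
have fW (e : edge) : cobd P U e = 0%R -> f e = 0%R by rewrite /f => ->; case: ifP.
rewrite /rest !pairing_cat pairing_opp.
rewrite (z0 (segment q _)); last first.
  move=> b /segment_near bq; apply: fW; apply: height_high.
  have := tri b.2.1 o q; rewrite oq sym (sym _ q) /L; lia.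
rewrite (z0 (segment o _)); last first.
  move=> b /segment_near bq; apply: fW; apply: (@height_low _ _ _ B); rewrite /L; lia.
rewrite (z0 (subpath _ _ _)); last first.
  move=> b /(subpath_mem j2l j1l) [j jl' [s bj _]]; rewrite /f ifF //.
  have jn := a'W j (ltnW jl'); have jSn := a'W j.+1 jl'.
  have [|t tE ty] := @unit_segment (a' j) (a' j.+1); first by rewrite a'g // subSnn.
  move: bj; rewrite tE /touches; case: t ty {tE} => [x []|h k] /= ty; rewrite !inE.
  - by case/eqP => _ ->/=; rewrite ty (negPf jn) (negPf jSn).
  - case/eqP => _ -> /=; rewrite ty (negPf jSn) /=.
    by rewrite -ty mulgVK (negPf jn).
  - by case/orP=> /eqP [_ ->] /=; rewrite ?ty ?(negPf jn) ?(negPf jSn).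
have inI : i \in iota (i - L) (2 * L) by rewrite mem_iota /L; lia.
rewrite pairing_path_arcs (bigD1_seq i) ?iota_uniq //=.
have step h : h \in iota (i - L) (2 * L) ->
    (((h == i) : nat)%:Z <= pairing f (segment (a h) (a h.+1)))%R.
  rewrite mem_iota => hh.
  have -> : (h == i) = ((h - (i - L))%N == L) by apply/eqP/eqP; lia.
  apply: height_step; rewrite /o ?ag //; try lia.
  by move=> hL; have -> : h = i by lia.
have := step i inI; rewrite eqxx.
have : (0 <= \sum_(h <- iota (i - L) (2 * L) | h != i) pairing f (segment (a h) (a h.+1)))%R.
  rewrite big_seq_cond; apply: sumr_ge0 => h /andP[hI _].
  by apply: le_trans (step h hI).
move: (pairing _ _) (\sum_(_ <- _ | _) _)%R => *; lia.
Qed.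

End FellowTravel.

Section Acylindricity.
Variables (G : groupType) (n : nat) (P : 'I_n -> set G) (X : set G).
Local Notation word := (word P X).
Implicit Types (x y z g : G).
Hypothesis P_sub : forall i, is_subgroup (P i).
Hypothesis gen : generated (X `|` \bigcup_i P i)%classic = [set: G]%classic.
Local Notation d := (wdist P_sub gen).
Local Notation geodesic_path := (geodesic_path P_sub gen).
Local Notation cell := (cell P X).
Variables (R : set word) (C M : nat).
Hypothesis pres : relative_presentation R.
Hypothesis dehn : forall w, word_val w = 1 -> relative_area_le R w (C * size w).
Hypothesis R_size : forall r, R r -> size r <= M.

Let tri := wdist_tri P_sub gen.
Let sym := wdist_sym P_sub gen.
Let dinv := dist_inv (wdist_metric P_sub gen).

Variable T : seq G.
Hypothesis TP : forall (s : cell), R s.2.2 -> forall x y,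
  x \in cell_verts s -> y \in cell_verts s -> x^-1 * y \in T.

(** Two applications of slimness: [x] is too far from the short sides to be close to them, so it is
    close to the opposite one. *)
Lemma quadrilateral_near : exists B, forall e p q p' q' x l' a',
  d p x + d x q = d p q -> d p p' <= e -> d q q' <= e ->
  e + B < d p x -> e + B < d x q ->
  geodesic_path l' a' -> a' 0 = p' -> a' l' = q' ->
  exists2 j, j <= l' & d x (a' j) <= B.
Proof.
have [B1 H1] := slim P_sub gen pres dehn R_size.
have [B2 H2] := morse P_sub gen pres dehn R_size 1.
exists (2 * B1 + B2)%N => e p q p' q' x l' a' xpq pp' qq' ex xe a'g a'0 a'l.
have [m1 d1 I1] := H1 p q q' x xpq.
case: I1 => I1; last first.
  by have := tri m1 x q; rewrite (sym q q') in qq'; lia.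
have [m2 d2 I2] := H1 p q' p' m1 I1.
case: I2 => I2.
  have := tri m1 p x; have := tri m2 p m1.
  by rewrite (sym m1 x) (sym m2 m1); lia.
have [b [bg b0 bl bm]] := geodesic_through I2.
have m2l : d p' m2 <= d p' q' by rewrite -I2 leq_addr.
have [||||j jl dj] := H2 (d p' q') b _ _ l' a' a'g _ _ (d p' m2) m2l.
- by move=> i il; rewrite bg // subSnn.
- by move=> i j ij jl; rewrite mul1n bg.
- by rewrite a'0.
- by rewrite a'l.
exists j => //; have := tri m1 x (a' j); have := tri m2 m1 (a' j).
by rewrite bm in dj; lia.
Qed.

(** By [fellow_travel] a fixed inner point [a i] of the geodesic satisfies [g * a j = a i * w] with
    [w] in a finite ball. So [g] is determined by [w] and [j], and [j] is within [e + rho] of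
    [i]. *)
Lemma acylindrical : exists (Rad Num : nat -> nat), forall e p q, Rad e <= d p q ->
  forall s : seq G, uniq s ->
  (forall g, g \in s -> d p (g * p) <= e /\ d q (g * q) <= e) -> size s <= Num e.
Proof.
have [B HB] := quadrilateral_near; have [k0 Hk] := fellow_travel P_sub gen pres dehn TP B.
pose W := ball T k0; pose rho := \max_(w <- W) wlen P_sub gen w.
pose L := (B + 5)%N; pose i0 e := (e + B + 1 + L)%N.
exists (fun e => i0 e + i0 e)%N, (fun e => size W * (i0 e + e + rho).+1)%N.
move=> e p q pq s su sP.
have [a [a0 al ag]] := geodesic_points P_sub gen p q; set l := d p q in pq al ag.
pose i := i0 e; pose cand := [seq a i * w * (a j)^-1 | w <- W, j <- iota 0 (i + e + rho).+1].
have : forall g : G, g \in s -> g \in cand.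
  move=> g gs; have [gp gq] := sP g gs.
  have apos h : h <= l -> d p (a h) = h /\ d (a h) q = (l - h)%N.
    move=> hl; have := ag 0 h (leq0n _) hl; have := ag h l hl (leqnn _).
    by rewrite a0 al subn0.
  pose a' h := g * a h.
  have a'g : geodesic_path l a' by move=> h k hk kl; rewrite dinv ag.
  have il : (i + L <= l)%N by rewrite /i /i0 in pq *; lia.
  have nearh h : (i - L <= h)%N -> h <= i + L -> exists2 j, j <= l & d (a h) (a' j) <= B.
    move=> h1 h2; have hl : h <= l := leq_trans h2 il.
    have [e1 e2] := apos h hl.
    apply: (HB e p q (g * p) (g * q) (a h) l a') => //; rewrite ?e1 ?e2 ?/a' ?a0 ?al //.
    + by rewrite subnKC.
    + by rewrite /i /i0 in h1; lia.
    + by rewrite /i /i0 in pq h2 *; lia.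
  have [j1 j1l d1] := nearh (i - L)%N (leqnn _) ltac:(lia).
  have [j2 j2l d2] := nearh (i + L)%N ltac:(lia) (leqnn _).
  have Li : L <= i by rewrite /i /i0; lia.
  have [j jl wW] := Hk l a l a' i j1 j2 ag a'g Li il j1l j2l d1 d2.
  have wr : d (a i) (a' j) <= rho by rewrite /rho; apply: leq_bigmax_seq.
  have jbound : j < (i + e + rho).+1.
    have [e1 _] := apos i (leq_trans (leq_addr _ _) il); have [e2 _] := apos j jl.
    have := tri (a i) p (a' j); have := tri p (g * p) (a' j).
    by rewrite /a' dinv e2 (sym (g * p) p) e1; move: gp wr => /= gp wr; rewrite /a' in wr; dist_lia.
  apply/allpairsP; exists ((a i)^-1 * a' j, j); split => //; first by rewrite mem_iota.
  by rewrite /= mulVKg /a' mulgK.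
by move/(uniq_leq_size su); rewrite size_allpairs size_iota.
Qed.

End Acylindricity.

(** * Infinite peripheral subgroups *)

Section InfinitePeripheral.
Variables (G : groupType) (n : nat) (P : 'I_n -> set G) (X : set G).
Local Notation word := (word P X).
Implicit Types (x y z g : G).
Hypothesis P_sub : forall i, is_subgroup (P i).
Hypothesis gen : generated (X `|` \bigcup_i P i)%classic = [set: G]%classic.
Local Notation edge := (edge n X).
Variables (R : set word) (C M : nat).
Hypothesis pres : relative_presentation R.
Hypothesis dehn : forall w, word_val w = 1 -> relative_area_le R w (C * size w).
Hypothesis R_size : forall r, R r -> size r <= M.

Variables (i0 : 'I_n) (Om : seq G).
Local Notation letter := (letter P X).

Definition per_val (l : letter) : seq G :=
  if l is @Per _ _ _ _ i h then (if i == i0 then [:: \val h] else [::]) else [::].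

Hypothesis OmV : forall x, x \in Om -> x^-1 \in Om.
Hypothesis R_Om : forall r, R r -> all (mem Om) (flatten [seq per_val l | l <- r]).

(** On a letter [h] of [P i0] read at [g] this gives [F g - F (g * h)]: jumps inside cosets of
    [P i0] are recorded and everything else is ignored. *)
Definition per_cochain (F : G -> int) (e : edge) : int :=
  if e.2 == inr i0 then F e.1 else 0%R.

Lemma pairing_letter (F : G -> int) g (l : letter) : pairing (per_cochain F) (letter_arcs g l) =
  (\sum_(h <- per_val l) (F g - F (g * h)%g))%R.
Proof.
case: l => [x []|i h] /=; rewrite !pairing_cons pairing_nil /per_cochain /= ?big_nil ?addr0 ?oppr0 //.
rewrite -[inr i == _]/(i == i0); case: eqP => _; last by rewrite big_nil oppr0 addr0.
by rewrite big_seq1.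
Qed.

Lemma pairing_word_bound (F : G -> int) (c : nat) (Q : pred G) g (w : word) :
  (forall y h, Q h -> P i0 h -> `|F y - F (y * h)%g| <= c%:Z)%R ->
  all Q (flatten [seq per_val l | l <- w]) ->
  (`|pairing (per_cochain F) (word_arcs g w)| <= (c * size w)%:Z)%R.
Proof.
move=> Fc; elim: w g => [|l w IH] g /=; first by rewrite pairing_nil.
rewrite all_cat pairing_cat => /andP[Ql /(IH (g * letter_val l))].
rewrite pairing_letter.
have : (`|\sum_(h <- per_val l) (F g - F (g * h)%g)| <= c%:Z)%R.
  case: l Ql => [x b|i h] /=; first by rewrite big_nil.
  case: eqP => [ii0|_] /=; last by rewrite big_nil.
  rewrite big_seq1 andbT => Qh; apply: Fc => //.
  by rewrite -ii0; exact: set_mem (valP h).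
move: (pairing _ _) (\sum_(_ <- _) _)%R => *; nia.
Qed.

Lemma pairing_filling_bound (F : G -> int) (w : word) g : (forall y h, h \in Om -> P i0 h -> `|F y - F (y * h)%g| <= 1)%R ->
  word_val w = 1 -> (`|pairing (per_cochain F) (word_arcs g w)| <= (M * (C * size w))%:Z)%R.
Proof.
move=> F1 w1; have [k kle kR] := dehn w1.
have [c [ck cR] ceq] := conj_prod_filling pres kR g.
rewrite -ceq; have : (`|pairing (per_cochain F) (cells_bd c)| <= (M * size c)%:Z)%R.
  elim: c cR {ck ceq} => [|s c IH]; first by rewrite pairing_nil.
  rewrite cells_in_cons => /andP[+ /IH].
  rewrite /cells_in /= andbT => /asboolP sR.
  rewrite /cells_bd /= pairing_cat -/(cells_bd c).
  have := @pairing_word_bound F 1 (mem Om) s.2.1 s.2.2 F1 (R_Om sR).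
  have := R_size sR; rewrite /cell_arcs; case: s.1; rewrite ?pairing_opp;
    move: (pairing _ _) (pairing _ _) (size _) (size _) => *; nia.
have := leq_mul (leqnn M) kle; rewrite -ck.
move: (pairing _ _) (M * size c)%N (M * _)%N => *; lia.
Qed.

Lemma ballS k : ball Om k.+1 = [seq t * b | t <- 1 :: Om, b <- ball Om k].
Proof. by []. Qed.

Lemma ball_right k b t : b \in ball Om k -> t \in Om -> b * t \in ball Om k.+1.
Proof.
move=> + tO; elim: k b => [|k IH] b.
  move=> b0; have {b0}/eqP-> : b == 1 by move: b0; rewrite /= inE.
  rewrite ballS; apply/allpairsP; exists (t, 1) => /=.
  by rewrite mulg1 mul1g !inE tO orbT eqxx.
move=> /allpairsP [[t0 b'] /= [t0O /IH b'O ->]].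
by rewrite -mulgA; exact: (allpairs_f (fun x y => x * y) t0O b'O).
Qed.

(** Word length over [Om] cut off at [k]; elements outside the smaller balls, in particular those
    not generated by [Om], get the value [k]. *)
Definition trunc_len k y := find (fun j => y \in ball Om j) (iota 0 k).

Lemma trunc_len_le k y : trunc_len k y <= k.
Proof. by rewrite (leq_trans (find_size _ _)) // size_iota. Qed.

Lemma trunc_len_mul k y t : t \in Om -> trunc_len k (y * t) <= (trunc_len k y).+1.
Proof.
move=> tO; have [h|h] := leqP k (trunc_len k y).
  exact: leq_trans (trunc_len_le _ _) (leq_trans h (leqnSn _)).
have yb : y \in ball Om (trunc_len k y).
  have := h; rewrite -{2}(size_iota 0 k) -has_find => /(nth_find 0).
  by rewrite nth_iota.
have [|h2] := ltnP (trunc_len k y).+1 k; last exact: leq_trans (trunc_len_le _ _) h2.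
move=> h2; rewrite leqNgt; apply/negP => /(before_find 0).
by rewrite nth_iota // add0n ball_right.
Qed.

Lemma trunc_len_far k y : (forall j, j < k -> y \notin ball Om j) -> trunc_len k y = k.
Proof.
move=> H; apply/eqP; rewrite eqn_leq trunc_len_le leqNgt; apply/negP => h.
have := h; rewrite -{2}(size_iota 0 k) -has_find => /(nth_find 0).
by rewrite nth_iota // add0n; apply/negP; exact: H.
Qed.

Variables (g h : G) (k : nat).
Hypothesis Ph : P i0 h.
Hypothesis h_far : forall j, j < k -> h \notin ball Om j.
Local Notation wg := (dist_word P_sub gen 1 g).
Hypothesis wg_Om : all (mem Om) (flatten [seq per_val l | l <- wg]).

Let per_h : letter := Per X (SigSub (mem_set Ph)).
Fixpoint rep_word m : word := if m is m'.+1 then rep_word m' ++ wg ++ [:: per_h] else [::].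
Let gj j := (g * h) ^+ j * g.

Lemma rep_word_val m : word_val (rep_word m) = (g * h) ^+ m.
Proof.
elim: m => [|m IH] /=; first by rewrite word_val_nil.
rewrite !word_val_cat IH word_val1 /= expgSr; congr (_ * (_ * _)).
by have := dist_word_val P_sub gen 1 g; rewrite mul1g.
Qed.

Lemma size_rep_word m : size (rep_word m) = (m * (size wg).+1)%N.
Proof. by elim: m => //= m IH; rewrite !size_cat IH /=; lia. Qed.

(** Each long letter [h] contributes [k] to the pairing, in a coset of its own, while a filling cell
    contributes at most [M] because its peripheral letters lie in [Om]. So the area or the tail must
    pay for [m * k]. The tail bound is asked for all admissible [F], since [F] is constructed in the
    proof. *)
Lemma penetration m (t : word) : word_val (rep_word m ++ t) = 1 ->
  (forall a b, a < b -> b < m -> ~ P i0 ((gj a)^-1 * gj b)) ->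
  forall s : nat,
  (forall F : G -> int, (forall y, (exists2 j, j < m & P i0 ((gj j)^-1 * y)) \/ F y = 0%R) ->
    (forall y x, x \in Om -> P i0 x -> `|F y - F (y * x)%g| <= 1)%R ->
    (forall y x, P i0 x -> `|F y - F (y * x)%g| <= k%:Z)%R ->
    (`|pairing (per_cochain F) (word_arcs ((g * h) ^+ m) t)| <= s%:Z)%R) ->
  m * k <= M * (C * (m * (size wg).+1 + size t)) + m * size wg + s.
Proof.
move=> W1 dis s tail.
have [P1 PM PV] := P_sub i0.
pose inc y j := `[< P i0 ((gj j)^-1 * y) >].
pose idx y := find (inc y) (iota 0 m).
(* In the coset entered at [gj j] the function is the truncated length measured from [gj j]; it is 0
   outside these cosets. *)
pose F y : int := if idx y < m then (trunc_len k ((gj (idx y))^-1 * y))%:Z%R else 0%R.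
have idxP y x : P i0 x -> idx (y * x) = idx y.
  move=> Px; apply: eq_find => j; rewrite /inc mulgA; apply/asboolP/asboolP => H.
    by rewrite -(mulgK x (_ * y)); apply: PM => //; exact: PV.
  exact: PM.
have Fk y x : P i0 x -> (`|F y - F (y * x)%g| <= k%:Z)%R.
  move=> Px; rewrite /F (idxP _ _ Px); case: ifP => // _; rewrite mulgA.
  have := trunc_len_le k ((gj (idx y))^-1 * y).
  have := trunc_len_le k ((gj (idx y))^-1 * y * x).
  move: (trunc_len _ _) (trunc_len _ _) => *; lia.
have F1 y x : x \in Om -> P i0 x -> (`|F y - F (y * x)%g| <= 1)%R.
  move=> xO Px; rewrite /F (idxP _ _ Px); case: ifP => // _; rewrite mulgA.
  have := trunc_len_mul k ((gj (idx y))^-1 * y) xO.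
  have := trunc_len_mul k ((gj (idx y))^-1 * y * x) (OmV xO).
  rewrite mulgK; move: (trunc_len _ _) (trunc_len _ _) => *; lia.
have idxg j : j < m -> idx (gj j) = j.
  move=> jm; have hj : has (inc (gj j)) (iota 0 m).
    by apply/hasP; exists j; rewrite ?mem_iota //; apply/asboolP; rewrite mulVg.
  have im : idx (gj j) < m by rewrite /idx -{2}(size_iota 0 m) -has_find.
  have := nth_find 0 hj; rewrite -/(idx _) nth_iota // add0n => /asboolP Hi.
  have [ij|ji|//] := ltngtP (idx (gj j)) j; first by case: (dis _ _ ij jm).
  by case: (dis _ _ ji im); have := PV _ Hi; rewrite invgM invgK.
have Fg j : j < m -> F (gj j) = 0%R.
  move=> jm; rewrite /F idxg // jm mulVg; congr Posz; apply/eqP; rewrite -leqn0.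
  case: (k) => [|k']; first exact: trunc_len_le.
  by rewrite /trunc_len /= inE eqxx.
have Fgh j : j < m -> F (gj j * h) = k%:Z%R.
  move=> jm; rewrite /F idxP // idxg // jm mulKg trunc_len_far //.
have wgb y : (`|pairing (per_cochain F) (word_arcs y wg)| <= (size wg)%:Z)%R.
  have := @pairing_word_bound F 1 (mem Om) y wg F1 wg_Om; by rewrite mul1n.
have main j : j <= m -> (pairing (per_cochain F) (word_arcs 1 (rep_word j)) <=
    (j * size wg)%:Z - (j * k)%:Z)%R.
  elim: j => [|j IH] jm; first by rewrite pairing_nil.
  rewrite /= !word_arcs_cat !pairing_cat rep_word_val mul1g.
  have -> : word_val wg = g by have := dist_word_val P_sub gen 1 g; rewrite mul1g.
  rewrite pairing_nil addr0 (pairing_letter F _ per_h) /=.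
  rewrite eqxx big_seq1 -/(gj j) Fg // Fgh //.
  have := IH (ltnW jm); have := wgb ((g * h) ^+ j).
  move: (pairing _ _) (pairing _ _) => *; nia.
have := main m (leqnn _).
have := @pairing_filling_bound F (rep_word m ++ t) 1 F1 W1.
rewrite word_arcs_cat pairing_cat rep_word_val mul1g size_cat size_rep_word.
have Fz y : (exists2 j, j < m & P i0 ((gj j)^-1 * y)) \/ F y = 0%R.
  rewrite /F; case: ifP => im; last by right.
  left; exists (idx y) => //.
  have hy : has (inc y) (iota 0 m) by rewrite has_find size_iota.
  by have := nth_find 0 hy; rewrite -/(idx _) nth_iota // add0n => /asboolP.
have := tail F Fz F1 Fk.
move: (pairing _ _) (pairing _ _) (M * (C * _))%N => *; lia.
Qed.

Hypothesis gP : ~ P i0 g.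
Hypothesis k_big : 2 * (M * C * (size wg).+1) + 2 * size wg < k.

(** Since [(gj a)^-1 * gj b] is [h * gj (b - a.+1)], the induction hypothesis separates the cosets
    used so far. If the next [gj j] were peripheral, the word would close up with only one more copy
    of [wg]; the factor 2 in [k_big] covers that copy. *)
Lemma rep_not_peripheral j : ~ P i0 (gj j).
Proof.
have [P1 PM PV] := P_sub i0.
elim/ltn_ind: j => j IH.
case: j IH => [|j] IH Pj; first by apply: gP; move: Pj; rewrite /gj expg0 mul1g.
have dis a b : a < b -> b < j.+1 -> ~ P i0 ((gj a)^-1 * gj b).
  move=> ab bj H; apply: (IH (b - a.+1)%N); first by lia.
  have -> : gj (b - a.+1)%N = h^-1 * ((gj a)^-1 * gj b).
    rewrite /gj; have {2}-> : b = (a + 1 + (b - a.+1))%N by lia.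
    by rewrite !expgnDr expg1 invgM !mulgA mulgVK -!mulgA !mulKg.
  by apply: PM => //; exact: PV.
have Pv := PV _ Pj.
pose t := wg ++ [:: Per X (SigSub (mem_set Pv))] : word.
have wgv : word_val wg = g by have := dist_word_val P_sub gen 1 g; rewrite mul1g.
have W1 : word_val (rep_word j.+1 ++ t) = 1.
  by rewrite word_val_cat rep_word_val /t word_val_cat wgv word_val1 /= mulgA mulgV.
have := penetration W1 dis (s := size wg).
rewrite /t size_cat /= => H.
have {}H : j.+1 * k <= M * (C * (j.+1 * (size wg).+1 + (size wg + 1))) + j.+1 * size wg + size wg.
  apply: H => F Fz F1 Fk.
  rewrite word_arcs_cat pairing_cat wgv -/(gj j.+1).
  rewrite -[word_arcs _ [:: _]]/(letter_arcs (gj j.+1) (Per X (SigSub (mem_set Pv)))).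
  rewrite (pairing_letter F _ (Per X (SigSub (mem_set Pv)))) /=.
  rewrite eqxx big_seq1 /= mulgV.
  have FP y : P i0 y -> F y = 0%R.
    move=> Py; have [[a aj Pa]|//] := Fz y; case: (IH a aj).
    have := PM _ _ Py (PV _ Pa); by rewrite invgM invgK mulVKg.
  rewrite !FP // subrr addr0.
  by have := @pairing_word_bound F 1 (mem Om) ((g * h) ^+ j.+1) wg F1 wg_Om; rewrite mul1n.
move: H k_big; move: (size wg) => w; nia.
Qed.

(** The power is closed up by a geodesic word. Each of its letters pays at most [M * C] through the
    area and [k] through the cochain, so its length is at least proportional to [m]. *)
Lemma peripheral_loxodromic m : m <= (M * C + k) * wlen P_sub gen ((g * h) ^+ m).
Proof.
have dis a b : a < b -> b < m -> ~ P i0 ((gj a)^-1 * gj b).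
  move=> ab bj H; apply: (@rep_not_peripheral (b - a.+1)%N).
  have [P1 PM PV] := P_sub i0.
  have -> : gj (b - a.+1)%N = h^-1 * ((gj a)^-1 * gj b).
    rewrite /gj; have {2}-> : b = (a + 1 + (b - a.+1))%N by lia.
    by rewrite !expgnDr expg1 invgM !mulgA mulgVK -!mulgA !mulKg.
  by apply: PM => //; exact: PV.
have [t ts tv] := wlenP P_sub gen ((g * h) ^+ m)^-1.
have W1 : word_val (rep_word m ++ t) = 1 by rewrite word_val_cat rep_word_val tv mulgV.
have := penetration W1 dis (s := (k * size t)%N).
rewrite ts wlenV => H.
have {}H : m * k <= M * (C * (m * (size wg).+1 + wlen P_sub gen ((g * h) ^+ m))) + m * size wg
    + k * wlen P_sub gen ((g * h) ^+ m).
  apply: H => F Fz F1 Fk; rewrite -wlenV -ts.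
  by apply: (@pairing_word_bound F k xpredT) => [y x _|]; [exact: Fk|exact: all_predT].
move: H k_big; move: (size wg) (wlen _ _ _) => w l; nia.
Qed.

End InfinitePeripheral.

End RelativePresentation.

(** * Acylindrically hyperbolic metrics *)

(** [D], [Rad] and [Num] are parameters, not existentially bound, so that bounds derived from them
    hold simultaneously for a whole family of metrics. *)
Record acyl_hyperbolic (G : groupType) (D : nat) (Rad Num : nat -> nat)
    (d : G -> G -> nat) : Prop := AcylHyperbolic {
  hyp_metric : geodesic_metric d;
  hyp_four_point : forall x y z w,
    d x z + d y w <= d x y + d z w + D \/ d x z + d y w <= d x w + d y z + D;
  hyp_acyl : forall e p q, Rad e <= d p q -> forall s : seq G, uniq s ->
    (forall g, g \in s -> d p (g * p) <= e /\ d q (g * q) <= e) -> size s <= Num e }.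

(* The library's lemmas leave group operations that are typed through different
   inheritance paths of groupType; they are identified before calling lia. *)
Ltac canon_group G :=
  let m := constr:(fun x y : Group.sort G => x * y) in
  let v := constr:(fun x : Group.sort G => x^-1) in
  let e := constr:(fun (x : Group.sort G) (n : nat) => x ^+ n) in
  match m with context [@monoid.mul ?A] => match v with context [@monoid.inv ?B] =>
  match e with context [@monoid.natexp ?C] =>
    repeat match goal with
    | |- context [@monoid.mul ?M] => tryif constr_eq M A then fail else change (@monoid.mul M) with (@monoid.mul A)
    | |- context [@monoid.inv ?M] => tryif constr_eq M B then fail else change (@monoid.inv M) with (@monoid.inv B)
    | |- context [@monoid.natexp ?M] =>
      tryif constr_eq M C then fail else change (@monoid.natexp M) with (@monoid.natexp C)
    end
  end end end.

Ltac dist_gen d :=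
  repeat match goal with
  | H : is_true ?b |- _ => match b with context [d _ _] => revert H end
  | H : @eq nat _ _ |- _ => revert H
  | H : _ \/ _ |- _ => revert H
  end;
  match type of d with Group.sort ?G -> _ => canon_group G end;
  repeat match goal with |- context [d ?x ?y] => generalize (d x y) end;
  intros.

Ltac dist_tac d := dist_gen d; lia.
Ltac dist_nia d := dist_gen d; nia.

(** * Local geodesic orbits and minimal displacement *)

Section Axes.
Variables (G : groupType) (D : nat) (Rad Num : nat -> nat) (d : G -> G -> nat).
Hypothesis H : acyl_hyperbolic D Rad Num d.
Implicit Types (a g h p q x y z : G).

Let tri := dist_tri (hyp_metric H).
Let sym := dist_sym (hyp_metric H).
Let dinv := dist_inv (hyp_metric H).
Let dxx := dist_refl (hyp_metric H).
Let fp := hyp_four_point H.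

Lemma dist_move g x y : d x (g * y) = d (g^-1 * x) y.
Proof. by rewrite -(dinv g (g^-1 * x)) mulVKg. Qed.

Lemma dist_powD a p m n : d (a ^+ m * p) (a ^+ (m + n) * p) = d p (a ^+ n * p).
Proof. by rewrite expgnDr -mulgA dinv. Qed.

Lemma dist_pow_le a n y : d y (a ^+ n * y) <= n * d y (a * y).
Proof.
elim: n => [|n IH]; first by rewrite expg0 mul1g dxx.
have := tri (a ^+ n * y) y (a ^+ n.+1 * y); rewrite expgSr -mulgA dinv mulSn.
by dist_tac d.
Qed.

Section Orbit.
Variables (a p : G) (t : nat).
Local Notation L n := (d p (a ^+ n%N * p)).
Hypothesis tL : 2 * L 1 <= L 2 + t.
Hypothesis tD : t + 2 * D < L 1.

(** Local-to-global principle for an orbit with defect [t] at each point. In the four-point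
    condition on [p] and three successive orbit points, the unwanted alternative contradicts the
    inductive lower bound. *)
Lemma orbit_step n : L n + L 1 <= L n.+1 + t + D.
Proof.
elim: n => [|n IH]; first by rewrite expg0 mul1g dxx; lia.
case: n IH => [|n] IH; first by move: tL; lia.
have := fp p (a ^+ n.+1 * p) (a ^+ n.+2 * p) (a ^+ n.+3 * p).
have -> : d (a ^+ n.+1 * p) (a ^+ n.+3 * p) = L 2 by rewrite -(addn2 n.+1) dist_powD.
have -> : d (a ^+ n.+2 * p) (a ^+ n.+3 * p) = L 1 by rewrite -(addn1 n.+2) dist_powD.
have -> : d (a ^+ n.+1 * p) (a ^+ n.+2 * p) = L 1 by rewrite -(addn1 n.+1) dist_powD.
by move: tL tD IH => /=; dist_tac d.
Qed.

Lemma orbit_add m n : L m + L n <= L (m + n)%N + t + 2 * D.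
Proof.
case: n => [|n]; first by rewrite addn0 expg0 mul1g dxx; lia.
have := fp p (a ^+ m * p) (a ^+ m.+1 * p) (a ^+ (m + n.+1) * p).
have -> : d (a ^+ m * p) (a ^+ (m + n.+1) * p) = L n.+1 by rewrite dist_powD.
have -> : d (a ^+ m.+1 * p) (a ^+ (m + n.+1) * p) = L n by rewrite -addSnnS dist_powD.
have -> : d (a ^+ m * p) (a ^+ m.+1 * p) = L 1 by rewrite -addn1 dist_powD.
by have := orbit_step m; have := orbit_step n; move: tL tD => /=; dist_tac d.
Qed.

Lemma orbit_linear n : n * L 1 <= L n + n * (t + D).
Proof.
elim: n => // n IH; have := orbit_step n; rewrite !mulSn.
by move: tD IH => /=; dist_tac d.
Qed.

(* The translation length of a power is compared on long stretches of the orbit. *)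
Lemma orbit_disp n y : L n <= d y (a ^+ n * y) + t + 2 * D.
Proof.
have mul m : m * L n <= L (m * n)%N + m * (t + 2 * D).
  elim: m => // m IH; have := orbit_add n (m * n); rewrite !mulSn.
  by move: IH; dist_tac d.
have up m : L (m * n)%N <= m * d y (a ^+ n * y) + 2 * d p y.
  have := dist_pow_le (a ^+ n) m y; rewrite -expgnA (mulnC n m).
  have := tri y p (a ^+ (m * n) * p); have := tri (a ^+ (m * n) * y) y (a ^+ (m * n) * p).
  rewrite dinv (sym y p) /=; dist_tac d.
rewrite leqNgt; apply/negP => lt; have := mul (2 * d p y).+1; have := up (2 * d p y).+1.
by move: lt; clear; dist_nia d.
Qed.

End Orbit.

Lemma mdisp_ex a : exists k, `[< exists y, d y (a * y) = k >].
Proof. by exists (d 1 (a * 1)); apply/asboolP; exists 1. Qed.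

Definition mdisp a := ex_minn (mdisp_ex a).

Lemma mdisp_le a y : mdisp a <= d y (a * y).
Proof. by rewrite /mdisp; case: ex_minnP => k _; apply; apply/asboolP; exists y. Qed.

Lemma mdisp_att a : exists y, d y (a * y) = mdisp a.
Proof. by rewrite /mdisp; case: ex_minnP => k /asboolP. Qed.

Lemma mdispJ a g : mdisp (g * a * g^-1) = mdisp a.
Proof.
apply/eqP; rewrite eqn_leq; apply/andP; split.
  have [y <-] := mdisp_att a; have := mdisp_le (g * a * g^-1) (g * y).
  by rewrite -!mulgA mulKg dinv.
have [y <-] := mdisp_att (g * a * g^-1); have := mdisp_le a (g^-1 * y).
by rewrite -(dinv g) mulVKg !mulgA.
Qed.

Lemma mdispV a : mdisp a^-1 = mdisp a.
Proof.
suff le b : mdisp b^-1 <= mdisp b.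
  by apply/eqP; rewrite eqn_leq le; have := le a^-1; rewrite invgK.
have [y <-] := mdisp_att b; have := mdisp_le b^-1 y.
by rewrite dist_move invgK sym.
Qed.

Lemma mdispX_le a n : mdisp (a ^+ n) <= n * mdisp a.
Proof.
have [y <-] := mdisp_att a; exact: leq_trans (mdisp_le _ y) (dist_pow_le _ _ _).
Qed.

(* Moving to the middle of [p, ap] would shorten the displacement if the
   geodesics [p, ap] and [ap, aap] had a long common part. *)
Lemma min_point_axis a p : d p (a * p) = mdisp a -> 2 * D + 1 < mdisp a ->
  2 * d p (a ^+ 1 * p) <= d p (a ^+ 2 * p) + 2 * D.
Proof.
move=> pl lD; rewrite expg1 expg2 -mulgA.
have hl : (d p (a * p) %/ 2 <= d p (a * p)) by lia.
have [m pm mp] := dist_geo (hyp_metric H) hl.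
have := mdisp_le a m; rewrite -pl in lD *.
have a1 : d (a * p) (a * m) = d p m by rewrite dinv.
have a2 : d (a * m) (a * (a * p)) = d m (a * p) by rewrite dinv.
have a3 : d (a * p) (a * (a * p)) = d p (a * p) by rewrite dinv.
have := fp p m (a * p) (a * (a * p)); have := fp m (a * p) (a * m) (a * (a * p)).
rewrite (sym (a * m) (a * (a * p))) (sym (a * (a * p)) (a * m)) a1 a2 a3 pm mp.
move: (d p (a * p)) lD => l lD; dist_tac d.
Qed.

(** Above this threshold the orbit of a point of minimal displacement is a local geodesic with
    defect [2 * D], and every step gains more than the error terms of size at most [7 * D] lose. *)
Definition big a := 10 * D + 10 <= mdisp a.

Lemma big_axis a p : big a -> d p (a * p) = mdisp a ->
  2 * d p (a ^+ 1 * p) <= d p (a ^+ 2 * p) + 2 * D /\ 2 * D + 2 * D < d p (a ^+ 1 * p).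
Proof.
rewrite /big => al pl; split; first by apply: min_point_axis => //; lia.
by rewrite expg1 pl; lia.
Qed.

Lemma bigV a : big a -> big a^-1. Proof. by rewrite /big mdispV. Qed.
Section BigOrbit.
Variables (a p : G).
Hypothesis (al : big a) (pl : d p (a * p) = mdisp a).
Local Notation L n := (d p (a ^+ n%N * p)).

Lemma big_add m n : L m + L n <= L (m + n)%N + 4 * D.
Proof. by have [h1 h2] := big_axis al pl; have := orbit_add h1 h2 m n => /=; lia. Qed.

Lemma big_step n : L n + mdisp a <= L n.+1 + 3 * D.
Proof.
have [h1 h2] := big_axis al pl; have := orbit_step h1 h2 n.
by rewrite expg1 pl /=; lia.
Qed.

Lemma big_linear n : n * mdisp a <= L n + n * (3 * D).
Proof.
have [h1 h2] := big_axis al pl; have := orbit_linear h1 h2 n.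
by rewrite expg1 pl /=; move: (L n) => x; nia.
Qed.

Lemma big_grow n : n <= L n.
Proof.
have := big_linear n; move: al; rewrite /big; move: (L n) (mdisp a) => x l; nia.
Qed.

Lemma big_disp n y : L n <= d y (a ^+ n * y) + 4 * D.
Proof. by have [h1 h2] := big_axis al pl; have := orbit_disp h1 h2 n y => /=; lia. Qed.

Lemma big_mdispX n : L n <= mdisp (a ^+ n) + 4 * D.
Proof. by have [y <-] := mdisp_att (a ^+ n); exact: big_disp. Qed.

Lemma big_upper n : L n <= n * mdisp a.
Proof. by rewrite -pl; exact: dist_pow_le. Qed.

End BigOrbit.

Lemma big_mdisp_linear a n : big a -> n * mdisp a <= mdisp (a ^+ n) + n * (7 * D).
Proof.
case: n => // n al; have [p pl] := mdisp_att a.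
have := big_linear al pl n.+1; have := big_mdispX al pl n.+1.
move: (d _ _) (mdisp _) (mdisp _) => *; nia.
Qed.

End Axes.

Definition loxodromic (G : groupType) (d : G -> G -> nat) (a : G) :=
  exists c, forall n, n <= c * d 1 (a ^+ n).

Section Loxodromic.
Variables (G : groupType) (D : nat) (Rad Num : nat -> nat) (d : G -> G -> nat).
Hypothesis H : acyl_hyperbolic D Rad Num d.
Implicit Types (a b g h p q x y z : G).

Let tri := dist_tri (hyp_metric H).
Let sym := dist_sym (hyp_metric H).
Let dinv := dist_inv (hyp_metric H).
Let dxx := dist_refl (hyp_metric H).
Let fp := hyp_four_point H.
Local Notation lox := (loxodromic d).
Local Notation mdisp := (mdisp d).
Local Notation big := (big D d).

Lemma distV a p n : d p (a^-1 ^+ n * p) = d p (a ^+ n * p).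
Proof. by rewrite expVgn -(dinv (a ^+ n)) mulVKg sym. Qed.

Lemma dist_commute a b p : commute a b -> d (b * p) (a * (b * p)) = d p (a * p).
Proof. by move=> ab; rewrite mulgA ab -mulgA dinv. Qed.

(** Changing the base point costs only an additive constant, which disappears on passing to high
    powers of [a ^+ m]. *)
Lemma lox_disp a c : (forall n, n <= c * d 1 (a ^+ n)) ->
  forall m y, m <= c * d y (a ^+ m * y).
Proof.
move=> ac m y; rewrite leqNgt; apply/negP => lt.
have [k kE] : exists k, k = (2 * c * d 1 y).+1 by eexists.
have h1 := ac (m * k)%N; have h2 := dist_pow_le H (a ^+ m) k y.
rewrite -expgnA in h2; have := tri y 1 (a ^+ (m * k)).
have := tri (a ^+ (m * k) * y) y (a ^+ (m * k)).
have -> : d (a ^+ (m * k) * y) (a ^+ (m * k)) = d 1 y.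
  by rewrite -{2}[a ^+ (m * k)]mulg1 dinv sym.
by move: h1 h2 lt kE; clear; dist_nia d.
Qed.

Lemma big_lox a : big a -> lox a.
Proof.
move=> al; have [p pl] := mdisp_att d a; exists 1%N => n; rewrite mul1n.
have := big_linear H al pl n; have := big_disp H al pl n 1; move: al; rewrite /big mulg1.
case: n => // n; move: (mdisp a) => l hl; have := leq_mul (leqnn n.+1) hl; dist_tac d.
Qed.

Lemma loxX a m : lox a -> 0 < m -> lox (a ^+ m).
Proof.
move=> [c ac] m0; exists c => n; have := ac (m * n)%N; rewrite expgnA.
by move: m0; dist_nia d.
Qed.

Lemma lox_pow_disp a : lox a -> forall B, exists2 m, 0 < m & B <= mdisp (a ^+ m).
Proof.
move=> [c ac] B; exists (c * B).+1 => //.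
have [y yd] := mdisp_att d (a ^+ (c * B).+1); have := lox_disp ac (c * B).+1 y.
by rewrite yd; move: (mdisp _) => x; nia.
Qed.

Lemma lox_pow_big a : lox a -> exists2 m, 0 < m & big (a ^+ m).
Proof. by move=> /lox_pow_disp /(_ (10 * D + 10)%N). Qed.

Lemma lox_pow_inj a i j : lox a -> a ^+ i = a ^+ j -> i = j.
Proof.
move=> [c ac]; wlog ij : i j / i <= j.
  by move=> W; case: (leqP i j) => [|/ltnW] ij E; [exact: W|symmetry; apply: W].
move=> E; have E1 : a ^+ (j - i) = 1.
  by apply: (mulgI (a ^+ i)); rewrite -expgnDr subnKC // mulg1.
by have := ac (j - i)%N; rewrite E1 dxx muln0; lia.
Qed.

(* If gp lies forward of p along the orbit of h, then g^-1 p lies behind p;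
   hence g^-1 p, p, gp is a local geodesic. *)
Lemma commuting_disp_aux h g p qm : big h -> d p (h * p) = mdisp h -> commute h g ->
  d qm (g * qm) = d p (g * p) -> d p (g * p) + 10 * D + 10 <= d p qm ->
  d p (g * p) + d p qm <= d (g * p) qm + 5 * D ->
  d p (g * p) <= mdisp g + 13 * D.
Proof.
move=> hl pl hg gqm far fwd.
have h1 := fp p (g * p) (g * qm) qm.
have e1 : d (g * p) (g * qm) = d p qm by rewrite dinv.
have e2 : d p (g * qm) = d (g^-1 * p) qm by rewrite (dist_move H).
have e3 := tri (g^-1 * p) (g * p) qm; rewrite (sym (g * p) (g^-1 * p)) in e3.
have e4 : d (g^-1 * p) (g * p) = d p (g ^+ 2 * p).
  by rewrite expg2 -[g * g * p]mulgA [RHS](dist_move H).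
have [lt|ge] := leqP (d p (g * p)) (13 * D); first by apply: leq_trans lt (leq_addl _ _).
have [y yd] := mdisp_att d g.
have t1 : 2 * d p (g ^+ 1 * p) <= d p (g ^+ 2 * p) + 11 * D.
  rewrite expg1; move: h1 e1 e2 e3 e4 gqm far fwd.
  rewrite (sym (g * qm) qm); dist_tac d.
have t2 : 11 * D + 2 * D < d p (g ^+ 1 * p) by rewrite expg1; dist_tac d.
by have := orbit_disp H t1 t2 1 y; rewrite !expg1; dist_tac d.
Qed.

(** [g] coarsely preserves the axis of [h] and shifts [p] forwards or backwards along it. Far orbit
    points in the two directions are the reference points for [commuting_disp_aux]. *)
Lemma commuting_disp h g p : big h -> d p (h * p) = mdisp h -> commute h g ->
  d p (g * p) <= mdisp g + 13 * D.
Proof.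
move=> hl pl hg; have [J JE] : exists J, J = (d p (g * p) + 10 * D + 10)%N by eexists.
have L := big_grow H hl pl J; have A := big_add H hl pl J J.
have [q1 q1E] : exists q, q = h ^+ J * p by eexists.
have [q2 q2E] : exists q, q = h^-1 ^+ J * p by eexists.
have d1 : d q1 (g * q1) = d p (g * p) by rewrite q1E; apply/dist_commute/commuteX.
have d2 : d q2 (g * q2) = d p (g * p).
  by rewrite q2E; apply/dist_commute/commuteX/commuteV/commute_sym.
have e2 : d p q2 = d p q1 by rewrite q2E q1E distV.
have e12 : d q2 q1 = d p (h ^+ (J + J) * p).
  rewrite -(dinv (h ^+ J) q2 q1) q2E expVgn mulVKg.
  by rewrite expgnDr -mulgA -q1E.
have := fp p q2 (g * p) q1; rewrite e2 (sym (g * p) q1) (sym q2 (g * p)) e12.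
rewrite -q1E in L A.
move=> [|] h1.
  apply: (commuting_disp_aux (h := h) (qm := q1)) => //; first by move: L; lia.
  by move: h1 A; rewrite (sym (g * p) q1); dist_tac d.
apply: (commuting_disp_aux (h := h) (qm := q2)) => //; rewrite e2; first by move: L; lia.
by move: h1 A; dist_tac d.
Qed.

End Loxodromic.

Lemma collision (T : Type) (s : nat -> T) n :
  ~ injective (fun i : 'I_n => s i) -> exists i j, [/\ i < j, j < n & s i = s j].
Proof.
move=> /existsNP[i] /existsNP[j] /not_implyP[sij] /eqP ij.
wlog lt : i j sij ij / i < j.
  move=> W; case: (ltngtP i j) => lt; [exact: (W i j)|apply: (W j i) => //; by rewrite eq_sym|].
  by case/eqP: ij; apply: val_inj.
by exists i, j.
Qed.

(** If [h], ..., [h ^+ n1] all had small displacement, then, commuting with a big power of [h], they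
    would all move two far points of its axis by at most [e], against [n1 > Num e]. So one exponent
    up to [n1] works, and it divides the factorial of [n1], which depends only on the constants. *)
Lemma uniform_power (G : groupType) D Rad Num B : exists2 n0, 0 < n0 &
  forall d : G -> G -> nat, acyl_hyperbolic D Rad Num d ->
  forall h, loxodromic d h -> B <= mdisp d (h ^+ n0).
Proof.
pose B' := (B + 10 * D + 10)%N; pose e := (B' + 13 * D)%N; pose n1 := (Num e).+1.
exists n1`!; first exact: fact_gt0.
move=> d H h hl.
have [/existsP[i /andP[i0 Bi]]|/existsPn nBi] := boolP [exists i : 'I_n1.+1, (0 < i) && (B' <= mdisp d (h ^+ i))].
  have /dvdnP[m mE] : i %| n1`! by apply: dvdn_fact; rewrite i0 -ltnS ltn_ord.
  have m0 : 0 < m by move: (fact_gt0 n1); rewrite mE; case: (m).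
  have hi : big D d (h ^+ i) by rewrite /big; move: Bi; rewrite /B'; lia.
  have := big_mdisp_linear H m hi; rewrite -expgnA (mulnC i m) -mE; move: Bi; rewrite /B'.
  case: m m0 mE => // m _ _; move: (mdisp d (h ^+ i)) (mdisp d (h ^+ n1`!)) => x y Bx.
  by have : m * (7 * D) <= m * x; [rewrite leq_mul2l; lia|rewrite !(mulSn m); lia].
have [m m0 hm] := lox_pow_big H hl; have [p pl] := mdisp_att d (h ^+ m).
have small i : 0 < i -> i <= n1 -> d p (h ^+ i * p) <= e.
  move=> i0 i1; have [|/negP lt] := boolP (B' <= mdisp d (h ^+ i)).
    by move=> Bi; have /negP[] := nBi (Ordinal (i1 : i < n1.+1)); rewrite /= i0.
  have hc : commute (h ^+ m) (h ^+ i) by apply/commuteX/commute_sym/commuteX.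
  by have := commuting_disp H hm pl hc; move=> le; apply: leq_trans le _; rewrite /e leq_add2r ltnW // ltnNge; apply/negP.
have far := big_grow H hm pl (Rad e).
have := hyp_acyl H far (s := [seq h ^+ i | i <- iota 1 n1]).
rewrite map_inj_uniq ?iota_uniq; last by move=> i j; apply: (lox_pow_inj H hl).
move=> /(_ isT); rewrite size_map size_iota => W.
have : n1 <= Num e; last by rewrite ltnn.
apply: W => _ /mapP[i +] ->; rewrite mem_iota add1n ltnS => /andP[i0 i1].
split; first exact: small.
rewrite (dist_commute H); first exact: small.
by do 2!apply: commuteX; apply/commute_sym/commuteX.
Qed.

(** * Elements whose axes have a long overlap *)

Definition overlap_length D (Rad Num : nat -> nat) A :=
  (2 * (4 * A + 2 * Num (23 * D) + 1) + Rad (23 * D) + Num (23 * D))%N.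

Section Overlap.
Variables (G : groupType) (D : nat) (Rad Num : nat -> nat) (d : G -> G -> nat).
Hypothesis H : acyl_hyperbolic D Rad Num d.
Implicit Types (a b g h p q x y z : G).

Let tri := dist_tri (hyp_metric H).
Let sym := dist_sym (hyp_metric H).
Let dinv := dist_inv (hyp_metric H).
Let dxx := dist_refl (hyp_metric H).
Let fp := hyp_four_point H.
Local Notation lox := (loxodromic d).
Local Notation mdisp := (mdisp d).
Local Notation big := (big D d).

Lemma projection_aux a p q n : big a -> d p (a * p) = mdisp a ->
  d q p <= d q (a * p) -> 0 < n ->
  d q p + d p (a ^+ n * p) <= d q (a ^+ n * p) + mdisp a + D.
Proof.
move=> al pl near; case: n => // -[|n] _; first by rewrite expg1 pl; dist_tac d.
have := fp q (a * p) (a ^+ n.+2 * p) p; have := big_step H al pl n.+1.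
have -> : d (a * p) (a ^+ n.+2 * p) = d p (a ^+ n.+1 * p).
  by have := dist_powD H a p 1 n.+1; rewrite expg1 add1n.
rewrite (sym (a * p) p) (sym (a ^+ n.+2 * p) p) pl => s.
have := fp q p (a * p) (a ^+ n.+2 * p).
have -> : d (a * p) (a ^+ n.+2 * p) = d p (a ^+ n.+1 * p).
  by have := dist_powD H a p 1 n.+1; rewrite expg1 add1n.
by move: s near al; rewrite /big pl; dist_tac d.
Qed.

(* The witness is a point of [Q] nearest to [q]. *)
Lemma projection a (Q : G -> Prop) p0 q : big a -> Q p0 ->
  (forall p, Q p -> [/\ d p (a * p) = mdisp a, Q (a * p) & Q (a^-1 * p)]) ->
  exists2 p, Q p & forall n, 1 < n ->
    2 * d q p + d p (a ^+ n * p) <= d q (a ^+ n * q) + 2 * mdisp a + 3 * D.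
Proof.
move=> al Q0 Qa.
have ex : exists k, `[< exists2 p, Q p & d q p = k >].
  by exists (d q p0); apply/asboolP; exists p0.
case: (ex_minnP ex) => k /asboolP[p Qp pk] kmin; exists p => // n n1.
have near y : Q y -> d q p <= d q y by move=> Qy; rewrite pk; apply/kmin/asboolP; exists y.
have [pl Qap Qavp] := Qa p Qp; have n0 : 0 < n by exact: ltnW.
have h1 := projection_aux al pl (near _ Qap) n0.
have plV : d p (a^-1 * p) = mdisp a^-1.
  by have := distV H a p 1; rewrite !expg1 (mdispV H) -pl.
have h2 := projection_aux (bigV H al) plV (near _ Qavp) n0.
rewrite (distV H) (mdispV H) in h2.
have e1 : d q (a^-1 ^+ n * p) = d p (a ^+ n * q).
  by rewrite expVgn (dist_move H) invgK sym.
have e2 : d (a ^+ n * p) (a ^+ n * q) = d q p by rewrite dinv sym.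
rewrite e1 in h2; have h3 := big_linear H al pl n.
have h4 : 2 * (mdisp a - 3 * D) <= d p (a ^+ n * p).
  by apply: leq_trans (_ : n * (mdisp a - 3 * D) <= _); rewrite ?leq_mul2r ?n1 ?orbT ?mulnBr ?leq_subLR 1?addnC.
have := fp q p (a ^+ n * p) (a ^+ n * q); rewrite e2.
by move: h1 h2 h4 al; rewrite /big; clear; dist_tac d.
Qed.

Lemma shift_end c A p p' w q : d p w + d w q <= d p q + c -> d p p' <= A ->
  2 * A + c + D < 2 * d p w -> d p' w + d w q <= d p' q + (c + D).
Proof.
move=> h1 h2 h3; have := fp p w q p'; have := fp p p' w q.
have := tri p' p w; rewrite (sym w p') (sym q p') (sym p' w).
have := fp p p' q w; rewrite (sym p' w) (sym q w); move: h1 h2 h3; dist_tac d.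
Qed.

Lemma positions_close c k p q x y : d p x + d x q <= d p q + c ->
  d p y + d y q <= d p q + c -> d p x <= d p y + k -> d p y <= d p x + k ->
  d x y <= c + k + D.
Proof.
move=> h1 h2 h3 h4; have := fp p x q y; rewrite (sym x q) (sym y q) in h1 h2 *.
by move: h1 h2 h3 h4; dist_tac d.
Qed.

Section OverlapPoint.
Variables (b b' p p' : G) (A n n' n0 e i : nat).
Hypothesis disps : forall j, mdisp (b ^+ j) = mdisp (b' ^+ j).
Hypothesis bl : big b.
Hypothesis pl : d p (b * p) = mdisp b.
Hypothesis pl' : d p' (b' * p') = mdisp b'.
Hypothesis pA : d p p' <= A.
Hypothesis qA : d (b ^+ n * p) (b' ^+ n' * p') <= A.
Hypothesis i_le : i <= n0.
Hypothesis ei_le : e + i <= n.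
Local Notation L n := (d p (b ^+ n%N * p)).
Local Notation L' n := (d p' (b' ^+ n%N * p')).
Local Notation Z := (4 * A + 2 * (n0 * mdisp b) + 8 * D)%N.
Hypothesis Le : Z < 2 * L e.
Hypothesis Lei : Z < 2 * L (e + i).
Hypothesis Lne : Z < 2 * L (n - e).
Hypothesis Lnei : Z < 2 * L (n - (e + i)).

Lemma overlap_disp : mdisp b' = mdisp b.
Proof. by have := disps 1; rewrite !expg1. Qed.

Lemma overlap_near j : j <= n -> Z < 2 * L j -> Z < 2 * L (n - j) ->
  let x := b ^+ j * p in let q' := b' ^+ n' * p' in
  [/\ d p' x + d x q' <= d p' q' + 6 * D, Z < 2 * d p' x + 2 * A & Z < 2 * d x q' + 2 * A].
Proof.
move=> jn Lj Lnj; move: (qA).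
have [q qE] : exists q, q = b ^+ n * p by eexists.
have [x xE] : exists q, q = b ^+ j * p by eexists.
rewrite -xE -qE; move: (b' ^+ n' * p') => q' qq' /=.
have h := big_add H bl pl j (n - j).
have xq : d x q = L (n - j) by rewrite xE qE -(dist_powD H b p j) subnKC.
rewrite subnKC // -xE -qE -xq in h.
rewrite -xE in Lj; rewrite -xq in Lnj.
have s1 := shift_end (c := 4 * D) h pA; have {s1} s1 : d p' x + d x q <= d p' q + 5 * D.
  by apply: leq_trans (s1 _) _; [move: Lj; dist_tac d|dist_tac d].
have s2 : d q x + d x p' <= d q p' + 5 * D by rewrite (sym q x) (sym x p') (sym q p'); dist_tac d.
have s3 := shift_end (c := 5 * D) s2 qq'.
have {s3} : d q' x + d x p' <= d q' p' + 6 * D.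
  by apply: leq_trans (s3 _) _; [rewrite (sym q x); move: Lnj; dist_tac d|dist_tac d].
rewrite (sym q' x) (sym x p') (sym q' p') => s3; split; first by dist_tac d.
  by have := tri p' p x; move: Lj pA; dist_tac d.
by have := tri q' q x; rewrite (sym q x) (sym q' x); move: Lnj qq'; dist_tac d.
Qed.

(** Where the axes run together, [b ^+ i] and [b' ^+ i] translate by nearly equal lengths because
    their minimal displacements agree; they send a common point to nearly the same place. *)
Lemma overlap_point : d (b ^+ i * (b ^+ e * p)) (b' ^+ i * (b ^+ e * p)) <= 23 * D.
Proof.
have en : e <= n by apply: leq_trans ei_le; exact: leq_addr.
have [h1 f1 f1'] := overlap_near en Le Lne; have [h2 f2 f2'] := overlap_near ei_le Lei Lnei.
have bl' : big b' by rewrite /big overlap_disp.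
have Q2 := overlap_disp.
have step : L' i <= n0 * mdisp b.
  by apply: leq_trans (big_upper H pl' i) _; rewrite Q2 leq_mul2r i_le orbT.
have a1 := big_add H bl pl e i.
have a2 := big_mdispX H bl pl i; have a3 := big_mdispX H bl' pl' i.
have a4 := mdisp_le d (b ^+ i) p; have a5 := mdisp_le d (b' ^+ i) p'.
rewrite disps in a2 a4.
have a6 := big_add H bl' pl' i n'.
have ex : d (b ^+ e * p) (b ^+ (e + i) * p) = L i by rewrite (dist_powD H).
have E : b ^+ i * (b ^+ e * p) = b ^+ (e + i) * p by rewrite mulgA -expgnDr addnC.
rewrite expgnDr -mulgA (dist_move H (b' ^+ i) p' (b' ^+ n' * p')) in a6.
have c1 : d (b' ^+ n' * p') (b' ^+ i * (b' ^+ n' * p')) = L' i.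
  by apply: (dist_commute H); apply: commuteX; apply/commute_sym/commuteX.
rewrite (dist_move H) in c1; have c2 := dist_move H (b' ^+ i) p' p'.
have c3 := dist_move H (b' ^+ i) p' (b ^+ e * p).
have c4 := dist_move H (b' ^+ i) (b' ^+ n' * p') (b ^+ e * p).
have c5 : d ((b' ^+ i)^-1 * (b' ^+ n' * p')) ((b' ^+ i)^-1 * p') = d (b' ^+ n' * p') p' by rewrite dinv.
rewrite E {E}; rewrite /= in h1 f1 f1' h2 f2 f2'.
have [x' xE'] : exists g, g = b' ^+ i * (b ^+ e * p) by eexists.
have [q' qE'] : exists g, g = b' ^+ n' * p' by eexists.
have [w wE] : exists g, g = (b' ^+ i)^-1 * p' by eexists.
have [t tE] : exists g, g = (b' ^+ i)^-1 * q' by eexists.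
have [y yE] : exists g, g = b ^+ e * p by eexists.
have [x xE] : exists g, g = b ^+ (e + i) * p by eexists.
rewrite -?xE' -?qE' -?wE -?yE -?xE in h1 f1 f1' h2 f2 f2' a1 a6 ex c1 c2 c3 c4 c5 *.
rewrite -?tE -?xE' in c1 c2 c3 c4 c5.
rewrite c2 (sym w p') in a3 a5 step a6.
have s1 : d w y + d y q' <= d w q' + 7 * D.
  apply: leq_trans (shift_end (c := 6 * D) h1 step _) _; last by clear; lia.
  by clear -f1; dist_tac d.
have s2 : d t y + d y w <= d t w + 8 * D.
  have s2 : d q' y + d y w <= d q' w + 7 * D by rewrite (sym q' y) (sym y w) (sym q' w); clear -s1; dist_tac d.
  have q't : d q' t <= n0 * mdisp b by rewrite (sym q' t) c1 c2 (sym w p').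
  apply: leq_trans (shift_end (c := 7 * D) s2 q't _) _; last by clear; lia.
  by rewrite (sym q' y); clear -f1'; dist_tac d.
rewrite (sym x x').
have px : d p' x' = d w y by [].
have s3 : d p' x' + d x' q' <= d p' q' + 8 * D.
  by rewrite (sym x' q') (sym p' q') c3 c4 -c5; rewrite (sym w y); clear -s2; dist_tac d.
have s4 : d p' y + d y x <= d p' x + 5 * D.
  have a1' : d p y + d y x <= d p x + 4 * D by rewrite ex.
  apply: leq_trans (shift_end (c := 4 * D) a1' pA _) _; last by clear; lia.
  by rewrite yE; clear -Le; dist_tac d.
apply: leq_trans (positions_close (c := 8 * D) (k := 14 * D) s3 _ _ _) _; last by clear; lia.
- by clear -h2; dist_tac d.
- by rewrite c3; have := tri p' w y; rewrite (sym w p'); clear -s4 ex a2 a5 a3 a4 c2; dist_tac d.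
- rewrite c3; have := tri y p' x; have := tri y w q'; clear -s4 ex a2 a5 a3 a4 c2 a6 h1 s1.
  by dist_tac d.
Qed.

End OverlapPoint.

(** All [(b' ^+ i)^-1 * b ^+ i] with [i <= Num (23 * D)] nearly fix two points at distance at least
    [Rad (23 * D)]. Acylindricity forces two of them to coincide, and their quotient relation
    equates powers of [b] and [b']. *)
Lemma overlap b b' p p' n n' A : (forall j, mdisp (b ^+ j) = mdisp (b' ^+ j)) ->
  big b -> d p (b * p) = mdisp b -> d p' (b' * p') = mdisp b' ->
  d p p' <= A * mdisp b -> d (b ^+ n * p) (b' ^+ n' * p') <= A * mdisp b ->
  overlap_length D Rad Num A * mdisp b <= d p (b ^+ n * p) ->
  exists2 k, 0 < k & b' ^+ k = b ^+ k.
Proof.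
move=> disps bl pl pl' pA qA; rewrite /overlap_length.
(* The overlap consists of a margin of [E] steps at either end, [R] steps between the two test
   points, and [N] steps of room for the powers applied to them. *)
set E := (4 * A + _ + 1)%N; set R := Rad _; set N := Num _ => far.
have l0 : 10 * D + 10 <= mdisp b by [].
have n_big : 2 * E + R + N <= n.
  by have := leq_trans far (big_upper H pl n); rewrite leq_mul2r; lia.
have Lbig j : E <= j -> 4 * (A * mdisp b) + 2 * (N * mdisp b) + 8 * D < 2 * d p (b ^+ j * p).
  move=> Ej; have := big_linear H bl pl j; move: (d p (b ^+ j * p)) => L hL.
  have h1 : j * (6 * D) <= j * mdisp b by rewrite leq_mul2l; lia.
  have h2 : E * mdisp b <= j * mdisp b by rewrite leq_mul2r Ej orbT.
  by move: h1 h2 hL l0; rewrite /E; clear; nia.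
have pt e i : E <= e -> e <= E + R -> i <= N ->
    d (b ^+ i * (b ^+ e * p)) (b' ^+ i * (b ^+ e * p)) <= 23 * D.
  move=> e1 e2 iN; apply: (overlap_point (A := A * mdisp b) (n := n) (n' := n') (n0 := N) (p' := p')) => //;
    by [lia|apply: Lbig; lia].
have far' : R <= d (b ^+ E * p) (b ^+ (E + R) * p).
  by rewrite (dist_powD H); exact: (big_grow H bl pl).
pose g i := (b' ^+ i)^-1 * b ^+ i.
have [inj|ninj] := pselect (injective (fun i : 'I_N.+1 => g i)).
  have := hyp_acyl H far' (s := [seq g (val i) | i <- enum 'I_N.+1]).
  rewrite map_inj_uniq ?enum_uniq // => /(_ isT); rewrite size_map size_enum_ord => W.
  suff : N.+1 <= N by rewrite ltnn.
  apply: W => _ /mapP[i _ ->].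
  have disp e : d (b ^+ e * p) (g i * (b ^+ e * p)) = d (b ^+ i * (b ^+ e * p)) (b' ^+ i * (b ^+ e * p)).
    by rewrite /g -[g' in d _ g']mulgA (dist_move H) invgK sym.
  by have iN : i <= N; [rewrite -ltnS|split; rewrite disp; apply: pt => //; lia].
have [i [j [ij _ gij]]] := collision (n := N.+1) ninj.
exists (j - i)%N; first by rewrite subn_gt0.
apply: (mulIg (b ^+ i)); rewrite -expgnDr subnK 1?ltnW // -(mulVKg (b' ^+ j) (b ^+ j)) -[_ * b ^+ j]gij.
have [k kE] : exists k, k = (j - i)%N by eexists.
by rewrite -kE (_ : j = k + i)%N; [rewrite expgnDr -mulgA mulVKg|rewrite kE subnK 1?ltnW].
Qed.

End Overlap.

(** * Commensurable loxodromic elements *)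

Section Commensurable.
Variable G : groupType.
Implicit Types (a b g h x y : G).

Definition cyc a g := exists k, g = a ^+ k \/ g = a ^- k.

Lemma cycX a k : cyc a (a ^+ k). Proof. by exists k; left. Qed.
Lemma cycV a g : cyc a g -> cyc a g^-1.
Proof. by case=> k [] ->; exists k; [right|left; rewrite invgK]. Qed.

Lemma expgBl a m n : n <= m -> a ^+ m * a ^- n = a ^+ (m - n).
Proof. by move=> nm; rewrite -{1}(subnK nm) expgnDr mulgK. Qed.

Lemma expgBr a m n : n <= m -> a ^- n * a ^+ m = a ^+ (m - n).
Proof. by move=> nm; rewrite -{1}(subnKC nm) expgnDr mulKg. Qed.

Lemma cycM a g h : cyc a g -> cyc a h -> cyc a (g * h).
Proof.
move=> [m [] ->] [n [] ->].
- by rewrite -expgnDr; exact: cycX.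
- case: (leqP n m) => [|/ltnW] nm; first by rewrite expgBl //; exact: cycX.
  by rewrite -[_ * _]invgK invgM invgK expgBl //; apply/cycV/cycX.
- case: (leqP m n) => [|/ltnW] nm; first by rewrite expgBr //; exact: cycX.
  by rewrite -[_ * _]invgK invgM invgK expgBr //; apply/cycV/cycX.
- by rewrite -invgM -expgnDr; apply/cycV/cycX.
Qed.

Lemma cyc_commute a g : cyc a g -> commute a g.
Proof. by case=> k [] ->; [|apply: commuteV]; exact: commuteX. Qed.

Definition commensurable a b :=
  exists i j, [/\ 0 < i, 0 < j & b ^+ j = a ^+ i \/ b ^+ j = a ^- i].

Lemma commensurable_sym a b : commensurable a b -> commensurable b a.
Proof.
move=> [i [j [i0 j0 E]]]; exists j, i; split=> //.
by case: E => ->; [left|right; rewrite invgK].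
Qed.

Lemma commensurable_pow a b i j : 0 < i -> 0 < j ->
  commensurable (a ^+ i) (b ^+ j) -> commensurable a b.
Proof.
move=> i0 j0 [m [n [m0 n0]]]; rewrite -!expgnA => E.
by exists (i * m)%N, (j * n)%N; rewrite !muln_gt0 i0 j0 m0 n0.
Qed.

End Commensurable.

Lemma conj_expg (G : groupType) (a b : G) n : (b * a * b^-1) ^+ n = b * a ^+ n * b^-1.
Proof.
by elim: n => [|n IH]; rewrite ?expg0 ?mulg1 ?mulgV // !expgS IH !mulgA mulgVK.
Qed.

Section OverlapTheorems.
Variables (G : groupType) (D : nat) (Rad Num : nat -> nat) (d : G -> G -> nat).
Hypothesis H : acyl_hyperbolic D Rad Num d.
Implicit Types (a b g h p q x y z : G).

Let tri := dist_tri (hyp_metric H).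
Let sym := dist_sym (hyp_metric H).
Let dinv := dist_inv (hyp_metric H).
Local Notation lox := (loxodromic d).
Local Notation mdisp := (mdisp d).
Local Notation big := (big D d).

Lemma min_point_cyc a p g : d p (a * p) = mdisp a -> cyc a g ->
  d (g * p) (a * (g * p)) = mdisp a.
Proof. by move=> <- /cyc_commute ag; apply: (dist_commute H); exact: commute_sym. Qed.

Lemma orbit_projection a p u : big a -> d p (a * p) = mdisp a ->
  exists2 g, cyc a g & forall n, 1 < n ->
    2 * d u (g * p) + d p (a ^+ n * p) <= d u (a ^+ n * u) + 2 * mdisp a + 3 * D.
Proof.
move=> al pl; pose Q x := exists2 g, cyc a g & x = g * p.
have [||_ [g ag ->] gm] := projection (a := a) (Q := Q) (p0 := p) H u al.
- by exists 1; rewrite ?mul1g //; exact: (cycX a 0).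
- move=> _ [g ag ->]; split; first exact: min_point_cyc.
    by exists (a * g); rewrite ?mulgA //; apply: cycM => //; exact: (cycX a 1).
  by exists (a^-1 * g); rewrite ?mulgA //; apply/cycM => //; apply/cycV/(cycX a 1).
exists g => // n n1; apply: leq_trans (gm n n1); rewrite leq_add2l (dist_commute H) //.
by apply/commute_sym/commuteX/commute_sym/cyc_commute.
Qed.

Lemma near_orbit a p u c : big a -> d p (a * p) = mdisp a -> d u (a ^+ 2 * u) <= c ->
  exists2 g, cyc a g & 2 * d u (g * p) + mdisp a <= c + 2 * mdisp a.
Proof.
move=> al pl uc; have [g ag /(_ 2%N isT) gm] := orbit_projection u al pl.
exists g => //; have := big_step H al pl 1; rewrite expg1 pl.
by move: gm al uc; rewrite /big; dist_tac d.
Qed.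

(** A point displaced by [C * mdisp a] lies within [(C + 2) * mdisp a] of each axis, so orbit points
    on the two axes are within twice that; the second summand pays for replacing [u] and [v] by
    orbit points. *)
Definition overlap_const C := (overlap_length D Rad Num (2 * (C + 2)) + 2 * (C + 2))%N.

Lemma mdispVX a i : mdisp (a^-1 ^+ i) = mdisp (a ^+ i).
Proof. by rewrite expVgn (mdispV H). Qed.

(** Points displaced little lie near both axes, so [u] and [v] mark a common stretch to which
    [overlap] applies. The axes may be traversed in opposite directions, hence the sign. *)
Lemma overlap_conj a a' u v C : (forall j, mdisp (a ^+ j) = mdisp (a' ^+ j)) -> big a ->
  d u (a * u) <= C * mdisp a -> d v (a * v) <= C * mdisp a ->
  d u (a' * u) <= C * mdisp a -> d v (a' * v) <= C * mdisp a ->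
  overlap_const C * mdisp a <= d u v ->
  exists2 k, 0 < k & a' ^+ k = a ^+ k \/ a' ^+ k = a ^- k.
Proof.
move=> disps al ua va ua' va' far.
have la' : mdisp a' = mdisp a by have := disps 1%N; rewrite !expg1.
have al' : big a' by rewrite /big la'.
have near b p x : big b -> mdisp b = mdisp a -> d p (b * p) = mdisp b ->
    d x (b * x) <= C * mdisp a ->
    exists2 g, cyc b g & d x (g * p) <= (C + 2) * mdisp a.
  move=> bl lb pl xC; have := dist_pow_le H b 2 x.
  have [g bg gp] := near_orbit bl pl (leqnn (d x (b ^+ 2 * x))).
  exists g => //; move: xC gp; rewrite lb; move: (mdisp a) => l; rewrite mulnDl.
  by dist_tac d.
have [p pl] := mdisp_att d a; have [p' pl'] := mdisp_att d a'.
have [g ag gu] := near a p u al erefl pl ua; have [h ah hv] := near a p v al erefl pl va.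
have [g' ag' gu'] := near a' p' u al' la' pl' ua'.
have [h' ah' hv'] := near a' p' v al' la' pl' va'.
have orient b q x y : cyc b x -> cyc b y -> exists n b1, [/\ b1 = b \/ b1 = b^-1 & y * q = b1 ^+ n * (x * q)].
  move=> bx bY; have [n En] : cyc b (y * x^-1) by apply: cycM => //; exact: cycV.
  case: En => En; [exists n, b|exists n, b^-1]; (split; first by [left|right]).
    by rewrite -En mulgA mulgVK.
  by rewrite expVgn -En mulgA mulgVK.
have [n [b [bE hE]]] := orient a p g h ag ah; have [n' [b' [bE' hE']]] := orient a' p' g' h' ag' ah'.
have lb j : mdisp (b ^+ j) = mdisp (a ^+ j) by case: bE => -> //; rewrite mdispVX.
have lb' j : mdisp (b' ^+ j) = mdisp (a ^+ j) by case: bE' => ->; rewrite ?mdispVX disps.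
have lb1 : mdisp b = mdisp a by have := lb 1%N; rewrite !expg1.
have lb1' : mdisp b' = mdisp a by have := lb' 1%N; rewrite !expg1.
have bl : big b by rewrite /big lb1.
have mpV c x y : d x (c * x) = mdisp c -> y = c \/ y = c^-1 -> d x (y * x) = mdisp y.
  by move=> xc [] -> //; have := distV H c x 1; rewrite !expg1 (mdispV H) xc.
have pb := mpV _ _ b (min_point_cyc pl ag) bE.
have pb' := mpV _ _ b' (min_point_cyc pl' ag') bE'.
have A1 : d (g * p) (g' * p') <= 2 * (C + 2) * mdisp b.
  have := tri u (g * p) (g' * p'); rewrite (sym (g * p) u) lb1 -mulnA; move: gu gu'; dist_tac d.
have A2 : d (b ^+ n * (g * p)) (b' ^+ n' * (g' * p')) <= 2 * (C + 2) * mdisp b.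
  rewrite -hE -hE'; have := tri v (h * p) (h' * p').
  by rewrite (sym (h * p) v) lb1 -mulnA; move: hv hv'; dist_tac d.
have far' : overlap_length D Rad Num (2 * (C + 2)) * mdisp b <= d (g * p) (b ^+ n * (g * p)).
  rewrite -hE lb1; have := tri (g * p) u v; have := tri (h * p) (g * p) v.
  rewrite (sym (h * p) v); move: far; rewrite /overlap_const mulnDl -(mulnA 2); move: gu hv; dist_tac d.
have disps' j : mdisp (b ^+ j) = mdisp (b' ^+ j) by rewrite lb lb'.
have [k k0 E] := overlap H disps' bl pb pb' A1 A2 far'.
exists k => //; move: E; case: bE => ->; case: bE' => ->; rewrite ?expVgn; auto.
- by move=> <-; rewrite invgK; right.
- by move/invg_inj; left.
Qed.

Lemma mdisp_conjX a b j : mdisp (a ^+ j) = mdisp ((b * a * b^-1) ^+ j).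
Proof. by rewrite conj_expg (mdispJ H). Qed.

(* The powers of b move the axis of a within bounded distance of itself. *)
Lemma commuting_commensurable a b i j : lox a -> lox b -> 0 < i -> 0 < j ->
  commute (a ^+ i) (b ^+ j) -> commensurable a b.
Proof.
move=> al bl i0 j0 ab.
have [m m0 Al] := lox_pow_big H (loxX al i0); pose A := (a ^+ i) ^+ m.
have Bl := loxX bl j0; pose B := b ^+ j.
have AB s : commute A (B ^+ s) by apply/commuteX/commute_sym/commuteX/commute_sym.
suff [s [t [s0 Est]]] : exists s t, [/\ 0 < s & B ^+ s = A ^+ t \/ B ^+ s = A ^- t].
  have t0 : 0 < t.
    rewrite lt0n; apply/eqP => t0; have : B ^+ s = B ^+ 0 by case: Est => ->; rewrite t0 expg0 ?invg1.
    by move/(lox_pow_inj H Bl) => E; rewrite E in s0.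
  apply: (commensurable_pow (i := (i * m)%N) (j := j)) => //; first by rewrite muln_gt0 i0.
  by rewrite expgnA; exists t, s.
have [p pl] := mdisp_att d A.
pose e := (d p (A ^+ 2 * p) + mdisp A)%N.
have ex s : exists2 g, cyc A g & d p (g * B ^+ s * p) <= e.
  have [g Ag gp] := near_orbit (u := B ^+ s * p) Al pl (leqnn _).
  exists g^-1; first exact: cycV.
  rewrite -mulgA (dist_move H) invgK sym; move: gp; rewrite -/A.
  have -> : d (B ^+ s * p) (A ^+ 2 * (B ^+ s * p)) = d p (A ^+ 2 * p).
    by apply: (dist_commute H); apply/commute_sym/commuteX/commute_sym/AB.
  by rewrite /e; dist_tac d.
have [g gP] := choice (fun s => let: ex_intro2 g x y := ex s in ex_intro (fun g => cyc A g /\ d p (g * B ^+ s * p) <= e) g (conj x y)).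
have far := big_grow H Al pl (Rad e).
have gA s : commute (A ^+ Rad e) (g s * B ^+ s).
  apply/commute_sym/commuteX/commute_sym/commuteM; last exact: AB.
  by have [+ _] := gP s; exact: cyc_commute.
have [inj|ninj] := pselect (injective (fun s : 'I_(Num e).+1 => g s * B ^+ s)).
  have := hyp_acyl H far (s := [seq g (val i) * B ^+ val i | i <- enum 'I_(Num e).+1]).
  rewrite map_inj_uniq ?enum_uniq // => /(_ isT); rewrite size_map size_enum_ord => W.
  suff : (Num e).+1 <= Num e by rewrite ltnn.
  apply: W => _ /mapP[s _ ->]; have [_ sp] := gP s; split=> //.
  by rewrite (dist_commute H) //; exact: commute_sym.
have [s [t [st _ E]]] := collision (s := fun s => g s * B ^+ s) ninj.
have [] : cyc A (B ^+ (t - s)); last by move=> k Ek; exists (t - s)%N, k; rewrite subn_gt0.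
have -> : B ^+ (t - s) = (g t)^-1 * g s.
  apply: (mulgI (g t)); apply: (mulIg (B ^+ s)); rewrite mulVKg -mulgA -expgnDr subnK ?E //.
  exact: ltnW.
by have [h1 _] := gP t; have [h2 _] := gP s; apply: cycM => //; exact: cycV.
Qed.

Lemma conj_commensurable a b k : lox a -> lox b -> 0 < k ->
  b * a ^+ k * b^-1 = a ^+ k \/ b * a ^+ k * b^-1 = a ^- k -> commensurable a b.
Proof.
move=> al bl k0 E; apply: (commuting_commensurable (i := k) (j := 2)) => //.
rewrite expg2; move: (a ^+ k) E => x [] E.
  have bx : commute x b by rewrite /commute -{1}E mulgVK.
  exact: commuteM.
have b1 : b * x = x^-1 * b by rewrite -E mulgVK.
have b2 : b * x^-1 = x * b by apply: (mulIg x); rewrite mulgVK -mulgA b1 mulVKg.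
by rewrite /commute mulgA -b2 -mulgA -b1 mulgA.
Qed.

(** [overlap_conj] is applied to [a] and its conjugate by [b], whose powers have equal
    displacements; then [b] normalises the subgroup generated by a power of [a]. *)
Lemma overlap_commensurable a b u v C K : big a -> lox b ->
  d u (a * u) <= C * mdisp a -> d v (a * v) <= C * mdisp a ->
  d u (b * u) <= K * mdisp a -> d v (b * v) <= K * mdisp a ->
  overlap_const (C + 2 * K) * mdisp a <= d u v -> commensurable a b.
Proof.
move=> al bl ua va ub vb far.
have disps := mdisp_conjX a b.
have le x : d x (a * x) <= C * mdisp a -> d x (b * x) <= K * mdisp a ->
    d x (b * a * b^-1 * x) <= (C + 2 * K) * mdisp a.
  move=> xa xb; have := tri (b * x) x (b * a * b^-1 * x); have := tri (b * (a * x)) (b * x) (b * a * b^-1 * x).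
  rewrite -!mulgA !dinv; have := dist_move H b^-1 x x; rewrite invgK.
  by move: xa xb; rewrite (sym (b * x) x) mulnDl -mulnA; dist_tac d.
have le' (x : nat) : x <= C * mdisp a -> x <= (C + 2 * K) * mdisp a by rewrite mulnDl; lia.
have [k k0 E] := overlap_conj disps al (le' _ ua) (le' _ va) (le _ ua ub) (le _ va vb) far.
by apply: (conj_commensurable (big_lox H al) bl k0); rewrite -conj_expg.
Qed.

End OverlapTheorems.

(** * Displacement of products, commutators and finite sets *)

Section Products.
Variables (G : groupType) (D : nat) (Rad Num : nat -> nat) (d : G -> G -> nat).
Hypothesis H : acyl_hyperbolic D Rad Num d.
Implicit Types (a b g h p q x y z : G).

Let tri := dist_tri (hyp_metric H).
Let sym := dist_sym (hyp_metric H).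
Let dinv := dist_inv (hyp_metric H).
Let fp := hyp_four_point H.
Local Notation lox := (loxodromic d).
Local Notation mdisp := (mdisp d).
Local Notation big := (big D d).

(* If [(a^N)(a'^N)] moves [q] little, then [a^-N q] and [a'^N q] are close, so the
   axes of [a] and [a'] overlap between [q] and these points. *)
Lemma disp_product a a' N : (forall j, mdisp (a ^+ j) = mdisp (a' ^+ j)) -> big a ->
  2 * overlap_length D Rad Num 11 < N -> mdisp (a ^+ N * a' ^+ N) < mdisp a ->
  exists2 k, 0 < k & a' ^+ k = a^-1 ^+ k.
Proof.
move=> disps al N_big; have [q <-] := mdisp_att d (a ^+ N * a' ^+ N).
rewrite -mulgA (dist_move H) -expVgn -(mdispV H) => small.
have disps' j : mdisp (a^-1 ^+ j) = mdisp (a' ^+ j) by rewrite (mdispVX H).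
move: a^-1 small disps' (bigV H al) => {a disps al} b small disps al.
have lE : mdisp a' = mdisp b by have := disps 1%N; rewrite !expg1.
have al' : big a' by rewrite /big lE.
have N1 : 1 < N by move: N_big; rewrite /overlap_length; lia.
have proj c : big c -> exists p, [/\ d p (c * p) = mdisp c,
    d q p + d p (c ^+ N * q) <= d q (c ^+ N * q) + 2 * mdisp c + 3 * D,
    d q (c ^+ N * p) + d (c ^+ N * p) (c ^+ N * q) <= d q (c ^+ N * q) + 2 * mdisp c + 3 * D &
    2 * d q p + d p (c ^+ N * p) <= d q (c ^+ N * q) + 2 * mdisp c + 3 * D].
  move=> cl; have [p0 p0l] := mdisp_att d c.
  have [g cg /(_ N N1)] := orbit_projection H q cl p0l; have pl := min_point_cyc H p0l cg.
  have -> : d p0 (c ^+ N * p0) = d (g * p0) (c ^+ N * (g * p0)).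
    by rewrite (dist_commute H) //; apply/commute_sym/commuteX/commute_sym/cyc_commute.
  move: (g * p0) pl => p pl gm; exists p; split=> //.
    have := tri (c ^+ N * p) p (c ^+ N * q); rewrite dinv (sym p q); move: gm; dist_tac d.
  rewrite dinv (sym p q); have := tri p q (c ^+ N * p); move: gm; dist_tac d.
have [p [pl p1 p2 p3]] := proj b al; have [p' [pl' p1' p2' p3']] := proj a' al'.
have u1 := mdisp_le d (b ^+ N) p; have u2 := big_mdispX H al pl N.
have u1' := mdisp_le d (a' ^+ N) p'; have u2' := big_mdispX H al' pl' N.
have v1 := tri p q (b ^+ N * p); have v1' := tri p' q (a' ^+ N * p').
have lin := big_linear H al pl N.
have e1 : d (b ^+ N * p) (b ^+ N * q) = d q p by rewrite dinv sym.
have e2 : d (a' ^+ N * p') (a' ^+ N * q) = d q p' by rewrite dinv sym.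
have far : overlap_length D Rad Num 11 * mdisp b <= d p (b ^+ N * p).
  move: lin al N_big; rewrite /big; move: (overlap_length _ _ _ _) (mdisp b) (d p _) => A l L.
  clear; move=> h1 h2 h3; have : N * (6 * D) <= N * l by rewrite leq_mul2l; lia.
  by have : 2 * A * l <= N * l; [rewrite leq_mul2r; lia|move: h1; clear; nia].
rewrite disps lE in u1 u2 u1' u2' p1' p2' p3'.
have [l lD] : exists l, l = mdisp b by eexists.
have bl := al.
rewrite /big -lD in p1 p2 p3 p1' p2' p3' al small far.
have k1 := tri (a' ^+ N * q) q (b ^+ N * q); have k2 := tri (b ^+ N * q) q (a' ^+ N * q).
have k3 := tri (a' ^+ N * q) p' (b ^+ N * q).
have k4 := tri (a' ^+ N * q) (a' ^+ N * p') (b ^+ N * q).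
have k5 := tri (b ^+ N * p) p (b ^+ N * q); have k10 := tri (a' ^+ N * p') p' (a' ^+ N * q).
have k6 := tri (b ^+ N * p) q (b ^+ N * q).
have k7 := tri (a' ^+ N * p') q (a' ^+ N * q).
have k8 := tri p q (b ^+ N * q); have k9 := tri p' q (a' ^+ N * q).
rewrite (sym (a' ^+ N * q) (b ^+ N * q)) in k1 k2 k3 k4.
apply: (overlap (n := N) (n' := N) (p := p) (p' := p') (A := 11) H disps bl pl pl') => //; rewrite -lD.
- apply: leq_trans (positions_close H (c := (4 * l + 3 * D)%N) (k := (5 * l + 9 * D)%N) (p := q) (q := b ^+ N * q) _ _ _ _) _;
    [| | | |by move: al; clear; lia]; by clear -p1 p2 p3 p1' p2' p3' al small k1 k2 k3 k4 k5 k6 k7 k8 k9 k10 u1 u2 u1' u2' v1 v1' e1 e2; dist_tac d.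
- apply: leq_trans (positions_close H (c := (4 * l + 3 * D)%N) (k := (5 * l + 9 * D)%N) (p := q) (q := b ^+ N * q) _ _ _ _) _;
    [| | | |by move: al; clear; lia]; by clear -p1 p2 p3 p1' p2' p3' al small k1 k2 k3 k4 k5 k6 k7 k8 k9 k10 u1 u2 u1' u2' v1 v1' e1 e2; dist_tac d.
- exact: far.
Qed.

(** The commutator is [a ^+ N] times the [N]-th power of a conjugate of the inverse of [a]. If its
    displacement is small, [disp_product] shows that [b ^+ N] commutes with a power of [a]. *)
Lemma disp_commutator a b N : big a -> lox b -> 2 * overlap_length D Rad Num 11 < N ->
  mdisp a <= mdisp (a ^+ N * b ^+ N * a^-1 ^+ N * b^-1 ^+ N) \/ commensurable a b.
Proof.
move=> al bl N_big; case: (leqP (mdisp a) (mdisp (a ^+ N * b ^+ N * a^-1 ^+ N * b^-1 ^+ N))) => lt; [by left|right].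
have N0 : 0 < N by lia.
have E : a ^+ N * b ^+ N * a^-1 ^+ N * b^-1 ^+ N = a ^+ N * (b ^+ N * a^-1 * (b ^+ N)^-1) ^+ N.
  by rewrite conj_expg !expVgn !mulgA.
rewrite E in lt.
have disps j : mdisp (a ^+ j) = mdisp ((b ^+ N * a^-1 * (b ^+ N)^-1) ^+ j).
  by rewrite -(mdisp_conjX H) (mdispVX H).
have [k k0] := disp_product disps al N_big lt; rewrite conj_expg !expVgn => Ek.
apply: (commensurable_pow (i := 1) (j := N)) => //; rewrite expg1.
apply: (conj_commensurable H (big_lox H al) (loxX bl N0) k0); left.
by apply: invg_inj; rewrite -Ek !invgM !invgK mulgA.
Qed.

Lemma gromov_chain T q x y z : T + d x y <= d q x + d q y -> T + d y z <= d q y + d q z ->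
  T + d x z <= d q x + d q z + D.
Proof. by move=> h1 h2; have := fp q x y z; dist_tac d. Qed.

Lemma disp_square s q : d q (s ^+ 2 * q) <= d q (s * q) + mdisp s + 2 * D.
Proof.
have [y <-] := mdisp_att d s; have := dist_pow_le H s 2 q.
pose t := (2 * d q (s ^+ 1 * q) - d q (s ^+ 2 * q))%N.
have [lt|ge] := ltnP (t + 2 * D) (d q (s ^+ 1 * q)).
  have tL : 2 * d q (s ^+ 1 * q) <= d q (s ^+ 2 * q) + t by rewrite /t; lia.
  have := orbit_disp H tL lt 1 y; rewrite /t !expg1; dist_tac d.
by move: ge; rewrite /t !expg1; dist_tac d.
Qed.

(* If [s^-1 q] and [tq] lie in different directions from [q], then [q, sq, stq, ...]
   is a local geodesic and [st] has a large translation length. *)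
Lemma disp_mul T s t q : 3 * T + 10 * D < d q (s * q) -> 3 * T + 10 * D < d q (t * q) ->
  T + d (s^-1 * q) (t * q) <= d q (s * q) + d q (t * q) \/
  T + 2 * D + d (t^-1 * q) (s * q) <= d q (s * q) + d q (t * q) \/
  d q (s * q) + d q (t * q) <= mdisp (s * t) + 3 * T + 6 * D.
Proof.
move=> sl tl; case: leqP => [|g1]; [by left|right]; case: leqP => [|g2]; [by left|right].
have m1 : d (s^-1 * q) (t * q) = d q (s * (t * q)) by rewrite [RHS](dist_move H).
have m2 : d (t^-1 * q) (s * q) = d (s * q) (s * (t * (s * q))) by rewrite dinv [RHS](dist_move H).
have [w wE] : exists w, w = s * t by eexists.
have wM x : s * (t * x) = w * x by rewrite wE mulgA.
have b2 : d (s * q) (w * q) = d q (t * q) by rewrite -wM dinv.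
have b3 : d (w * q) (w * (s * q)) = d q (s * q) by rewrite dinv.
have b4 : d (w * (s * q)) (w * (w * q)) = d q (t * q) by rewrite dinv b2.
have b5 : d (w * q) (w * (w * q)) = d q (w * q) by rewrite dinv.
rewrite !wM in m1 m2; rewrite -wE.
have f1 := fp q (s * q) (w * q) (w * (s * q)).
have f2 := fp q (w * q) (w * (s * q)) (w * (w * q)).
have t1 := tri (s * q) q (w * q).
have L2 : 2 * d q (w ^+ 1 * q) <= d q (w ^+ 2 * q) + (2 * T + 4 * D).
  rewrite expg1 expg2 -mulgA; clear -f1 f2 t1 m1 m2 b2 b3 b4 b5 g1 g2 sl tl.
  by dist_tac d.
have tL : 2 * T + 4 * D + 2 * D < d q (w ^+ 1 * q).
  by rewrite expg1; clear -m1 g1 sl tl; dist_tac d.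
have [y <-] := mdisp_att d w; have := orbit_disp H L2 tL 1 y; rewrite !expg1.
by clear -m1 g1; dist_tac d.
Qed.

(** Analogue of the common fixed point criterion on trees. Let [q] minimise the largest displacement
    and [t] attain it. If it were large, [disp_mul] would force every nearly maximal [s] to send
    [q], under [s] and its inverse, in the direction of [t * q]; a small move of [q] in that
    direction would lower the maximum. *)
Lemma joint_displacement (S : seq G) M : (forall s, s \in S -> mdisp s <= M) ->
  (forall s t, s \in S -> t \in S -> mdisp (s * t) <= M) ->
  exists q, forall s, s \in S -> d q (s * q) <= M + 50 * D + 30.
Proof.
move=> M1 M2; pose E q := \max_(s <- S) d q (s * q).
have leE q s : s \in S -> d q (s * q) <= E q by move=> sS; exact: (leq_bigmax_seq (F := fun s => d q (s * q))).
have exE : exists k, `[< exists q, E q = k >] by exists (E 1); apply/asboolP; exists 1.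
case: (ex_minnP exE) => k /asboolP[q qk] kmin; exists q => t0 t0S; rewrite leqNgt; apply/negP => big0.
have {}kmin y : (forall s, s \in S -> d y (s * y) < k) -> k = 0.
  move=> lt; apply/eqP; rewrite -leqn0; apply: contraT; rewrite -ltnNge => k0.
  suff : E y < k by rewrite ltnNge (kmin (E y)) //; apply/asboolP; exists y.
  by rewrite -(prednK k0) ltnS; apply/bigmax_leqP_seq => s sS _; rewrite -ltnS prednK // lt.
have k_big : M + 50 * D + 30 < k by rewrite -qk; exact: leq_trans big0 (leE _ _ t0S).
have [t [tS tk]] : exists t, t \in S /\ k <= d q (t * q).
  apply: contrapT => no; have : k = 0; last by move: k_big; lia.
  apply: (kmin q) => s sS; rewrite ltnNge; apply/negP => ks; apply: no; by exists s.
have sV x : d q (x^-1 * q) = d q (x * q) by rewrite -(dinv x) mulVKg sym.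
have self s : s \in S -> k <= d q (s * q) + 4 * D + 3 ->
    7 * D + 2 + d (s^-1 * q) (s * q) <= d q (s * q) + d q (s * q).
  move=> sS ls; have := disp_square s q; have := M1 s sS.
  have -> : d (s^-1 * q) (s * q) = d q (s ^+ 2 * q) by rewrite expg2 -mulgA [RHS](dist_move H).
  by move: k_big ls; dist_tac d.
have key s : s \in S -> k <= d q (s * q) + 4 * D + 3 ->
    5 * D + 2 + d (s^-1 * q) (t * q) <= d q (s * q) + d q (t * q).
  move=> sS ls; have := M2 s t sS tS.
  have [||h|[h|h]] := @disp_mul (5 * D + 2) s t q; [by dist_tac d..|by []| |by dist_tac d].
  move=> _; have h1 : 7 * D + 2 + d (t * q) (t^-1 * q) <= d q (t * q) + d q (t^-1 * q).
    by rewrite sV sym; apply: self => //; dist_tac d.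
  have h2 : 7 * D + 2 + d (t^-1 * q) (s * q) <= d q (t^-1 * q) + d q (s * q).
    by rewrite sV; move: h; dist_tac d.
  have h3 := gromov_chain h1 h2.
  have h4 : 6 * D + 2 + d (t * q) (s * q) <= d q (t * q) + d q (s * q) by dist_tac d.
  have h5 : 6 * D + 2 + d (s * q) (s^-1 * q) <= d q (s * q) + d q (s^-1 * q).
    by have := self s sS ls; rewrite sV (sym (s * q)); dist_tac d.
  have := gromov_chain h4 h5; rewrite sV (sym (t * q) (s^-1 * q)); dist_tac d.
have tr : 2 * D + 1 <= d q (t * q) by move: k_big tk; dist_tac d.
(* A move by [2 * D + 1] adds at most [4 * D + 2] to a displacement, less than the slack [4 * D + 3]
   of the elements that are not nearly maximal. *)
have [m qm mt] := dist_geo (hyp_metric H) tr.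
have near x : 4 * D + 2 + d x (t * q) <= d q x + d q (t * q) -> d m x + (2 * D + 1) <= d q x + D.
  move=> h; have h' : 4 * D + 2 + d m (t * q) <= d q m + d q (t * q) by move: tr; dist_tac d.
  by have := gromov_chain h' (y := t * q) (z := x); rewrite (sym (t * q) x) (addnC (d q (t * q))); move: h; dist_tac d.
have : k = 0; last by move: k_big; lia.
apply: (kmin m) => s sS.
have s_m : d (s * m) (s * q) = d q m by rewrite dinv sym.
have [ls|ss] := leqP k (d q (s * q) + 4 * D + 3); last first.
  have := tri q m (s * m); have := tri (s * q) q (s * m).
  by rewrite (sym m q) (sym (s * q) (s * m)); move: ss; dist_tac d.
have n1 := near (s^-1 * q); have n2 := near (s * q); have k1 := key s sS ls; have s1 := self s sS ls.
rewrite sV in n1.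
have h5 : 5 * D + 2 + d (s * q) (s^-1 * q) <= d q (s * q) + d q (s^-1 * q) by rewrite sV sym; move: s1; dist_tac d.
have h6 : 5 * D + 2 + d (s^-1 * q) (t * q) <= d q (s^-1 * q) + d q (t * q) by rewrite sV.
have h7 := gromov_chain h5 h6.
have {n1} n1 : d m (s^-1 * q) + (2 * D + 1) <= d q (s * q) + D by apply: n1; move: k1; dist_tac d.
have {n2} n2 : d m (s * q) + (2 * D + 1) <= d q (s * q) + D by apply: n2; move: h7; dist_tac d.
have e1 : d q (s * m) = d m (s^-1 * q) by rewrite (dist_move H) sym.
have := fp m q (s * m) (s * q); rewrite e1 s_m (sym m q).
have := leE q s sS; rewrite qk; clear -n1 n2 ls qm k_big; dist_tac d.
Qed.

End Products.

Definition generates (G : groupType) (S : seq G) := forall Q : set G, is_subgroup Q ->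
  (forall s, s \in S -> Q s) -> forall g, Q g.

(** [h] is improved for one [u] at a time. A non-loxodromic [u] is dominated already. Otherwise a
    uniform power [v] of [u] is big in all metrics: if it is commensurable with [h], their
    displacements are comparable; if not, a commutator of high powers of [h] and [v] dominates
    both. *)
Lemma filling (G : groupType) D Rad Num (Cl : set (G -> G -> nat)) (a0 : G) (us : seq G) :
  (forall d, Cl d -> acyl_hyperbolic D Rad Num d) ->
  (forall d d' a, Cl d -> Cl d' -> loxodromic d a -> loxodromic d' a) ->
  (forall d, Cl d -> loxodromic d a0) ->
  exists h C, forall d, Cl d -> big D d h /\
    forall u, u \in us -> mdisp d u <= C * mdisp d h.
Proof.
move=> ClH ClL a0l; have [n0 n00 powP] := uniform_power G D Rad Num (10 * D + 10).
elim: us => [|u us [h [C IH]]].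
  by exists (a0 ^+ n0), 1%N => d Cd; split=> //; apply: powP; [exact: ClH|exact: a0l].
have [[d1 [C1 ul]]|nul] := pselect (exists d, Cl d /\ loxodromic d u); last first.
  exists h, (C + 1)%N => d Cd; have [hl hC] := IH d Cd; split=> // v.
  rewrite inE => /orP[/eqP->|/hC le]; last by rewrite mulnDl; apply: leq_trans le (leq_addr _ _).
  have /negP nb : ~ big D d u by move=> /(big_lox (ClH d Cd)) ul; apply: nul; exists d.
  by move: hl nb; rewrite /big -ltnNge mulnDl; lia.
pose v := u ^+ n0.
have vl d : Cl d -> big D d v by move=> Cd; apply: powP; [exact: ClH|exact: ClL ul].
have uv d : Cl d -> mdisp d u <= 3 * mdisp d v.
  move=> Cd; have := vl d Cd; rewrite /big; case: (leqP (10 * D + 10) (mdisp d u)) => [ub|]; last by lia.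
  have := big_mdisp_linear (ClH d Cd) n0 ub; rewrite -/v; move: (mdisp d u) (mdisp d v) => x y h1 h2.
  have : n0 * (x - 7 * D) <= y by rewrite mulnBr; lia.
  have : 1 * (x - 7 * D) <= n0 * (x - 7 * D) by rewrite leq_mul2r n00 orbT.
  by lia.
have [[i [j [i0 j0 E]]]|nhv] := pselect (commensurable h v).
  have hv d : Cl d -> mdisp d v <= (i + 1) * mdisp d h.
    move=> Cd; have [hb _] := IH d Cd; have vb := vl d Cd; have Hd := ClH d Cd.
    have := big_mdisp_linear Hd j vb.
    have -> : mdisp d (v ^+ j) = mdisp d (h ^+ i) by case: E => ->; rewrite ?(mdispV Hd).
    have := mdispX_le Hd h i; move: hb; rewrite /big.
    move: (mdisp d v) (mdisp d h) (mdisp d (h ^+ i)) => x y z h1 h2 h3.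
    have : j * (x - 7 * D) <= i * y by rewrite mulnBr; lia.
    have : 1 * (x - 7 * D) <= j * (x - 7 * D) by rewrite leq_mul2r j0 orbT.
    by rewrite mulnDl; lia.
  exists h, (C + 3 * (i + 1))%N => d Cd; have [hl hC] := IH d Cd; split=> // w.
  rewrite inE mulnDl => /orP[/eqP->|/hC]; last by lia.
  by apply: leq_trans (uv d Cd) _; rewrite -mulnA; have := hv d Cd; lia.
have [N NE] : exists N, 2 * overlap_length D Rad Num 11 < N by exists (2 * overlap_length D Rad Num 11).+1.
have nvh : ~ commensurable v h by move/commensurable_sym.
pose w := h ^+ N * v ^+ N * h^-1 ^+ N * v^-1 ^+ N.
have hw d : Cl d -> mdisp d h <= mdisp d w.
  move=> Cd; have [hb _] := IH d Cd; have Hd := ClH d Cd.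
  by have [] := disp_commutator Hd hb (big_lox Hd (vl d Cd)) NE.
have vw d : Cl d -> mdisp d v <= mdisp d w.
  move=> Cd; have [hb _] := IH d Cd; have Hd := ClH d Cd.
  have [] := disp_commutator Hd (vl d Cd) (big_lox Hd hb) NE => //.
  suff -> : v ^+ N * h ^+ N * v^-1 ^+ N * h^-1 ^+ N = w^-1 by rewrite (mdispV Hd).
  by rewrite /w !invgM !expVgn !invgK !mulgA.
exists w, (C + 3)%N => d Cd; have [hb hC] := IH d Cd; split.
  by rewrite /big; apply: leq_trans hb (hw d Cd).
move=> x; rewrite inE mulnDl => /orP[/eqP->|/hC le].
  by apply: leq_trans (uv d Cd) _; have := vw d Cd; lia.
by apply: leq_trans le _; rewrite (leq_trans (leq_mul (leqnn C) (hw d Cd))) // leq_addr.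
Qed.

Lemma bounded_finite (T : choiceType) (A : set T) N :
  (forall s : seq T, uniq s -> (forall x, x \in s -> A x) -> size s <= N) -> finite_set A.
Proof.
move=> bnd; apply: contrapT => /(infinite_set_fset N.+1)[B BA] /=.
by rewrite ltnNge bnd ?finmap.fset_uniq // => x xB; exact: BA.
Qed.

(** * A criterion for virtual cyclicity *)

Section VirtuallyCyclic.
Variables (G : groupType) (D : nat) (Rad Num : nat -> nat) (d : G -> G -> nat).
Hypothesis H : acyl_hyperbolic D Rad Num d.
Implicit Types (a b g h p q x y z : G).

Lemma lox_exponent a i j : loxodromic d a ->
  (forall n, mdisp d (a ^+ (i * n)) = mdisp d (a ^+ (j * n))) -> i = j.
Proof.
move=> al; wlog ij : i j / i < j.
  move=> W E; case: (ltngtP i j) => ij //; first exact: (W i j).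
  by apply/esym/(W j i) => // n.
move=> E; have [m m0 Al] := lox_pow_big H al; have [p pl] := mdisp_att d (a ^+ m).
have [n nE] : exists n, n = (8 * D + 1)%N by eexists.
have := E (m * n)%N; rewrite (mulnCA i m) (mulnCA j m) !(expgnA a) => En.
have := big_add H Al pl (i * n) ((j - i) * n); have := big_grow H Al pl ((j - i) * n).
have := big_mdispX H Al pl (j * n); have := mdisp_le d ((a ^+ m) ^+ (i * n)) p.
rewrite -mulnDl (subnKC (ltnW ij)).
have : n <= (j - i) * n by rewrite leq_pmull // subn_gt0.
by move: nE En; clear; dist_tac d.
Qed.

(** Displacement is invariant under conjugation and inversion and grows along powers, so a relation
    of Baumslag-Solitar type must have equal exponents. *)
Lemma conj_exponent a g i j : loxodromic d a ->
  g * a ^+ i * g^-1 = a ^+ j \/ g * a ^+ i * g^-1 = a ^- j -> i = j.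
Proof.
move=> al E; apply: (lox_exponent al) => n; rewrite !expgnA -(mdispJ H ((a ^+ i) ^+ n) g).
by rewrite -conj_expg; case: E => ->; rewrite // expVgn (mdispV H).
Qed.

(** A common power [A] of [h] is fixed or inverted by all of [G]. An element centralising [A] can be
    corrected by an element of [cyc A] to displace [p] by at most [e]; by acylindricity only
    finitely many corrected elements exist. Inverting elements form at most one further coset of the
    centraliser. *)
Lemma virtually_cyclic_normalizer (S : seq G) h : generates S -> loxodromic d h ->
  (forall s, s \in S -> exists2 k, 0 < k & s * h ^+ k * s^-1 = h ^+ k \/ s * h ^+ k * s^-1 = h ^- k) ->
  virtually_cyclic G.
Proof.
move=> gS hl norm.
have [N N0 {}norm] : exists2 N, 0 < N & forall s, s \in S ->
    s * h ^+ N * s^-1 = h ^+ N \/ s * h ^+ N * s^-1 = h ^- N.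
  elim: S norm {gS} => [|s S IH] norm; first by exists 1%N.
  have [|N N0 NP] := IH; first by move=> t tS; apply: norm; rewrite inE tS orbT.
  have [k k0 kP] := norm s (mem_head _ _).
  exists (k * N)%N; first by rewrite muln_gt0 k0.
  move=> t; rewrite inE => /orP[/eqP->|/NP {}NP].
    by rewrite expgnA -conj_expg; case: kP => ->; rewrite ?expVgn; auto.
  by rewrite mulnC expgnA -conj_expg; case: NP => ->; rewrite ?expVgn; auto.
have [m m0 Al] := lox_pow_big H (loxX hl N0).
have [A AE] : exists A, A = (h ^+ N) ^+ m by eexists.
rewrite -AE in Al; have [p pl] := mdisp_att d A.
have {norm} norm g : g * A * g^-1 = A \/ g * A * g^-1 = A^-1.
  apply: (gS [set g | g * A * g^-1 = A \/ g * A * g^-1 = A^-1]%classic); last first.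
    by move=> s /norm E; rewrite AE /= -conj_expg; case: E => ->; rewrite ?expVgn; auto.
  split=> /=; first by left; rewrite mul1g invg1 mulg1.
    have M x y : x * y * A * (x * y)^-1 = x * (y * A * y^-1) * x^-1 by rewrite invgM !mulgA.
    have V x : x * A^-1 * x^-1 = (x * A * x^-1)^-1 by rewrite !invgM invgK mulgA.
    by move=> x y hx [] hy; rewrite M hy ?V; case: hx => ->; rewrite ?invgK; auto.
  have V x y : x^-1 * (x * y * x^-1) * x = y by rewrite -!mulgA mulVg mulg1 mulKg.
  move=> x [] hx; [left|right]; rewrite invgK; first by rewrite -{1}hx V.
  have {1}<- : x * A^-1 * x^-1 = A.
    by have /= := congr1 (fun y => y^-1) hx; rewrite !invgM !invgK mulgA.
  by rewrite V.
exists [set g | cyc A g]%classic; split.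
- by split=> /=; [exact: (cycX A 0)|exact: cycM|exact: cycV].
- exists A; rewrite predeqE => g; split=> /=.
    move=> [k Ek] Q [[Q1 QM QV] QA]; have QX n : Q (A ^+ n).
      by elim: n => [|n IH]; rewrite ?expg0 // expgS; apply: QM => //; exact: QA.
    by case: Ek => ->; [|apply: QV]; exact: QX.
  apply; split; first by split=> /=; [exact: (cycX A 0)|exact: cycM|exact: cycV].
  by move=> _ ->; exact: (cycX A 1).
have [e eE] : exists e, e = (d p (A ^+ 2 * p) + mdisp d A)%N by eexists.
have cent g : g * A * g^-1 = A -> exists b c, [/\ g = b * c, cyc A c, commute A b & d p (b * p) <= e].
  move=> gA; have gc : commute A g by rewrite /commute -{1}gA mulgVK.
  have [c Ac cp] := near_orbit (u := g * p) H Al pl (leqnn _).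
  exists (c^-1 * g), c; have cc := cyc_commute Ac; split=> //.
  - have gcc : commute g c.
      by case: Ac => k [] ->; [|apply: commuteV]; apply/commuteX/commute_sym.
    by rewrite -mulgA gcc mulKg.
  - by apply: commuteM => //; apply: commuteV.
  rewrite -mulgA (dist_move H) invgK (dist_sym (hyp_metric H)); move: cp.
  have -> : d (g * p) (A ^+ 2 * (g * p)) = d p (A ^+ 2 * p).
    by apply: (dist_commute H); apply/commute_sym/commuteX/commute_sym.
  by rewrite eE; dist_tac d.
have far := big_grow H Al pl (Rad e).
pose B := [set b | commute A b /\ d p (b * p) <= e]%classic.
have finB : finite_set B.
  apply: (bounded_finite (N := Num e)) => s us sB; apply: (hyp_acyl H far us) => b /sB[Ab bp].
  by split=> //; rewrite (dist_commute H) //; apply/commuteX/commute_sym.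
have [g0 g0P] : exists g0, forall g, g * A * g^-1 = A^-1 -> g0 * A * g0^-1 = A^-1.
  have [[g gA]|ng] := pselect (exists g, g * A * g^-1 = A^-1); first by exists g.
  by exists 1 => g gA; case: ng; exists g.
pose coset g := [set g * h | h in [set g | cyc A g]]%classic.
suff sub : (range coset `<=` [set coset b | b in B] `|` [set coset (g0 * b) | b in B])%classic.
  by apply: sub_finite_set sub _; rewrite finite_setU; split; exact: finite_image.
have cosetM b c : cyc A c -> coset (b * c) = coset b.
  move=> Ac; rewrite predeqE => g; split=> -[x Ax <-].
    by exists (c * x); rewrite ?mulgA //; exact: cycM.
  by exists (c^-1 * x); [apply: cycM => //; exact: cycV|rewrite mulgA mulgK].
move=> _ [g _ <-]; case: (norm g) => gA.
  by have [b [c [-> Ac Ab bp]]] := cent g gA; left; exists b => //; rewrite cosetM.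
have g1A : (g0^-1 * g) * A * (g0^-1 * g)^-1 = A.
  have -> : (g0^-1 * g) * A * (g0^-1 * g)^-1 = g0^-1 * (g * A * g^-1) * g0 by rewrite invgM invgK !mulgA.
  have V x y : x^-1 * (x * y * x^-1) * x = y by rewrite -!mulgA mulVg mulg1 mulKg.
  by rewrite gA -(g0P g gA) V.
have [b [c [E Ac Ab bp]]] := cent _ g1A; right; exists b => //.
by rewrite -(mulVKg g0 g) E mulgA (cosetM _ c).
Qed.

End VirtuallyCyclic.

(** * Twisted conjugacy *)

Definition prev (k : int) : int := (k - 1)%R.
Definition next (k : int) : int := (k + 1)%R.
Lemma prevK k : next (prev k) = k. Proof. by rewrite /next /prev; lia. Qed.
Lemma nextK k : prev (next k) = k. Proof. by rewrite /next /prev; lia. Qed.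

(* In the application [a k] and [b k] are the images of [q (prev k)] and [q (next k)]
   under the isometries [d (prev k) -> d k] and [d (next k) -> d k] that map [v (prev k)]
   and [v (next k)] to [v k]. *)
Section Drift.
Variables (G : groupType) (D : nat) (Rad Num : nat -> nat) (d : int -> G -> G -> nat).
Hypothesis H : forall k, acyl_hyperbolic D Rad Num (d k).
Variables (v q a b : int -> G) (l : int -> nat) (K C1 beta gam B Lam : nat).
Hypothesis lD : forall k, D < l k.
Hypothesis bq : forall k, d (next k) (q (next k)) (a (next k)) = d k (b k) (q k).
Hypothesis vq : forall k, d (next k) (v (next k)) (a (next k)) = d k (v k) (q k).
Hypothesis vb : forall k, d (next k) (v (next k)) (q (next k)) = d k (v k) (b k).
Hypothesis qa_big : forall k, Lam * l k <= d k (q k) (a k).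
Hypothesis qb_big : forall k, Lam * l k <= d k (q k) (b k).
Hypothesis ab : forall k, d k (q k) (a k) + d k (q k) (b k) <= d k (a k) (b k) + gam * l k.
Hypothesis l_next : forall k, l (next k) <= K * l k.
Hypothesis v_next : forall k, d k (v k) (v (next k)) <= C1.
Hypothesis v_next' : forall k, d (next k) (v k) (v (next k)) <= C1.
Hypothesis q_next : forall k, d k (q k) (q (next k)) <= beta * l k.
Hypothesis q_next' : forall k, d (next k) (q k) (q (next k)) <= beta * l (next k).
Hypothesis b_next : forall k, d (next k) (b k) (b (next k)) <= beta * l (next k).
Hypothesis a_next : forall k, d k (a k) (a (next k)) <= beta * l k.
Hypothesis quasi : forall k x y z, d (next k) x z + d (next k) y z <=
  d (next k) x y + B * (d k x z + d k y z - d k x y) + B.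
Hypothesis quasi' : forall k x y z, d k x z + d k y z <=
  d k x y + B * (d (next k) x z + d (next k) y z - d (next k) x y) + B.
Local Notation g1 := (gam + 1 + 2 * C1 + 4 * beta)%N.
Hypothesis Lam_big : B * g1 * K + B * g1 + 2 * B + gam + 2 < Lam.

(** [back] and [forw] say that [q k] is nearly between [v k] and [a k], respectively [b k]. As [a k]
    and [b k] lie in different directions from [q k], at least one of them holds. *)
Let back k := d k (v k) (q k) + d k (q k) (a k) <= d k (v k) (a k) + (gam + 1) * l k.
Let forw k := d k (v k) (q k) + d k (q k) (b k) <= d k (v k) (b k) + (gam + 1) * l k.

Lemma back_or_forw k : back k \/ forw k.
Proof.
have := hyp_four_point (H k) (q k) (a k) (v k) (b k).
move: (dist_sym (hyp_metric (H k)) (a k) (v k)) (dist_sym (hyp_metric (H k)) (q k) (v k)) (ab k) (lD k).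
by rewrite /back /forw; move: (d k) => e; dist_tac e.
Qed.

Lemma forw_grow k : forw k -> d k (v k) (q k) < d (next k) (v (next k)) (q (next k)).
Proof.
rewrite /forw vb => h; have := qb_big k; have := lD k; move: h Lam_big.
move: (d k _ _) (d k _ _) (d k _ _) (l k) => *; nia.
Qed.

Lemma back_grow k : back (next k) -> d (next k) (v (next k)) (q (next k)) < d k (v k) (q k).
Proof.
rewrite /back vq => h; have := qa_big (next k); have := lD (next k); move: h Lam_big.
move: (d k _ _) (d _ _ _) (d _ _ _) (l _) => *; nia.
Qed.

Lemma gromov_move (e : G -> G -> nat) x x' y y' z z' m c1 c2 : geodesic_metric e ->
  e x x' <= c1 -> e y y' <= c2 -> e z z' <= c2 ->
  e x z + e z y <= e x y + m -> e x' z' + e z' y' <= e x' y' + (m + 2 * c1 + 4 * c2).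
Proof.
move=> M h1 h2 h3 h4.
have := dist_tri M x x' z'; have := dist_tri M z x z'; have := dist_tri M z z' y'; have := dist_tri M y z y'.
have := dist_tri M x' x y; have := dist_tri M y' x' y.
rewrite (dist_sym M x' x) (dist_sym M z' z) (dist_sym M y' y); dist_tac e.
Qed.

(** For suitable consecutive indices, [back k] and [forw (next k)] hold. Exchanging metrics and
    neighbouring points turns [forw (next k)] into [q k] being nearly between [v k] and [b k] for
    [d k]. The same exchange on [back k], followed by the isometry, places [b k] nearly between
    [v k] and [q k]. Then [q k] and [b k] are close, against [qb_big]. *)
Lemma drift_contradiction : False.
Proof.
have ex : exists n, `[< exists k, d k (v k) (q k) = n >].
  by exists (d 0%R (v 0%R) (q 0%R)); apply/asboolP; exists 0%R.
case: (ex_minnP ex) => n /asboolP[k0 k0n] nmin.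
have {}nmin k : d k0 (v k0) (q k0) <= d k (v k) (q k).
  by rewrite k0n; apply/nmin/asboolP; exists k.
(* At the nearest index [k0], [back] at the next index or [forw] at the previous one would give a
   shorter or a strictly larger distance than minimality permits. *)
have [k [bk fk]] : exists k, back k /\ forw (next k).
  have [bk|fk] := back_or_forw k0.
    exists k0; split=> //; have [/back_grow|//] := back_or_forw (next k0).
    by rewrite ltnNge nmin.
  exists (prev k0); rewrite prevK; split=> //; have [//|/forw_grow] := back_or_forw (prev k0).
  by rewrite prevK ltnNge nmin.
have M := hyp_metric (H k); have M' := hyp_metric (H (next k)).
have S := dist_sym M; have S' := dist_sym M'.
have fit m : (gam + 1) * l m + 2 * C1 + 4 * (beta * l m) <= g1 * l m.
  by have := lD m; move: (l m) => x; clear; nia.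
have h1 : d (next k) (v k) (q k) + d (next k) (q k) (b k) <= d (next k) (v k) (b k) + g1 * l (next k).
  have := gromov_move (x' := v k) (y' := b k) (z' := q k) (c1 := C1) (c2 := (beta * l (next k))%N) M' _ _ _ fk.
  rewrite (S' (v (next k)) (v k)) (S' (b (next k)) (b k)) (S' (q (next k)) (q k)).
  move=> /(_ (v_next' k) (b_next k) (q_next' k)) W; apply: leq_trans W _.
  by rewrite leq_add2l; exact: fit.
have h2 : d k (v (next k)) (q (next k)) + d k (q (next k)) (a (next k)) <=
    d k (v (next k)) (a (next k)) + g1 * l k.
  apply: leq_trans (gromov_move M (v_next k) (a_next k) (q_next k) bk) _.
  by rewrite leq_add2l; exact: fit.
have h3 := quasi' k (v k) (b k) (q k); have h4 := quasi k (v (next k)) (a (next k)) (q (next k)).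
rewrite vb vq (S' (a (next k))) bq (S (b k)) in h4.
rewrite (S (b k)) (S' (b k)) in h3.
rewrite (S (a (next k))) in h4.
have sub p1 p2 p3 c : p1 + p2 <= p3 + c -> B * (p1 + p2 - p3) <= B * c.
  by move=> h; rewrite leq_mul2l; apply/orP; right; lia.
have {h1}h1 := sub _ _ _ _ h1; have {h2}h2 := sub _ _ _ _ h2.
have e1 : B * (g1 * l (next k)) <= B * g1 * K * l k.
  by rewrite mulnA -(mulnA (B * g1)%N) leq_mul2l l_next orbT.
have e2 : (B * g1 * K + B * g1 + 2 * B + gam + 2) * l k <= Lam * l k by rewrite leq_mul2r ltnW ?orbT.
have e3 := qb_big k; have lk := lD k; move: h1 h2 h3 h4 e1 e2 e3.
move: (g1) => g; rewrite !mulnDl.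
move: (B * (_ + _ - _))%N (B * (_ + _ - _))%N (B * (g * l (next k)))%N (B * g * K * l k)%N (Lam * l k)%N.
move: (d k (v k) (q k)) (d k (v k) (b k)) (d k (q k) (b k)) => x1 x2 x3 y1 y2 y3 y4 y5.
move=> h1 h2 h3 h4 e1 e2 e3.
have := mulnA B g (l k); have : B <= B * l k by rewrite leq_pmulr //; lia.
move: lk e2; clear -h1 h2 h3 h4 e1 e3; lia.
Qed.

End Drift.

Section GromovBound.
Variables (G : groupType) (D : nat) (Rad Num : nat -> nat) (d : G -> G -> nat).
Hypothesis H : acyl_hyperbolic D Rad Num d.
Implicit Types (a b g h p q x y z : G).

Let tri := dist_tri (hyp_metric H).
Let sym := dist_sym (hyp_metric H).
Let dinv := dist_inv (hyp_metric H).
Let fp := hyp_four_point H.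

Lemma disp_convex a x y v c A : d x v + d v y <= d x y + c ->
  d x (a * x) <= A -> d y (a * y) <= A -> d v (a * v) <= A + c + 2 * D.
Proof.
move=> h hx hy.
have e1 : d (a * v) (a * y) = d v y by rewrite dinv.
have e2 : d (a * x) (a * v) = d x v by rewrite dinv.
have f1 := fp v x (a * v) (a * y); have f2 := fp v x (a * y) y.
have t1 := tri (a * x) x (a * v); have t2 := tri (a * y) v (a * v).
have t3 := tri (a * y) x y; rewrite (sym (a * y) y) in t3 f2.
rewrite (sym (a * y) (a * v)) e1 in t2; rewrite (sym v x) in f1 f2.
by move: h hx hy e1 e2 f1 f2 t1 t2 t3; clear; rewrite ?addnA; dist_tac d.
Qed.

(** If the orbits stayed together for length [R], the points [q] and [v] at distance [R] would both
    be displaced little by [a] and [b], making these commensurable. *)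
Lemma gromov_bound a b q m n C : big D d a -> loxodromic d b -> ~ commensurable a b ->
  d q (a * q) <= C * mdisp d a -> d q (b * q) <= C * mdisp d a ->
  d q (a ^+ m * q) + d q (b ^+ n * q) <=
    d (a ^+ m * q) (b ^+ n * q) + 2 * overlap_const D Rad Num (3 * (C + 1)) * mdisp d a.
Proof.
move=> al bl nab qa qb; rewrite leqNgt; apply/negP; rewrite -mulnA.
have [R RE] : exists R, R = (overlap_const D Rad Num (3 * (C + 1)) * mdisp d a)%N by eexists.
rewrite -RE => far; apply: nab.
have Rq : R <= d q (a ^+ m * q).
  by have := tri (a ^+ m * q) q (b ^+ n * q); move: far; dist_tac d.
have [v qv va] := dist_geo (hyp_metric H) Rq.
have g1 : 2 * R + d v (a ^+ m * q) <= d q v + d q (a ^+ m * q) by dist_tac d.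
have g2 : 2 * R + d (a ^+ m * q) (b ^+ n * q) <= d q (a ^+ m * q) + d q (b ^+ n * q) by dist_tac d.
have g3 := gromov_chain H g1 g2.
have fix_ c e : commute c e -> d (e * q) (c * (e * q)) = d q (c * q) by exact: (dist_commute H).
have ea : d (a ^+ m * q) (a * (a ^+ m * q)) = d q (a * q) by apply: fix_; exact: commuteX.
have eb : d (b ^+ n * q) (b * (b ^+ n * q)) = d q (b * q) by apply: fix_; exact: commuteX.
have v1 : d v (a * v) <= C * mdisp d a + 0 + 2 * D.
  by apply: (disp_convex (x := q) (y := a ^+ m * q)); rewrite ?ea //; dist_tac d.
have v2 : d v (b * v) <= C * mdisp d a + D + 2 * D.
  by apply: (disp_convex (x := q) (y := b ^+ n * q)); rewrite ?eb //; dist_tac d.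
have le (x : nat) : x <= C * mdisp d a + 3 * D -> x <= (C + 1) * mdisp d a.
  by move: al; rewrite /big mulnDl; lia.
apply: (overlap_commensurable H (u := q) (v := v) (C := (C + 1)%N) (K := (C + 1)%N)) => //.
- by apply: le; move: qa; lia.
- by apply: le; move: v1; lia.
- by apply: le; move: qb; lia.
- by apply: le; move: v2; lia.
have -> : (C + 1 + 2 * (C + 1) = 3 * (C + 1))%N by clear; lia.
by rewrite -RE; dist_tac d.
Qed.

End GromovBound.

(** The constant is chosen before the metric and the base point, so it serves all [d k] and all
    centres. *)
Lemma generated_disp (G : groupType) (S : seq G) g : generates S -> exists c,
  forall (e : G -> G -> nat) q M, geodesic_metric e ->
  (forall s, s \in S -> e q (s * q) <= M) -> e q (g * q) <= c * M.
Proof.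
move=> gS; apply: (gS [set g | exists c, forall (e : G -> G -> nat) q M, geodesic_metric e ->
  (forall s, s \in S -> e q (s * q) <= M) -> e q (g * q) <= c * M]%classic) => [|s sS /=]; last first.
  by exists 1%N => e q M _ h; rewrite mul1n; exact: h.
split=> /= [|x y [c xc] [c' yc]|x [c xc]].
- by exists 0%N => e q M Me _; rewrite mul1g (dist_refl Me).
- exists (c + c')%N => e q M Me h; have := dist_tri Me (x * q) q (x * y * q).
  by rewrite -mulgA (dist_inv Me) mulnDl; have := xc _ _ _ Me h; have := yc _ _ _ Me h; dist_tac e.
by exists c => e q M Me h; rewrite -(dist_inv Me x) mulVKg (dist_sym Me); exact: xc.
Qed.

Lemma int_orbit (T : Type) (psi psi' : T -> T) x : cancel psi' psi ->
  exists v : int -> T, v 0%R = x /\ forall k, v (next k) = psi (v k).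
Proof.
move=> psiK; exists (fun k => match k with Posz n => iter n psi x | Negz n => iter n.+1 psi' x end).
split=> // -[n|[|n]].
- have -> : next (Posz n) = Posz n.+1 by rewrite /next; lia.
  exact: iterS.
- have -> : next (Negz 0) = 0%R by [].
  by rewrite /= psiK.
have -> : next (Negz n.+1) = Negz n by rewrite /next; lia.
by rewrite /= psiK.
Qed.

Lemma int_const (T : Type) (u : int -> T) : (forall k, u (next k) = u k) -> forall k, u k = u 0%R.
Proof.
move=> uE [n|n].
  by elim: n => // n IH; rewrite -IH -(uE n); congr u; rewrite /next; lia.
elim: n => [|n IH]; first by rewrite -(uE (Negz 0)); congr u.
by rewrite -IH -(uE (Negz n.+1)); congr u; rewrite /next; lia.
Qed.

Lemma uniform_bound (T : eqType) (S : seq T) (P : T -> nat -> Prop) : (forall s, exists c, P s c) ->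
  (forall s c c', c <= c' -> P s c -> P s c') -> exists c, forall s, s \in S -> P s c.
Proof.
move=> ex mono; elim: S => [|s S [c cP]]; first by exists 0%N.
have [c' c'P] := ex s; exists (c + c')%N => t; rewrite inE => /orP[/eqP->|/cP].
  by apply: mono c'P; exact: leq_addl.
by apply: mono; exact: leq_addr.
Qed.

Section Twist.
Variables (G : groupType) (D : nat) (Rad Num : nat -> nat) (d : int -> G -> G -> nat).
Hypothesis H : forall k, acyl_hyperbolic D Rad Num (d k).
Variables (f fi : G -> G).
Hypothesis fM : {morph f : x y / x * y}.
Hypothesis fiM : {morph fi : x y / x * y}.
Hypothesis fK : cancel f fi.
Hypothesis fiK : cancel fi f.
Hypothesis d_next : forall k x y, d (next k) (f x) (f y) = d k x y.
Variables (K B : nat).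
Hypothesis lip : forall k x y, d (next k) x y <= K * d k x y.
Hypothesis lip' : forall k x y, d k x y <= K * d (next k) x y.
Hypothesis quasi : forall k x y z, d (next k) x z + d (next k) y z <=
  d (next k) x y + B * (d k x z + d k y z - d k x y) + B.
Hypothesis quasi' : forall k x y z, d k x z + d k y z <=
  d k x y + B * (d (next k) x z + d (next k) y z - d (next k) x y) + B.
Variables (S : seq G) (h : G) (C : nat).
Hypothesis gS : generates S.
Hypothesis nvc : ~ virtually_cyclic G.
Hypothesis h_big : forall k, big D (d k) h.
Hypothesis hC : forall k s, s \in S -> mdisp (d k) s <= C * mdisp (d k) h.
Hypothesis hC2 : forall k s t, s \in S -> t \in S -> mdisp (d k) (s * t) <= C * mdisp (d k) h.
Hypothesis nh : ~ commensurable h (fi h).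

Let M k := hyp_metric (H k).
Let tri k := dist_tri (M k).
Let sym k := dist_sym (M k).
Let dinv k := dist_inv (M k).
Let l k := mdisp (d k) h.

Lemma l_next k : l (next k) <= K * l k.
Proof.
rewrite /l; have [y <-] := mdisp_att (d k) h; exact: leq_trans (mdisp_le _ _ y) (lip _ _ _).
Qed.

Lemma l_prev k : l k <= K * l (next k).
Proof.
rewrite /l; have [y <-] := mdisp_att (d (next k)) h; exact: leq_trans (mdisp_le _ _ y) (lip' _ _ _).
Qed.

Lemma fi_lox k : mdisp (d k) (fi h) = l (next k).
Proof.
rewrite /l; apply/eqP; rewrite eqn_leq; apply/andP; split.
  have [y <-] := mdisp_att (d (next k)) h; rewrite -[y]fiK -{2}[h]fiK -fM d_next; exact: mdisp_le.
have [y <-] := mdisp_att (d k) (fi h); rewrite -d_next fM fiK; exact: mdisp_le.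
Qed.

Lemma centre_ex : exists q : int -> G, forall k s, s \in S -> d k (q k) (s * q k) <= (C + 5) * l k.
Proof.
suff ex k : exists q, forall s, s \in S -> d k q (s * q) <= (C + 5) * l k by have [q qP] := choice ex; exists q.
have [q qP] := joint_displacement (H k) (hC k) (hC2 k).
(* As [l k] is at least [10 * D + 10], five copies of it absorb [50 * D + 30]. *)
exists q => s /qP le; apply: leq_trans le _; have := h_big k.
by rewrite /big -/(l k) mulnDl; lia.
Qed.

(** Two far points displaced little by [S] are displaced little by [h] and by its conjugates under
    [S]. By [overlap_conj] each generator would fix or invert a power of [h], and [G] would be
    virtually cyclic. *)
Lemma points_close c : exists c', forall k u v, (forall s, s \in S -> d k u (s * u) <= c * l k) ->
  (forall s, s \in S -> d k v (s * v) <= c * l k) -> d k u v <= c' * l k.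
Proof.
have [ch hch] := generated_disp h gS.
exists (overlap_const D Rad Num (2 * c + ch * c)) => k u v uS vS; rewrite leqNgt; apply/negP => far.
apply: nvc; apply: (virtually_cyclic_normalizer (H k) (h := h) gS); first exact: (big_lox (H k) (h_big k)).
have disp x s : (forall s, s \in S -> d k x (s * x) <= c * l k) -> s \in S ->
    d k x (s * h * s^-1 * x) <= (2 * c + ch * c) * l k.
  move=> xS sS; have := hch _ _ _ (M k) xS; have := xS s sS.
  have := tri k (s * x) x (s * h * s^-1 * x); have := tri k (s * (h * x)) (s * x) (s * h * s^-1 * x).
  have := dist_move (H k) s^-1 x x; rewrite invgK -!mulgA !dinv mulnDl -!mulnA (sym k (s * x) x).
  by move: (d k) => e; dist_tac e.
have le x : (forall s, s \in S -> d k x (s * x) <= c * l k) -> d k x (h * x) <= (2 * c + ch * c) * l k.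
  by move=> xS; have := hch _ _ _ (M k) xS; rewrite mulnDl mulnA; lia.
move=> s sS.
have [n n0 E] := overlap_conj (H k) (mdisp_conjX (H k) h s) (h_big k) (le u uS) (le v vS) (disp u s uS sS) (disp v s vS sS) (ltnW far).
by exists n => //; rewrite -conj_expg.
Qed.

(* For [x] a large power of [h], the map [psi y := x^-1 * f y] sends [d k] isometrically
   to [d (next k)] and moves the centre [q k] of [S] a long way along the axis of [h];
   this is incompatible with a point [v] close to [psi v]. *)
Lemma unbounded_twist : ~ exists C1, forall x, exists v, d 0%R (x^-1 * f v) v <= C1.
Proof.
move=> [C1 tw]; have [q qS] := centre_ex.
have [b1 qq] : exists b1, forall k, d k (q k) (q (next k)) <= b1 * l k.
  have [c' cP] := points_close (K * (C + 5) * K + (C + 5)); exists c' => k; apply: cP => s sS.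
    by rewrite mulnDl; apply: leq_trans (qS k s sS) (leq_addl _ _).
  apply: leq_trans (lip' _ _ _) _; rewrite mulnDl; apply: leq_trans (leq_addr _ _).
  rewrite -!mulnA leq_mul2l; apply/orP; right; apply: leq_trans (qS _ s sS) _.
  by rewrite leq_mul2l l_next orbT.
have [c cP] : exists c, forall s, s \in S -> forall k, d k (q k) (fi s * q k) <= c * l k.
  apply: uniform_bound => [s|s c c' cc' sc k]; last by apply: leq_trans (sc k) _; rewrite leq_mul2r cc' orbT.
  have [c0 c0P] := generated_disp (fi s) gS; exists (c0 * (C + 5))%N => k.
  by rewrite -mulnA; apply: c0P (M k) _; exact: qS.
(* The displacement of [f (q k)] by [s] in the next metric is that of [q k] by [fi s] in [d k], so
   [f (q k)] is again a coarse centre. *)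
have [b2 fq] : exists b2, forall k, d (next k) (f (q k)) (q (next k)) <= b2 * l (next k).
  have [c' c'P] := points_close (c * K + (C + 5)); exists c' => k; apply: c'P => s sS; rewrite mulnDl.
    rewrite -{1}(fiK s) -fM d_next; apply: leq_trans (cP s sS k) _; apply: leq_trans (leq_addr _ _).
    by rewrite -mulnA leq_mul2l l_prev orbT.
  exact: leq_trans (qS _ s sS) (leq_addl _ _).
have [ch chP] := generated_disp h gS; have [cf cfP] := generated_disp (fi h) gS.
have [Ca CaE] : exists Ca, Ca = ((ch + cf) * (C + 5))%N by eexists.
have dh k : d k (q k) (h * q k) <= Ca * l k.
  apply: leq_trans (chP _ _ _ (M k) (qS k)) _; rewrite CaE mulnA leq_mul2r.
  by apply/orP; right; rewrite leq_mul2r leq_addr orbT.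
have dfh k : d k (q k) (fi h * q k) <= Ca * l k.
  apply: leq_trans (cfP _ _ _ (M k) (qS k)) _; rewrite CaE mulnA leq_mul2r.
  by apply/orP; right; rewrite leq_mul2r leq_addl orbT.
pose b3 := (b2 * K + b2)%N; pose gam := (2 * overlap_const D Rad Num (3 * (Ca + 1)) + 4 * b3)%N.
pose C1' := ((K + 1) * C1)%N; pose beta := (b1 + b3 + K * K * b3 + K * K * b1)%N.
pose g1 := (gam + 1 + 2 * C1' + 4 * beta)%N.
pose Lam := (B * g1 * K + B * g1 + 2 * B + gam + 2).+1.
(* The factor 4 compensates the loss of [7 * D] per power in [big_mdisp_linear]; [K + 1] compares
   the displacement of [fi h] with [l k]; [b3] pays for replacing exact orbit points by [a k] and
   [b k]. *)
pose m := (4 * ((K + 1) * (Lam + b3)))%N.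
have [x xE] : exists x, x = h ^+ m by eexists.
have [v0 v0P] := tw x.
pose psi y := x^-1 * f y; pose psi' y := fi (x * y).
have psiK : cancel psi' psi by move=> y; rewrite /psi /psi' fiK mulKg.
have d_psi k y z : d (next k) (psi y) (psi z) = d k y z by rewrite /psi dinv d_next.
have [v [v0E vS]] := int_orbit v0 psiK.
have v_next k : d k (v k) (v (next k)) <= C1.
  have -> : d k (v k) (v (next k)) = d 0%R (v 0%R) (v (next 0%R)).
    by apply: (int_const (u := fun k => d k (v k) (v (next k)))) => j; rewrite !vS d_psi.
  by rewrite vS v0E sym.
pose a k := psi (q (prev k)); pose b k := psi' (q (next k)).
have near_a k : d k (h^-1 ^+ m * q k) (a k) <= b3 * l k.
  rewrite -[k]prevK; move: (prev k) => j; rewrite /a nextK /psi expVgn -xE dinv sym.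
  by apply: leq_trans (fq j) _; rewrite leq_mul2r leq_addl orbT.
have fiX n : fi h ^+ n = fi (h ^+ n).
  elim: n => [|n IH]; last by rewrite !expgS IH fiM.
  by apply: (mulgI (fi h)); rewrite -fiM !expg0 !mulg1.
have near_b k : d k (fi h ^+ m * q k) (b k) <= b3 * l k.
  rewrite /b /psi' fiM fiX -xE dinv -d_next fiK; apply: leq_trans (fq k) _.
  rewrite mulnDl; apply: leq_trans (leq_addr _ _); rewrite -mulnA leq_mul2l.
  by apply/orP; right; exact: l_next.
have far k u j : big D (d k) u -> j <= (K + 1) * mdisp (d k) u ->
    (Lam + b3) * j <= d k (q k) (u ^+ m * q k).
  move=> ub jK; apply: leq_trans (mdisp_le _ _ (q k)); have := big_mdisp_linear (H k) m ub.
  move: ub; rewrite /big /m; have [z zE] : exists z, z = mdisp (d k) (u ^+ m) by eexists.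
  rewrite -/m -zE /m; move: (Lam + b3)%N (mdisp (d k) u) jK => L y jK h1 h2.
  apply: leq_trans (leq_mul (leqnn L) jK) _; have h3 : y + 28 * D <= 4 * y by lia.
  rewrite mulnCA mulnA; move: h2; move: ((K + 1) * L)%N => W h2.
  by have := leq_mul (leqnn W) h3; move: h2; clear; lia.
have q_next' k : d (next k) (q k) (q (next k)) <= K * K * b1 * l (next k).
  apply: leq_trans (lip _ _ _) _; rewrite -!mulnA leq_mul2l; apply/orP; right.
  apply: leq_trans (qq k) _; rewrite mulnCA leq_mul2l; apply/orP; right; exact: l_prev.
have lD k : D < l k by have := h_big k; rewrite /big -/(l k); lia.
clearbody b3.
apply: (@drift_contradiction G D Rad Num d H v q a b l K C1' beta gam B Lam) => //.
- by move=> k; rewrite /a nextK -{1}(psiK (q (next k))) d_psi.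
- by move=> k; rewrite /a nextK vS d_psi.
- by move=> k; rewrite vS -{1}(psiK (q (next k))) d_psi.
- move=> k; have jl : l k <= (K + 1) * mdisp (d k) h^-1.
    by rewrite (mdispV (H k)) -/(l k) mulnDl mul1n leq_addl.
  have := far k h^-1 (l k) (bigV (H k) (h_big k)) jl; rewrite mulnDl.
  by have := tri k (a k) (q k) (h^-1 ^+ m * q k); have := near_a k; rewrite (sym k (a k)); move: (d k) => e; dist_tac e.
- move=> k; have fb : big D (d k) (fi h) by rewrite /big fi_lox; exact: h_big.
  have jl : l k <= (K + 1) * mdisp (d k) (fi h).
    by rewrite fi_lox mulnDl; apply: leq_trans (l_prev k) (leq_addr _ _).
  have := far k (fi h) (l k) fb jl; rewrite mulnDl.
  by have := tri k (b k) (q k) (fi h ^+ m * q k); have := near_b k; rewrite (sym k (b k)); move: (d k) => e; dist_tac e.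
- move=> k; have nh' : ~ commensurable h^-1 (fi h).
    move=> [i [j [i0 j0 E]]]; apply: nh; exists i, j; split=> //.
    by case: E => ->; rewrite expVgn ?invgK; auto.
  have hV : d k (q k) (h^-1 * q k) <= Ca * mdisp (d k) h^-1.
    by rewrite (mdispV (H k)) (dist_move (H k)) invgK sym; exact: dh.
  have fV : d k (q k) (fi h * q k) <= Ca * mdisp (d k) h^-1 by rewrite (mdispV (H k)); exact: dfh.
  have fl : loxodromic (d k) (fi h) by apply: (big_lox (H k)); rewrite /big fi_lox; exact: h_big.
  have := near_a k; have := near_b k; have := gromov_bound (H k) m m (bigV (H k) (h_big k)) fl nh' hV fV.
  rewrite (mdispV (H k)) -/(l k) /gam mulnDl.
  have := tri k (h^-1 ^+ m * q k) (q k) (a k); have := tri k (fi h ^+ m * q k) (q k) (b k).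
  have := tri k (a k) (h^-1 ^+ m * q k) (fi h ^+ m * q k); have := tri k (b k) (a k) (fi h ^+ m * q k).
  rewrite (sym k (b k)); move: (d k) => e; dist_tac e.
- exact: l_next.
- by move=> k; apply: leq_trans (v_next k) _; rewrite /C1' mulnDl mul1n leq_addl.
- move=> k; apply: leq_trans (lip _ _ _) _; rewrite /C1' mulnDl; apply: leq_trans (leq_addr _ _).
  by rewrite leq_mul2l v_next orbT.
- by move=> k; apply: leq_trans (qq k) _; rewrite leq_mul2r /beta -!addnA leq_addr orbT.
- by move=> k; apply: leq_trans (q_next' k) _; rewrite leq_mul2r /beta leq_addl orbT.
- move=> k; have n1 := near_b k; have n2 := near_b (next k); have n3 := q_next' k.
  have := lip k (fi h ^+ m * q k) (b k) => n4.
  have n5 : K * d k (fi h ^+ m * q k) (b k) <= K * K * b3 * l (next k).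
    rewrite -!mulnA leq_mul2l; apply/orP; right; apply: leq_trans n1 _.
    by rewrite mulnCA leq_mul2l; apply/orP; right; exact: l_prev.
  have := tri (next k) (fi h ^+ m * q k) (b k) (b (next k)).
  have := tri (next k) (fi h ^+ m * q (next k)) (fi h ^+ m * q k) (b (next k)).
  rewrite dinv (sym _ (b k) (fi h ^+ m * q k)) /beta !mulnDl; move: n1 n2 n3 n4 n5; move: (d (next k)) (d k) => e e'; dist_gen e'; dist_tac e.
- move=> k; have n1 := near_a k; have n2 := near_a (next k); have n3 := qq k.
  have := lip' k (h^-1 ^+ m * q (next k)) (a (next k)) => n4.
  have n5 : K * d (next k) (h^-1 ^+ m * q (next k)) (a (next k)) <= K * K * b3 * l k.
    rewrite -!mulnA leq_mul2l; apply/orP; right; apply: leq_trans n2 _.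
    by rewrite mulnCA leq_mul2l; apply/orP; right; exact: l_next.
  have := tri k (h^-1 ^+ m * q k) (a k) (a (next k)).
  have := tri k (h^-1 ^+ m * q (next k)) (h^-1 ^+ m * q k) (a (next k)).
  rewrite dinv (sym _ (a k) (h^-1 ^+ m * q k)) /beta !mulnDl; move: n1 n2 n3 n4 n5; move: (d (next k)) (d k) => e' e; dist_gen e'; dist_tac e.
Qed.

End Twist.

(** * Relatively hyperbolic groups *)

Lemma finite_set_bound (T : Type) (A : set T) (F : T -> nat) : finite_set A ->
  exists M, forall x, A x -> F x <= M.
Proof.
move=> /(finite_image F)/finite_seqP[s sE]; exists (\max_(i <- s) i) => x Ax.
have : [set` s]%classic (F x) by rewrite -sE; exists x.
by move=> /= Fs; exact: (leq_bigmax_seq (F := id)).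
Qed.

Lemma finite_set_cover (T : Type) (U : eqType) (A : set T) (F : T -> seq U) : finite_set A ->
  exists s : seq U, forall x y, A x -> y \in F x -> y \in s.
Proof.
move=> /(finite_image F)/finite_seqP[ss sE]; exists (flatten ss) => x y Ax yF.
apply/flattenP; exists (F x) => //; have : [set` ss]%classic (F x) by rewrite -sE; exists x.
by [].
Qed.

Section Pullback.
Variables (G : groupType) (D : nat) (Rad Num : nat -> nat) (d : G -> G -> nat) (t : G -> G).
Hypothesis H : acyl_hyperbolic D Rad Num d.
Hypothesis tM : {morph t : x y / x * y}.
Hypothesis t_bij : bijective t.

Definition pullback x y := d (t x) (t y).

Lemma pullback_acyl : acyl_hyperbolic D Rad Num pullback.
Proof.
have M := hyp_metric H; split; first split.
- by move=> x; exact: (dist_refl M).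
- by move=> x y; exact: (dist_sym M).
- by move=> y x z; exact: (dist_tri M).
- by move=> g x y; rewrite /pullback !tM (dist_inv M).
- move=> x y j jd; have [m m1 m2] := dist_geo M jd; have [t' _ tK] := t_bij.
  by exists (t' m); rewrite /pullback tK.
- by move=> x y z w; exact: (hyp_four_point H).
move=> e p q far s us sP.
have := hyp_acyl H far (s := map t s); rewrite size_map map_inj_uniq; last exact: bij_inj.
by apply=> // _ /mapP[g /sP[h1 h2] ->]; rewrite -!tM.
Qed.

End Pullback.

Section RelativelyHyperbolicGroup.
Variables (G : groupType) (n : nat) (P : 'I_n -> set G) (X : set G).
Local Notation word := (word P X).
Hypothesis P_sub : forall i, is_subgroup (P i).
Hypothesis gen : generated (X `|` \bigcup_i P i)%classic = [set: G]%classic.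
Variables (R : set word) (C : nat).
Hypothesis X_fin : finite_set X.
Hypothesis R_fin : finite_set R.
Hypothesis pres : relative_presentation R.
Hypothesis dehn : forall w, word_val w = 1 -> relative_area_le R w (C * size w).
Local Notation wdist := (wdist P_sub gen).
Local Notation wlen := (wlen P_sub gen).

Lemma wdist_acyl : exists D Rad Num, acyl_hyperbolic D Rad Num wdist.
Proof.
have [M R_size] := finite_set_bound size R_fin.
have [D Dfp] := four_point_ex P_sub gen pres dehn R_size.
have [T TP] := finite_set_cover (fun w : word =>
  [seq (word_val (take i w))^-1 * word_val (take j w) | i <- iota 0 (size w).+1, j <- iota 0 (size w).+1]) R_fin.
have TP' (s : cell P X) : R s.2.2 -> forall x y, x \in cell_verts s -> y \in cell_verts s -> x^-1 * y \in T.
  move=> Rs x y /mapP[i ii ->] /mapP[j jj ->]; apply: (TP _ _ Rs).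
  by rewrite invgM -mulgA mulKg; apply/allpairsP; exists (i, j).
have [Rad [Num acyl]] := acylindrical P_sub gen pres dehn R_size TP'.
by exists D, Rad, Num; split=> //; exact: wdist_metric.
Qed.

Lemma generates_seq : (forall i, finitely_generated (P i)) -> exists S : seq G, generates S.
Proof.
move=> P_fg; have /choice[SP SPP] : forall i, exists s : seq G, P i = generated [set` s]%classic.
  by move=> i; have [S [/finite_seqP[s ->] ->]] := P_fg i; exists s.
have /finite_seqP[s sE] := X_fin.
exists (s ++ flatten [seq SP i | i <- enum 'I_n]) => Q Qsub SQ g.
have : [set: G]%classic g by []; rewrite -gen; apply => //; split=> // x [Xx|[i _]].
  by apply: SQ; rewrite mem_cat; apply/orP; left; move: Xx; rewrite sE.
rewrite SPP; apply; split=> // y /= ys; apply: SQ; rewrite mem_cat; apply/orP; right.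
by apply/flattenP; exists (SP i) => //; apply: map_f; rewrite mem_enum.
Qed.

Lemma wlen_lipschitz (t : G -> G) : {morph t : x y / x * y} ->
  (forall i, exists K, forall p, P i p -> wlen (t p) <= K) -> exists K, forall g, wlen (t g) <= K * wlen g.
Proof.
move=> tM tP; have [K1 XK] := finite_set_bound (fun x => wlen (t x)) X_fin.
have [|i c c' cc' h p Pp|K2 PK] := @uniform_bound _ (enum 'I_n) (fun i K => forall p, P i p -> wlen (t p) <= K).
- exact: tP.
- exact: leq_trans (h p Pp) cc'.
have t1 : t 1 = 1 by apply: (mulgI (t 1)); rewrite -tM !mulg1.
have tV x : t x^-1 = (t x)^-1 by apply: (mulgI (t x)); rewrite -tM !mulgV.
exists (K1 + K2)%N => g; have [w <- <-] := wlenP P_sub gen g.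
elim: w => [|l w IH]; first by rewrite word_val_nil t1 wlen1.
rewrite word_val_cons tM mulnSr addnC; apply: leq_trans (wlenM _ _ _ _) (leq_add _ IH).
case: l => [x b|i h] /=.
  apply: leq_trans (leq_addr _ _); have := XK _ (set_mem (valP x)).
  by case: b; rewrite // tV wlenV.
by apply: leq_trans (leq_addl _ _); apply: (PK i); [rewrite mem_enum|exact: set_mem (valP h)].
Qed.

Lemma finite_ball : (forall i, finite_set (P i)) -> forall m, exists s : seq G, forall g, wlen g <= m -> g \in s.
Proof.
move=> P_fin; have /choice[SP SPP] : forall i, exists s : seq G, P i = [set` s]%classic.
  by move=> i; apply/finite_seqP.
have /finite_seqP[s sE] := X_fin; pose L := s ++ [seq x^-1 | x <- s] ++ flatten [seq SP i | i <- enum 'I_n].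
have LP (l : letter P X) : letter_val l \in L.
  rewrite !mem_cat; case: l => [x b|i h] /=.
    have xs : \val x \in s by have := set_mem (valP x); rewrite {1}sE.
    by case: b; rewrite ?xs // map_f ?orbT.
  apply/orP; right; apply/orP; right; apply/flattenP; exists (SP i); first by rewrite map_f ?mem_enum.
  by have := set_mem (valP h); rewrite {1}SPP.
suff ex m : exists B : seq G, forall w : word, size w <= m -> word_val w \in B.
  move=> m; have [B BP] := ex m; exists B => g gm; have [w ws <-] := wlenP P_sub gen g.
  by apply: BP; rewrite ws.
elim: m => [|m [B BP]]; first by exists [:: 1] => -[|//] _; rewrite word_val_nil inE.
exists (1 :: [seq l * b | l <- L, b <- B]) => -[|l w] ws; first by rewrite word_val_nil mem_head.
by rewrite word_val_cons inE; apply/orP; right; apply: allpairs_f => //; exact: BP.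
Qed.

(** [Om] collects the finitely many peripheral letters of the relators and of a geodesic word for
    some [g] outside [P i0]. As [P i0] is infinite, it has an [h] of [Om]-length at least [k], and
    [g * h] is loxodromic. *)
Lemma loxodromic_infinite i0 : P i0 <> [set: G]%classic -> infinite_set (P i0) -> exists a, loxodromic wdist a.
Proof.
move=> Pi0 Pinf; have [M R_size] := finite_set_bound size R_fin.
have [g gP] : exists g, ~ P i0 g by apply/existsNP => all; apply: Pi0; rewrite predeqE.
have [wg wgE] : exists w, w = dist_word P_sub gen 1 g by eexists.
have [Om1 Om1P] := finite_set_cover (fun w : word => flatten [seq per_val i0 l | l <- w]) R_fin.
pose Om2 := Om1 ++ flatten [seq per_val i0 l | l <- wg]; pose Om := Om2 ++ [seq x^-1 | x <- Om2].
have OmV x : x \in Om -> x^-1 \in Om.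
  rewrite !(mem_cat _ Om2) => /orP[xO|/mapP[y yO ->]]; apply/orP; [right|left]; last by rewrite invgK.
  exact: map_f.
pose k := (2 * (M * C * (size wg).+1) + 2 * size wg).+1.
have [h Ph hfar] : exists2 h, P i0 h & forall j, j < k -> h \notin ball Om j.
  apply: contrapT => no; apply: Pinf.
  apply: (@sub_finite_set _ _ [set` flatten [seq ball Om j | j <- iota 0 k]]%classic _ (finite_seq _)).
  move=> h Ph; apply: contrapT => /negP nh; apply: no; exists h => // j jk; apply: contra nh => hj.
  by apply/flattenP; exists (ball Om j) => //; rewrite map_f // mem_iota.
exists (g * h), (M * C + k)%N => m; rewrite /wdist invg1 mul1g.
apply: (peripheral_loxodromic pres dehn R_size OmV _ Ph hfar _ gP); rewrite -?wgE ?ltnSn //.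
  by move=> r Rr; apply/allP => x xr; rewrite /= !mem_cat (Om1P r).
by apply/allP => x xr; rewrite /= !mem_cat xr ?orbT.
Qed.

(** When all [P i] are finite, balls are finite. Without loxodromics all displacements are bounded,
    so [joint_displacement] conjugates every finite subset of [G] into one fixed ball; then [G] is
    finite, hence virtually cyclic. *)
Lemma loxodromic_ex : ~ virtually_cyclic G -> (forall i, P i <> [set: G]%classic) -> exists a, loxodromic wdist a.
Proof.
move=> nvc Pn; have [[i Pi]|Pfin] := pselect (exists i, infinite_set (P i)).
  exact: loxodromic_infinite (Pn i) Pi.
have {}Pfin i : finite_set (P i) by apply: contrapT => Pi; apply: Pfin; exists i.
apply: contrapT => no; apply: nvc; have [D [Rad [Num H]]] := wdist_acyl.
have small a : mdisp wdist a <= 10 * D + 10.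
  rewrite leqNgt; apply/negP => /ltnW al; apply: no; exists a; exact: (big_lox H al).
have [B BP] := finite_ball Pfin (10 * D + 10 + 50 * D + 30)%N.
have Gfin : finite_set [set: G]%classic.
  apply: (bounded_finite (N := size B)) => s us _.
  have [q qP] := joint_displacement H (fun a _ => small a) (fun a b _ _ => small (a * b)) (S := s).
  have inj : injective (fun a => q^-1 * a * q) by move=> a b /mulIg/mulgI.
  rewrite -(size_map (fun a => q^-1 * a * q)); apply: uniq_leq_size; first by rewrite map_inj_uniq.
  by move=> _ /mapP[a /qP aq ->]; apply: BP; rewrite -mulgA.
exists [set 1]%classic; split.
- by split=> [|x y -> ->|x ->]; rewrite ?mulg1 ?invg1.
- exists 1; rewrite predeqE => x; split=> [-> Q [[Q1 _ _] _] //|].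
  by apply; split=> //; split=> [|y z -> ->|y ->]; rewrite ?mulg1 ?invg1.
exact: finite_image.
Qed.

End RelativelyHyperbolicGroup.

Lemma int_step (Q : int -> Prop) : Q 0%R -> (forall k, Q k -> Q (next k)) ->
  (forall k, Q (next k) -> Q k) -> forall k, Q k.
Proof.
move=> Q0 up down [m|m]; elim: m => [|m IH] //.
- rewrite (_ : Posz m.+1 = next m); [exact: up|rewrite /next; lia].
- exact: down.
by apply: down; rewrite (_ : next (Negz m.+1) = Negz m) //; rewrite /next; lia.
Qed.

(** * Bilipschitz automorphisms and the choice of the representative *)

Section Automorphisms.
Variables (G : groupType) (len : G -> nat).

Definition bilipschitz_aut (t : G -> G) :=
  [/\ {morph t : x y / x * y}, bijective t &
      exists K, forall g, len (t g) <= K * len g /\ len g <= K * len (t g)].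

Lemma bilipschitz_comp t u : bilipschitz_aut t -> bilipschitz_aut u -> bilipschitz_aut (t \o u).
Proof.
move=> [tM tb [K tK]] [uM ub [L uL]]; split; last 1 first.
- exists (K * L)%N => g /=; have [h1 h2] := tK (u g); have [h3 h4] := uL g; split.
    by apply: leq_trans h1 _; rewrite -mulnA leq_mul2l h3 orbT.
  by apply: leq_trans h4 _; rewrite (mulnC K) -mulnA leq_mul2l h2 orbT.
- by move=> x y /=; rewrite uM tM.
- exact: bij_comp.
Qed.

Lemma bilipschitz_inv t u : cancel t u -> cancel u t -> bilipschitz_aut t -> bilipschitz_aut u.
Proof.
move=> tK uK [tM tb [K KP]]; split; last 1 first.
- by exists K => g; have [] := KP (u g); rewrite uK; auto.
- by move=> x y; apply: (bij_inj tb); rewrite tM !uK.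
- by exists t.
Qed.

End Automorphisms.

Section FiniteClasses.
Variables (G : groupType) (d : G -> G -> nat).
Hypothesis M : geodesic_metric d.

(** If [f w * x * w^-1] is the chosen representative of the class of [x], then [v = w^-1] is moved
    by exactly the length of that representative; finitely many representatives have bounded
    length. *)
Lemma finite_twisted_classes (f : G -> G) : {morph f : x y / x * y} -> ~ R_infty f ->
  exists C1, forall x, exists v, d (x^-1 * f v) v <= C1.
Proof.
move=> fM /contrapT fin.
have [C1 C1P] := finite_set_bound (fun c => d 1 (xget 1 c)) fin.
exists C1 => x; pose c := [set y | twisted_conj f x y]%classic.
have cx : c x by exists 1; have f1 : f 1 = 1 by [apply: (mulgI (f 1)); rewrite -fM !mulg1]; rewrite f1 mul1g invg1 mulg1.
have [w wr] : c (xget 1 c) by apply: (xgetPex 1 (ex_intro _ x cx)).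
exists w^-1; have fV : f w^-1 = (f w)^-1 by apply: (mulgI (f w)); rewrite -fM !mulgV; apply: (mulgI (f 1)); rewrite -fM !mulg1.
have := C1P c (ex_intro2 _ _ x I erefl); rewrite -wr -(dist_inv M (x^-1 * f w^-1) 1) mulg1.
by rewrite fV -!mulgA !mulKg.
Qed.

End FiniteClasses.

Section Assembly.
Variables (G : groupType) (n : nat) (P : 'I_n -> set G) (X : set G).
Hypothesis P_sub : forall i, is_subgroup (P i).
Hypothesis gen : generated (X `|` \bigcup_i P i)%classic = [set: G]%classic.
Hypothesis X_fin : finite_set X.
Local Notation wdist := (wdist P_sub gen).
Local Notation wlen := (wlen P_sub gen).

Lemma wlen_per i p : P i p -> wlen p <= 1.
Proof.
move=> Pp; have := wlen_le P_sub gen [:: Per X (SigSub (mem_set Pp))].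
by rewrite word_val1.
Qed.

Lemma wlenJ p g : wlen (p ^ g) <= wlen p + 2 * wlen g.
Proof.
rewrite /conjg; apply: leq_trans (wlenM _ _ _ _) _; rewrite wlenV.
apply: leq_trans (leq_add (leqnn _) (wlenM _ _ _ _)) _.
by move: (wlen p) (wlen g) => *; lia.
Qed.

Lemma bilipschitz_conj g : bilipschitz_aut wlen (fun x => x ^ g).
Proof.
have lip u : exists K, forall x, wlen (x ^ u) <= K * wlen x.
  apply: (wlen_lipschitz (t := fun x => x ^ u) X_fin) => [x y|i]; first exact: conjMg.
  by exists (1 + 2 * wlen u)%N => p /wlen_per Pp; apply: leq_trans (wlenJ p u) _; rewrite leq_add2r.
have [K1 K1P] := lip g; have [K2 K2P] := lip g^-1; split.
- by move=> x y; exact: conjMg.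
- by exists (fun x => x ^ g^-1) => x; rewrite ?conjgK ?conjgKV.
exists (K1 + K2)%N => x; have h1 := K1P x; have h2 := K2P (x ^ g); rewrite conjgK in h2.
by rewrite !mulnDl; split; lia.
Qed.

Lemma wdist_morph (t : G -> G) x y : {morph t : x y / x * y} -> wdist (t x) (t y) = wlen (t (x^-1 * y)).
Proof.
move=> tM; rewrite /wdist tM; congr (wlen (_ * _)); apply: (mulgI (t x)).
by rewrite -tM !mulgV; apply: (mulgI (t 1)); rewrite -tM !mulg1.
Qed.

Lemma bilipschitz_loxodromic t a : bilipschitz_aut wlen t ->
  loxodromic (pullback wdist t) a <-> loxodromic wdist a.
Proof.
move=> [tM _ [K KP]]; have E m : pullback wdist t 1 (a ^+ m) = wlen (t (a ^+ m)).
  by rewrite /pullback wdist_morph // invg1 mul1g.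
have E' m : wdist 1 (a ^+ m) = wlen (a ^+ m) by rewrite /wdist invg1 mul1g.
split=> -[c cP]; exists (c * K)%N => m; have [h1 h2] := KP (a ^+ m); have := cP m; rewrite E E' => h.
  by apply: leq_trans h _; rewrite -mulnA leq_mul2l h1 orbT.
by apply: leq_trans h _; rewrite -mulnA leq_mul2l h2 orbT.
Qed.

(** An automorphism in [Phi] sends each [P i] to a conjugate of some [P j], so peripheral letters
    have images of bounded length. Equality of the two sets of classes, rather than inclusion, gives
    the same for the inverse. *)
Lemma outer_bilipschitz (Phi : set (G -> G)) f : relative_Out P Phi -> Phi f -> bilipschitz_aut wlen f.
Proof.
move=> [[f0 [f0M f0b] PhiE] imE]; rewrite -PhiE => -[g _ <-].
apply: (bilipschitz_comp (t := fun x => x ^ g) (bilipschitz_conj g)).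
have [fi fK fiK] := f0b.
have fiM : {morph fi : x y / x * y} by move=> x y; apply: (bij_inj f0b); rewrite f0M !fiK.
have f0J x u : fi (x ^ u) = fi x ^ fi u.
  rewrite /conjg !fiM; congr (_ * _); apply: (mulgI (fi u)); rewrite -fiM !mulgV.
  by apply: (mulgI (fi 1)); rewrite -fiM !mulg1.
have Phi1 : Phi (fun x => f0 x ^ 1) by rewrite -PhiE; exists 1.
have Pself i : conj_class (P i) (P i).
  exists 1 => //; rewrite predeqE => x; split=> [[y Py <-]|Px]; first by rewrite conjg1.
  by exists x; rewrite ?conjg1.
have fP i : exists K, forall p, P i p -> wlen (f0 p) <= K.
  have : peripheral_classes P (outer_image Phi (conj_class (P i))).
    by rewrite -imE; exists (conj_class (P i)) => //; exists i.
  move=> [j _ jE]; have : conj_class (P j) ((fun x => f0 x ^ 1) @` P i)%classic.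
    by rewrite jE; exists (fun x => f0 x ^ 1), (P i).
  move=> [u _ uE]; exists (1 + 2 * wlen u)%N => p Pp.
  have : ((fun x => f0 x ^ 1) @` P i)%classic (f0 p) by exists p; rewrite ?conjg1.
  rewrite -uE => -[y Py <-]; apply: leq_trans (wlenJ y u) _; rewrite leq_add2r; exact: wlen_per Py.
have fiP j : exists K, forall p, P j p -> wlen (fi p) <= K.
  have : peripheral_classes P (conj_class (P j)) by exists j.
  rewrite -imE => -[_ [i _ <-] iE].
  have : conj_class (P j) (P j) by [].
  rewrite -iE => -[f1 [H1 [Phif1 [u _ uE] PjE]]]; move: Phif1; rewrite -PhiE => -[v _ vE].
  exists (1 + 2 * wlen u + 2 * wlen (fi v))%N => p; rewrite PjE -uE => -[_ [y Py <-] <-].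
  rewrite -vE f0J fK; apply: leq_trans (wlenJ _ _) _; rewrite leq_add2r.
  by apply: leq_trans (wlenJ y u) _; rewrite leq_add2r; exact: wlen_per Py.
have [K1 K1P] := wlen_lipschitz X_fin f0M fP; have [K2 K2P] := wlen_lipschitz X_fin fiM fiP.
split=> //; exists (K1 + K2)%N => x; have h1 := K1P x; have h2 := K2P (f0 x); rewrite fK in h2.
by rewrite !mulnDl; split; lia.
Qed.

End Assembly.

(** If all conjugates of [k] were commensurable with [h], each would be commensurable with [k]
    itself; by [conj_exponent] every element would fix or invert a power of [k]. *)
Lemma conj_noncommensurable (G : groupType) D Rad Num (d : G -> G -> nat) (S : seq G) h k :
  acyl_hyperbolic D Rad Num d -> generates S -> ~ virtually_cyclic G -> loxodromic d k ->
  exists u, ~ commensurable h (u * k * u^-1).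
Proof.
move=> H gS nvc kl; apply/existsNP => all; apply: nvc.
apply: (virtually_cyclic_normalizer H gS kl) => s _.
have [i [j [i0 j0 E]]] := all s; have [i' [j' [i'0 j'0 E']]] := all 1.
rewrite conj_expg in E; rewrite mul1g invg1 mulg1 in E'.
have F : s * k ^+ (j * i') * s^-1 = k ^+ (j' * i) \/ s * k ^+ (j * i') * s^-1 = k ^- (j' * i).
  rewrite (expgnA k j i') (expgnA k j' i) -conj_expg.
  by case: E => ->; case: E' => ->; rewrite ?expVgn -?expgnA ?(mulnC i' i) ?invgK; auto.
have e := conj_exponent H kl F; exists (j * i')%N; first by rewrite muln_gt0 j0.
by rewrite {2 4}e.
Qed.

Theorem theorem6p1p1 (G : groupType) (n : nat) (P : 'I_n -> set G)
    (G_fp : finitely_presented G)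
    (P_subgroup : forall i, is_subgroup (P i))
    (P_fg : forall i, finitely_generated (P i))
    (G_hyp : relatively_hyperbolic P)
    (G_nonelem : non_elementary P)
    (Phi : set (G -> G)) (Phi_out : relative_Out P Phi) :
  R_infty_outer Phi.
Proof.
have [X [R [X_fin R_fin pres [C dehn]]]] := G_hyp; have [gen _] := pres.
have [nvc Pn] := G_nonelem.
have [D [Rad [Num H]]] := wdist_acyl P_subgroup gen R_fin pres dehn.
have [S gS] := generates_seq gen X_fin P_fg.
have [a0 a0l] := loxodromic_ex P_subgroup gen X_fin R_fin pres dehn nvc Pn.
pose len := wlen P_subgroup gen; pose d0 := wdist P_subgroup gen.
(* The class contains the pullbacks by all bilipschitz automorphisms, since the representative of
   [Phi] will depend on the [h] obtained from this class. *)
pose Cl := [set d | exists2 t, bilipschitz_aut len t & d = pullback d0 t]%classic.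
have ClH d : Cl d -> acyl_hyperbolic D Rad Num d.
  by move=> [t [tM tb _] ->]; exact: pullback_acyl.
have ClL d a : Cl d -> (loxodromic d a <-> loxodromic d0 a).
  by move=> [t tB ->]; exact: bilipschitz_loxodromic.
(* Products of two generators are included because [joint_displacement] needs them. *)
have [|d Cd|h [Ch hP]] := @filling _ _ _ _ Cl a0 (S ++ [seq s * t | s <- S, t <- S]) ClH.
- by move=> d d' a /ClL dL /ClL d'L /dL/d'L.
- exact/(ClL d a0 Cd).
have [[f0 f0A PhiE] _] := Phi_out; have [f0M f0b] := f0A.
have Phif u : Phi (fun x => f0 x ^ u) by rewrite -PhiE; exists u.
have [fi0 f0K fi0K] := f0b.
have fi0M : {morph fi0 : x y / x * y} by move=> x y; apply: (bij_inj f0b); rewrite f0M !fi0K.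
have id_bil : bilipschitz_aut len id by split=> //; [exists id|exists 1%N => g; rewrite mul1n].
have f0B : bilipschitz_aut len f0.
  have := outer_bilipschitz P_subgroup gen X_fin Phi_out (Phif 1).
  by rewrite (_ : (fun x => f0 x ^ 1) = f0) //; apply/funext => x; rewrite conjg1.
have fi0B := bilipschitz_inv f0K fi0K f0B.
have fi01 : fi0 1 = 1 by apply: (mulgI (fi0 1)); rewrite -fi0M !mulg1.
have fi0_lox : loxodromic d0 (fi0 h).
  have Cf : Cl (pullback d0 fi0) by exists fi0.
  have [hb _] := hP _ Cf; have [c cP] := big_lox (ClH _ Cf) hb.
  exists c => m; have := cP m; rewrite /pullback fi01.
  suff -> : fi0 (h ^+ m) = fi0 h ^+ m by [].
  by elim: (m) => [|j IH]; rewrite ?expg0 // !expgS fi0M IH.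
have [u nh] := conj_noncommensurable h H gS nvc fi0_lox.
(* With this inner twist [fi h] becomes the conjugate of [fi0 h] by [u], which is not commensurable
   with [h]. *)
pose g := f0 u; pose f x := f0 x ^ g; pose fi y := fi0 (y ^ g^-1).
have fK : cancel f fi by move=> x; rewrite /f /fi conjgK f0K.
have fiK : cancel fi f by move=> x; rewrite /f /fi fi0K conjgKV.
have fB : bilipschitz_aut len f := outer_bilipschitz P_subgroup gen X_fin Phi_out (Phif g).
have fiB := bilipschitz_inv fK fiK fB.
have [fM _ [K KP]] := fB; have [fiM _ _] := fiB.
have fih : fi h = u * fi0 h * u^-1.
  have gV : fi0 g^-1 = u^-1 by apply: (mulgI (fi0 g)); rewrite -fi0M mulgV fi01 /g f0K mulgV.
  by rewrite /fi /conjg invgK !fi0M gV /g f0K mulgA.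
rewrite -fih in nh.
(* [th k] is the [k]-th power of [fi] for [k] of either sign; it commutes with [f], which makes [f]
   an isometry from each metric [d k] to the next. *)
have [th [th0 thS]] : exists th : int -> G -> G, th 0%R = id /\ forall k, th (next k) = fi \o th k.
  by apply: (int_orbit (psi := fun t => fi \o t) (psi' := fun t => f \o t)) => t; apply/funext => x /=.
have thP k : bilipschitz_aut len (th k) /\ forall x, th k (f x) = f (th k x).
  elim/int_step: k => [|k [kB kf]|k]; first by rewrite th0.
    by rewrite thS; split; [exact: bilipschitz_comp|move=> x /=; rewrite kf fK fiK].
  rewrite thS => -[kB kf]; have E : th k = f \o (fi \o th k) by apply/funext => x /=; rewrite fiK.
  split; first by rewrite E; exact: bilipschitz_comp.
  by move=> x; apply: (can_inj fiK); have /= -> := kf x; rewrite fK fiK.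
exists f; first exact: (Phif g).
apply: contrapT => fin; have [C1 C1P] := finite_twisted_classes (hyp_metric H) fM fin.
pose d k := pullback d0 (th k).
have dCl k : Cl (d k) by exists (th k) => //; have [] := thP k.
have lip_f x y : d0 (f x) (f y) <= K * d0 x y.
  by rewrite /d0 wdist_morph //; have [] := KP (x^-1 * y).
have lip_fi x y : d0 (fi x) (fi y) <= K * d0 x y.
  by rewrite /d0 wdist_morph //; have [_] := KP (fi (x^-1 * y)); rewrite fiK.
have [M R_size] := finite_set_bound size R_fin.
have [B BP] := gromov_product_quasi P_subgroup gen pres dehn R_size K.
have lip_fi' x y : d0 x y <= K * d0 (fi x) (fi y) by have := lip_f (fi x) (fi y); rewrite !fiK.
have lip_f' x y : d0 x y <= K * d0 (f x) (f y) by have := lip_fi (f x) (f y); rewrite !fK.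
have thE k x : th k x = f (th (next k) x) by rewrite thS /= fiK.
apply: (@unbounded_twist G D Rad Num d (fun k => ClH _ (dCl k)) f fi fM fiM fK fiK _ K B _ _ _ _ S h Ch gS nvc) => //.
- by move=> k x y; rewrite /d /pullback thS /=; have [_ kf] := thP k; rewrite !kf !fK.
- by move=> k x y; rewrite /d /pullback thS; exact: lip_fi.
- by move=> k x y; rewrite /d /pullback thS; exact: lip_fi'.
- by move=> k x y z; rewrite /d /pullback thS; exact: (BP fi).
- by move=> k x y z; rewrite /d /pullback !(thE k); exact: (BP f).
- by move=> k; have [] := hP _ (dCl k).
- by move=> k s sS; have [_] := hP _ (dCl k); apply; rewrite mem_cat sS.
- by move=> k s t sS tS; have [_] := hP _ (dCl k); apply; rewrite mem_cat allpairs_f ?orbT.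
by exists C1 => x; have [v vP] := C1P x; exists v; rewrite /d /pullback th0.
Qed.
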